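(* Consider a non-resonant capillary-gravity wave with parameters $(\beta,\kappa)$ in the super-critical region ($\mu_0(\kappa;\beta)>1$) admitting $(k_j(\sigma),k_{j'}(\sigma),1)\in\mathcal R(\sigma)$ at a non-critical $\sigma>0$ where $\dim Y(\sigma)=4$, and suppose that the two remaining real numbers $k_r,k_s$ for which $ik_r,ik_s$ are eigenvalues of $\mathbf L(i\sigma)$ satisfy $k_r,k_s\not\equiv k_j,k_{j'}\pmod\kappa$. Let $W(\delta,\gamma,\varepsilon)=\delta^2+a_1(\gamma,\varepsilon)\delta+a_0(\gamma,\varepsilon)$ be the Weierstrass polynomial associated with the expansion of the periodic Evans function at $(i\sigma,k_j(\sigma)+p\kappa;0)$ and $\mathrm{disc}(\gamma,\varepsilon)=a_1(\gamma,\varepsilon)^2-4a_0(\gamma,\varepsilon)$, which is real-valued for real $\gamma,\varepsilon$, analytic at $(0,0)$ and vanishes there. Let $$\mathrm{disc}(\gamma,\varepsilon)=W(\gamma,\varepsilon)\,h(\gamma,\varepsilon),\qquad W(\gamma,\varepsilon)=\gamma^n+b_{n-1}(\varepsilon)\gamma^{n-1}+\cdots+b_0(\varepsilon),$$ be its factorization by the Weierstrass preparation theorem with respect to $\gamma$, where $n\ge1$ is the order of vanishing of $\mathrm{disc}(\cdot,0)$ at $\gamma=0$, the $b_l$ are analytic with $b_l(0)=0$, and $h$ is analytic and non-vanishing at $(0,0)$. Then $W(\gamma,\varepsilon)$ must be quadratic, i.e. $$W(\gamma,\varepsilon)=\gamma^2+b_1(\varepsilon)\gamma+b_0(\varepsilon),$$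 and moreover $h(0,0)<0$.
   Context: **Wave.** Fix $\beta>0$, $\kappa>0$; put $T=2\pi/\kappa$, $\mu_0(k;\beta)=\frac{k}{(1+\beta k^2)\tanh k}$, $\mu_0=\mu_0(\kappa;\beta)$. A non-resonant capillary-gravity wave of small amplitude is a family $(\bar\phi(x,y),\bar\eta(x),\mu,q)$, real analytic in $\varepsilon\in\mathbb R$, $|\varepsilon|\ll1$, with $\bar\phi=\varepsilon\sin(\kappa x)\cosh(\kappa y)+O(\varepsilon^2)$, $\bar\eta=\varepsilon\sinh(\kappa)\cos(\kappa x)+O(\varepsilon^2)$, $\mu=\mu_0+O(\varepsilon^2)$, $q=O(\varepsilon^2)$, where no positive root $k\ne\kappa$ of $\mu_0(k;\beta)=\mu_0$ has $k/\kappa$ rational; $\bar\phi$ is odd in $x$, $\bar\eta$ is even in $x$ with zero mean, both are $T$-periodic in $x$, and with $\bar u=\bar\phi_x-\frac{y\bar\eta_x\bar\phi_y}{1+\bar\eta}$, $\bar z=\beta\bar\eta_x(1+\bar\eta_x^2)^{-1/2}$ they satisfy $\bar u_x-\frac{y\bar\eta_x\bar u_y}{1+\bar\eta}+\frac{\bar\phi_{yy}}{(1+\bar\eta)^2}=0$ for $0<y<1$; $\bar\phi_y=0$ at $y=0$; $(\bar u-1)\bar\eta_x-\frac{\bar\phi_y}{1+\bar\eta}=0$ and $\mu\bar z_x+\bar u-\frac{\bar u^2}{2}-\mu\bar\eta-\frac{\bar\phi_y^2}{2(1+\bar\eta)^2}+q=0$ at $y=1$. **Spectral problem.** Let $s=(1+\bar\eta_x^2)^{3/2}$.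 Perturbations $e^{\lambda t}(\phi,u,\eta,z)$ of the wave satisfy the linearized equations: for $0<y<1$, $\phi_x-\frac{y\bar\eta_x}{1+\bar\eta}\phi_y+\frac{y\bar\eta_x\bar\phi_y}{(1+\bar\eta)^2}\eta-\frac{y\bar\phi_ys}{\beta(1+\bar\eta)}z-u=0$, $u_x-\frac{y\bar\eta_x}{1+\bar\eta}u_y+\frac{y\bar\eta_x\bar u_y}{(1+\bar\eta)^2}\eta-\frac{y\bar u_ys}{\beta(1+\bar\eta)}z+\frac{\phi_{yy}}{(1+\bar\eta)^2}-\frac{2\bar\phi_{yy}}{(1+\bar\eta)^3}\eta=0$; at $y=1$, $\eta_x-\frac{s}{\beta}z=0$, $\lambda\phi-\mu z_x-u+\frac{(\bar u-1)\bar\phi_ys}{\beta(1+\bar\eta)}z+\frac{\bar\phi_y\bar\eta_x}{1+\bar\eta}u+\bar uu+\mu\eta=0$, $\lambda\eta+(\bar u-1)\frac{s}{\beta}z+\bar\eta_xu-\frac{\phi_y}{1+\bar\eta}+\frac{\bar\phi_y}{(1+\bar\eta)^2}\eta=0$; and $\phi_y=0$ at $y=0$. Replacing $\phi$ by $\varphi$ through $\phi=(1-\bar u(\cdot,1))(1+\bar\eta)s\,\varphi+\bar\eta_x(1+\bar\eta)\int_0^yy'u(\cdot,y')dy'+\big(\lambda(1+\bar\eta)+\frac{\bar\phi_y(\cdot,1)}{1+\bar\eta}\big)\frac{y^2\eta}{2}$, the last two boundary conditions become $\varphi_y(1)+z/\beta=0$, $\varphi_y(0)=0$, and the other equations become $\mathbf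 u_x=\mathbf L(\lambda)\mathbf u+\mathbf B(x;\lambda,\varepsilon)\mathbf u$, $\mathbf u=(\varphi,u,\eta,z)^T$, where $\mathbf B(x;\lambda,0)=0$, $\mathbf B$ is $T$-periodic in $x$, and $\mathbf L(\lambda)\mathbf u=\big(u-\frac{\lambda y^2z}{2\beta},\ -\varphi_{yy}-\lambda\eta,\ \frac z\beta,\ \frac{\lambda^2\eta}{2\mu_0}+\frac{\lambda\varphi(1)}{\mu_0}+\eta-\frac{u(1)}{\mu_0}\big)^T$ on $Y=H^1(0,1)\times L^2(0,1)\times\mathbb C^2$ with $\mathrm{dom}(\mathbf L)=\{\mathbf u\in H^2\times H^1\times\mathbb C^2:\varphi_y(1)+z/\beta=0,\ \varphi_y(0)=0\}$. **Resonance.** For $\sigma\in\mathbb R$, let $ik_j(\sigma)$ ($k_j(\sigma)\in\mathbb R$) be the purely imaginary eigenvalues of $\mathbf L(i\sigma)$, corresponding to the real roots $k$ of $(\sigma-k)^2=\mu_0k\tanh(k)(1+\beta k^2)$; $\sigma\neq0$ is critical if one of them is a double eigenvalue. $\mathcal R(\sigma)=\{(k_j(\sigma),k_{j'}(\sigma),N):k_j(\sigma)-k_{j'}(\sigma)=N\kappa,\ N\in\mathbb N,\ N\ge1\}$. **Periodic Evans function.** Let $Y(\sigma)$ be the (finite-dimensional) sum of generalized eigenspaces of $\mathbf L(i\sigma)$ for its purely imaginary eigenvalues, $\boldsymbol\Pi(\sigma)$ the spectral projection onto $Y(\sigma)$ commuting with $\mathbf L(i\sigma)$, $\mathcal B(\sigma)$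 an ordered basis of $Y(\sigma)$ of (generalized) eigenvectors. Put $\mathbf B(x;\sigma,\delta,\varepsilon)=\mathbf L(i\sigma+\delta)-\mathbf L(i\sigma)+\mathbf B(x;i\sigma+\delta,\varepsilon)$. By Mielke's reduction theorem, for $|\delta|,|\varepsilon|\ll1$ there is a map $\mathbf w(x,\mathbf v;\sigma,\delta,\varepsilon)$ with values in $\mathrm{dom}(\mathbf L)\cap\ker\boldsymbol\Pi(\sigma)$ such that $\mathbf v+\mathbf w$ is a bounded solution of $\mathbf u_x=\mathbf L(i\sigma+\delta)\mathbf u+\mathbf B(x;i\sigma+\delta,\varepsilon)\mathbf u$ iff $\mathbf v(x)\in Y(\sigma)$ is a bounded solution of $\mathbf v_x=\mathbf L(i\sigma)\mathbf v+\boldsymbol\Pi(\sigma)\mathbf B(x;\sigma,\delta,\varepsilon)(\mathbf v+\mathbf w(x,\mathbf v;\sigma,\delta,\varepsilon))$. In coordinates with respect to $\mathcal B(\sigma)$ this is a linear $T$-periodic ODE system $\mathbf a_x=\mathbf A(x;\sigma,\delta,\varepsilon)\mathbf a$; let $\mathbf X$ be its fundamental matrix with $\mathbf X(0)=\mathbf I$. The periodic Evans function is $\Delta(i\sigma+\delta,k;\varepsilon)=\det(e^{ikT}\mathbf I-\mathbf X(T;\sigma,\delta,\varepsilon))$, $k\in\mathbb R$. **Weierstrass polynomial.** $\Delta(i\sigma,k_j(\sigma);0)=0$. If $m$ is the multiplicity of the zero $\lambda=i\sigma$ of $\Delta(\cdot,k_j(\sigma);0)$ (here $m=2$), then for any $p\in\mathbb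 Z$ and $|\delta|,|\gamma|,|\varepsilon|\ll1$ one has $\Delta(i\sigma+\delta,k_j(\sigma)+p\kappa+\gamma;\varepsilon)=W(\delta,\gamma,\varepsilon)h(\delta,\gamma,\varepsilon)$ with $h(\delta,\gamma,\varepsilon)$ analytic, $h(0,0,0)\ne0$, and $W(\delta,\gamma,\varepsilon)$ monic of degree $m$ in $\delta$ with coefficients analytic in $(\gamma,\varepsilon)$ and vanishing at $(0,0)$. (The symbols $W,h$ with three arguments and with two arguments denote different functions.) *)

(* Defs.v *)
From HB Require Import structures.
From mathcomp Require Import all_boot all_order all_algebra.
From mathcomp Require Import all_classical all_reals all_analysis.
From mathcomp Require Import complex.

Set Implicit Arguments.
Unset Strict Implicit.
Unset Printing Implicit Defensive.

Import Order.TTheory GRing.Theory Num.Theory.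
Import numFieldNormedType.Exports.

Local Open Scope classical_set_scope.
Local Open Scope ring_scope.

Section RealAndComplexCalculus.
Context {R : realType}.
Local Notation C := R[i].
Local Notation mu := (@lebesgue_measure R).

Definition cmod (z : C) : R := ComplexField.Normc.normc z.

Definition imag (x : R) : C := Complex 0 x.

Definition cexpi (x : R) : C := Complex (cos x) (sin x).

Definition tanh (x : R) : R := (expR x - expR (- x)) / (expR x + expR (- x)).
Definition cosh (x : R) : R := (expR x + expR (- x)) / 2.
Definition sinh (x : R) : R := (expR x - expR (- x)) / 2.

(* Calculus of complex-valued functions of a real variable, componentwise. *)
Definition cderiv (f : R -> C) (x : R) : C :=
  Complex (derive1 (fun t => complex.Re (f t)) x)
          (derive1 (fun t => complex.Im (f t)) x).

Definition is_cderive (f : R -> C) (x : R) (l : C) : Prop :=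
  is_derive x 1 (fun t => complex.Re (f t)) (complex.Re l) /\
  is_derive x 1 (fun t => complex.Im (f t)) (complex.Im l).

Definition cint (a b : R) (f : R -> C) : C :=
  Complex (\int[mu]_(y in `[a, b]) complex.Re (f y))
          (\int[mu]_(y in `[a, b]) complex.Im (f y)).

(* Convergent power series at the origin, jointly in one complex variable d and
   two real variables g, e.  Functions of fewer variables are viewed as
   functions that do not depend on the missing ones. *)
Definition analytic_at0 (f : C -> R -> R -> C) : Prop :=
  exists (rho M : R) (c : nat -> nat -> nat -> C),
    [/\ 0 < rho,
        forall i j k, cmod (c i j k) * rho ^+ (i + j + k) <= M
      & forall d g e, cmod d < rho -> `|g| < rho -> `|e| < rho ->
        (fun N : nat =>
           cmod (\sum_(i < N) \sum_(j < N) \sum_(k < N)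
                   c i j k * d ^+ i * g%:C%C ^+ j * e%:C%C ^+ k - f d g e))
          @ \oo --> (0 : R)].

Definition dx (f : R -> R -> R) (x y : R) : R := derive1 (f ^~ y) x.
Definition dy (f : R -> R -> R) (x y : R) : R := derive1 (f x) y.

Definition C1 (f : R -> R -> R) : Prop :=
  [/\ forall x y, derivable (f ^~ y) x 1 /\ derivable (f x) y 1,
      continuous (fun p : R * R => f p.1 p.2),
      continuous (fun p : R * R => dx f p.1 p.2)
    & continuous (fun p : R * R => dy f p.1 p.2)].

Definition C2 (f : R -> R -> R) : Prop := [/\ C1 f, C1 (dx f) & C1 (dy f)].

(* The norm of BC^2(R x [0, 1]) is at most K. *)
Definition C2_le (f : R -> R -> R) (K : R) : Prop :=
  forall x y, 0 <= y <= 1 ->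
    [/\ `|f x y| <= K, `|dx f x y| <= K & `|dy f x y| <= K] /\
    [/\ `|dx (dx f) x y| <= K, `|dx (dy f) x y| <= K & `|dy (dy f) x y| <= K].

(* Real analyticity at 0 of a map e |-> f e with values in BC^2(R x [0, 1]). *)
Definition analytic_C2 (f : R -> R -> R -> R) : Prop :=
  exists (rho : R) (c : nat -> R -> R -> R),
    [/\ 0 < rho, forall n, C2 (c n)
      & forall e, `|e| < rho -> forall eps, 0 < eps ->
        \forall N \near \oo,
          C2_le (fun x y => f e x y - \sum_(n < N) c n x y * e ^+ n) eps].

End RealAndComplexCalculus.

Section Wave.
Context {R : realType}.
Local Notation mu := (@lebesgue_measure R).

Definition mu0 (beta k : R) : R := k / ((1 + beta * k ^+ 2) * tanh k).

Definition period (kappa : R) : R := 2 * pi / kappa.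

(* The potential is a function on R x R of which only the values on the strip
   R x [0, 1] matter; a C^2 function on the closed strip extends to R x R. *)
Record wave := Wave {
  phib : R -> R -> R;
  etab : R -> R;
  mub : R;
  qb : R }.

Definition etab_x (w : wave) (x : R) : R := derive1 (etab w) x.

Definition ub (w : wave) (x y : R) : R :=
  dx (phib w) x y - y * etab_x w x * dy (phib w) x y / (1 + etab w x).

Definition zb (beta : R) (w : wave) (x : R) : R :=
  beta * etab_x w x * (1 + etab_x w x ^+ 2) `^ (- 2^-1).

Definition sb (w : wave) (x : R) : R := (1 + etab_x w x ^+ 2) `^ (3 / 2).

Definition wave_eqs (beta : R) (w : wave) : Prop :=
  [/\ forall x y, 0 < y < 1 ->
        dx (ub w) x y - y * etab_x w x * dy (ub w) x y / (1 + etab w x)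
        + dy (dy (phib w)) x y / (1 + etab w x) ^+ 2 = 0,
      forall x, dy (phib w) x 0 = 0,
      forall x, (ub w x 1 - 1) * etab_x w x - dy (phib w) x 1 / (1 + etab w x) = 0
    & forall x, mub w * derive1 (zb beta w) x + ub w x 1 - ub w x 1 ^+ 2 / 2
        - mub w * etab w x
        - dy (phib w) x 1 ^+ 2 / (2 * (1 + etab w x) ^+ 2) + qb w = 0].

Definition wave_symmetry (kappa : R) (w : wave) : Prop :=
  [/\ forall x y, 0 <= y <= 1 -> phib w (- x) y = - phib w x y,
      forall x, etab w (- x) = etab w x,
      \int[mu]_(x in `[0, period kappa]) etab w x = 0,
      forall x y, 0 <= y <= 1 -> phib w (x + period kappa) y = phib w x y
    & forall x, etab w (x + period kappa) = etab w x].

(* Small-amplitude family, for |e| < r. *)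
Definition is_wave_family (beta kappa r : R) (w : R -> wave) : Prop :=
  [/\ [/\ analytic_C2 (fun e => phib (w e)),
          analytic_C2 (fun e x _ => etab (w e) x),
          analytic_at0 (fun _ _ e => (mub (w e))%:C%C)
        & analytic_at0 (fun _ _ e => (qb (w e))%:C%C)],
      (exists K : R, forall e, `|e| < r ->
        [/\ C2_le (fun x y => phib (w e) x y
                     - e * (sin (kappa * x) * cosh (kappa * y))) (K * e ^+ 2),
            C2_le (fun x _ => etab (w e) x
                     - e * (sinh kappa * cos (kappa * x))) (K * e ^+ 2),
            `|mub (w e) - mu0 beta kappa| <= K * e ^+ 2
          & `|qb (w e)| <= K * e ^+ 2])
    & forall e, `|e| < r ->
        [/\ C2 (phib (w e)), C2 (fun x _ => etab (w e) x),
            wave_symmetry kappa (w e) & wave_eqs beta (w e)]].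

Definition nonresonant (beta kappa : R) : Prop :=
  forall k : R, 0 < k -> k != kappa -> mu0 beta k = mu0 beta kappa ->
    ~ exists p : rat, k / kappa = ratr p.

End Wave.

Section FunctionSpaces.
Context {R : realType}.
Local Notation C := R[i].
Local Notation mu := (@lebesgue_measure R).

(* Elements (varphi, u, eta, z).  The functions are defined on all of R but
   only their restrictions to ]0, 1[ matter; see eqY. *)
Definition state : Type := ((R -> C^o) * (R -> C^o) * C^o * C^o)%type.

Definition s_phi (U : state) : R -> C := U.1.1.1.
Definition s_u (U : state) : R -> C := U.1.1.2.
Definition s_eta (U : state) : C := U.1.2.
Definition s_z (U : state) : C := U.2.

Definition sqnorm_int (f : R -> C) : R := \int[mu]_(y in `](0 : R), 1[) (cmod (f y) ^+ 2).

Definition L2 (f : R -> C) : Prop :=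
  [/\ measurable_fun `](0 : R), 1[ (fun y => complex.Re (f y)),
      measurable_fun `](0 : R), 1[ (fun y => complex.Im (f y))
    & mu.-integrable `](0 : R), 1[ (fun y => (cmod (f y) ^+ 2)%:E)].

(* H^1(0, 1) through absolutely continuous representatives.  A representative
   is constrained on the open interval only, so that its boundary values are
   the one-sided limits tr0 and tr1. *)
Definition H1 (f : R -> C) : Prop :=
  exists (g : R -> C) (c : C), L2 g /\
    forall y, 0 < y < 1 -> f y = c + cint 0 y g.

Definition H2 (f : R -> C) : Prop := H1 f /\ H1 (cderiv f).

Definition tr0 (f : R -> C) : C :=
  Complex (lim (complex.Re (f y) @[y --> 0^'+]))
          (lim (complex.Im (f y) @[y --> 0^'+])).
Definition tr1 (f : R -> C) : C :=
  Complex (lim (complex.Re (f y) @[y --> 1^'-]))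
          (lim (complex.Im (f y) @[y --> 1^'-])).

(* Y = H^1 x L^2 x C^2 with its equality and its norm. *)
Definition inY (U : state) : Prop := H1 (s_phi U) /\ L2 (s_u U).

Definition eqY (U V : state) : Prop :=
  [/\ forall y, 0 < y < 1 -> s_phi U y = s_phi V y,
      {ae mu, forall y, 0 < y < 1 -> s_u U y = s_u V y},
      s_eta U = s_eta V
    & s_z U = s_z V].

Definition normY (U : state) : R :=
  Num.sqrt (sqnorm_int (s_phi U) + sqnorm_int (cderiv (s_phi U))
            + sqnorm_int (s_u U) + cmod (s_eta U) ^+ 2 + cmod (s_z U) ^+ 2).

Definition is_derive_Y (U : R -> state) (x : R) (V : state) : Prop :=
  (fun h : R => normY ((h^-1)%:C%C *: (U (x + h) - U x) - V)) @ 0^' --> (0 : R).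

(* Bounded solutions on R of U_x = G(x, U) in Y, with values in D. *)
Definition bounded_solution (D : state -> Prop) (G : R -> state -> state)
    (U : R -> state) : Prop :=
  [/\ forall x, D (U x),
      exists K : R, forall x, normY (U x) <= K
    & forall x, is_derive_Y U x (G x (U x))].

(* b is a basis, modulo equality in Y, of the subspace S. *)
Definition Y_basis (S : state -> Prop) (n : nat) (b : 'I_n -> state) : Prop :=
  [/\ forall i, S (b i),
      forall a : 'I_n -> C, eqY (\sum_(i < n) a i *: b i) 0 -> forall i, a i = 0
    & forall U, S U -> exists a : 'I_n -> C, eqY U (\sum_(i < n) a i *: b i)].

Definition Y_dim (S : state -> Prop) (n : nat) : Prop :=
  exists b : 'I_n -> state, Y_basis S b.

End FunctionSpaces.

Section SpectralProblem.
Context {R : realType}.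
Variables (beta kappa : R).
Local Notation C := R[i].
Local Notation state := (@state R).

Definition domL (U : state) : Prop :=
  [/\ H2 (s_phi U), H1 (s_u U),
      tr1 (cderiv (s_phi U)) + s_z U / beta%:C%C = 0
    & tr0 (cderiv (s_phi U)) = 0].

Definition Lop (lam : C) (U : state) : state :=
  let m0 : C := (mu0 beta kappa)%:C%C in
  (fun y => s_u U y - lam * (y ^+ 2)%:C%C * s_z U / (2 * beta%:C%C),
   fun y => - cderiv (cderiv (s_phi U)) y - lam * s_eta U,
   s_z U / beta%:C%C,
   lam ^+ 2 * s_eta U / (2 * m0) + lam * tr1 (s_phi U) / m0
     + s_eta U - tr1 (s_u U) / m0).

(* The coefficients of the substitution
     phi = chg1 varphi + chg2 \int_0^y y' u + chg3 y^2 eta / 2. *)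
Definition chg1 (w : wave) (x : R) : C :=
  ((1 - ub w x 1) * (1 + etab w x) * sb w x)%:C%C.
Definition chg2 (w : wave) (x : R) : C :=
  (etab_x w x * (1 + etab w x))%:C%C.
Definition chg3 (w : wave) (lam : C) (x : R) : C :=
  lam * (1 + etab w x)%:C%C + (dy (phib w) x 1 / (1 + etab w x))%:C%C.

Definition phi_of (w : wave) (lam : C) (x : R) (U : state) (y : R) : C :=
  chg1 w x * s_phi U y + chg2 w x * cint 0 y (fun t => t%:C%C * s_u U t)
  + chg3 w lam x * (y ^+ 2 / 2)%:C%C * s_eta U.

(* The linearized equations solved for (phi_x, u_x, eta_x, z_x), phi being
   expressed through (varphi, u, eta). *)
Definition phi_x (w : wave) (lam : C) (x : R) (U : state) (y : R) : C :=
  let d := 1 + etab w x in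
  (y * etab_x w x / d)%:C%C * cderiv (phi_of w lam x U) y
  - (y * etab_x w x * dy (phib w) x y / d ^+ 2)%:C%C * s_eta U
  + (y * dy (phib w) x y * sb w x / (beta * d))%:C%C * s_z U
  + s_u U y.

Definition u_x (w : wave) (lam : C) (x : R) (U : state) (y : R) : C :=
  let d := 1 + etab w x in
  (y * etab_x w x / d)%:C%C * cderiv (s_u U) y
  - (y * etab_x w x * dy (ub w) x y / d ^+ 2)%:C%C * s_eta U
  + (y * dy (ub w) x y * sb w x / (beta * d))%:C%C * s_z U
  - (d ^- 2)%:C%C * cderiv (cderiv (phi_of w lam x U)) y
  + (2 * dy (dy (phib w)) x y / d ^+ 3)%:C%C * s_eta U.

Definition eta_x (w : wave) (x : R) (U : state) : C :=
  (sb w x / beta)%:C%C * s_z U.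

Definition z_x (w : wave) (lam : C) (x : R) (U : state) : C :=
  let d := 1 + etab w x in
  (mub w)%:C%C^-1 *
  (lam * tr1 (phi_of w lam x U) - tr1 (s_u U)
   + ((ub w x 1 - 1) * dy (phib w) x 1 * sb w x / (beta * d))%:C%C * s_z U
   + (dy (phib w) x 1 * etab_x w x / d)%:C%C * tr1 (s_u U)
   + (ub w x 1)%:C%C * tr1 (s_u U) + (mub w)%:C%C * s_eta U).

(* varphi_x, from the x-derivative of the substitution. *)
Definition varphi_x (w : wave) (lam : C) (x : R) (U : state) (y : R) : C :=
  (chg1 w x)^-1 *
  (phi_x w lam x U y
   - cderiv (chg1 w) x * s_phi U y
   - cderiv (chg2 w) x * cint 0 y (fun t => t%:C%C * s_u U t)
   - chg2 w x * cint 0 y (fun t => t%:C%C * u_x w lam x U t)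
   - cderiv (chg3 w lam) x * (y ^+ 2 / 2)%:C%C * s_eta U
   - chg3 w lam x * (y ^+ 2 / 2)%:C%C * eta_x w x U).

(* L(lambda) U + B(x; lambda, e) U, for the wave w = w e. *)
Definition LBop (w : wave) (lam : C) (x : R) (U : state) : state :=
  (varphi_x w lam x U, u_x w lam x U, eta_x w x U, z_x w lam x U).

Definition Bop (w : wave) (lam : C) (x : R) (U : state) : state :=
  LBop w lam x U - Lop lam U.

Definition L_eigenvalue (lam nu : C) : Prop :=
  exists U, [/\ domL U, ~ eqY U 0 & eqY (Lop lam U) (nu *: U)].

(* The kernel of (L(lam) - nu)^m, with its successive domains. *)
Fixpoint gker (lam nu : C) (m : nat) (U : state) : Prop :=
  if m is m'.+1 then domL U /\ gker lam nu m' (Lop lam U - nu *: U)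
  else eqY U 0.

Definition gen_eigenspace (lam nu : C) (U : state) : Prop :=
  exists m : nat, gker lam nu m.+1 U.

Definition critical (sigma : R) : Prop :=
  sigma != 0 /\
  exists k : R, L_eigenvalue (imag sigma) (imag k) /\
    Y_dim (gen_eigenspace (imag sigma) (imag k)) 2.

(* (k, k', N) \in R(sigma) *)
Definition resonance (sigma k k' : R) (N : nat) : Prop :=
  [/\ L_eigenvalue (imag sigma) (imag k), L_eigenvalue (imag sigma) (imag k'),
      k - k' = N%:R * kappa & (1 <= N)%N].

Definition Ysigma (sigma : R) (U : state) : Prop :=
  exists (n : nat) (g : 'I_n -> state),
    (forall i, exists k : R, gen_eigenspace (imag sigma) (imag k) (g i)) /\
    U = \sum_(i < n) g i.

Definition Ysigma_basis (sigma : R) (n : nat) (b : 'I_n -> state) : Prop :=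
  Y_basis (Ysigma sigma) b /\
  forall i, exists k : R, gen_eigenspace (imag sigma) (imag k) (b i).

(* The bounded projection of Y onto Y(sigma) that commutes with L(i sigma);
   there is only one. *)
Definition spectral_projection (sigma : R) (P : state -> state) : Prop :=
  [/\ forall U, inY U -> Ysigma sigma (P U),
      forall (a : C) U V, inY U -> inY V ->
        eqY (P (a *: U + V)) (a *: P U + P V),
      exists K : R, forall U, inY U -> normY (P U) <= K * normY U,
      forall U, Ysigma sigma U -> eqY (P U) U
    & forall U, domL U ->
        eqY (P (Lop (imag sigma) U)) (Lop (imag sigma) (P U))].

(* B(x; sigma, delta, e), for the wave w = w e. *)
Definition Bdelta (sigma : R) (w : wave) (delta : C) (x : R) (U : state) : state :=
  Lop (imag sigma + delta) U - Lop (imag sigma) U + Bop w (imag sigma + delta) x U.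

(* The reduced vector field, for the reduction function W = w(x, v). *)
Definition reduced (sigma : R) (P : state -> state) (w : wave) (delta : C)
    (W : R -> state -> state) (x : R) (v : state) : state :=
  Lop (imag sigma) v + P (Bdelta sigma w delta x (v + W x v)).

(* W is a reduction function for given delta and e: it is linear in v and
   periodic in x, has values in dom(L) /\ ker Pi, and v |-> v + W(x, v) maps the
   bounded solutions of the reduced system onto those of the full system. *)
Definition is_reduction (sigma : R) (P : state -> state) (w : wave) (delta : C)
    (W : R -> state -> state) : Prop :=
  [/\ forall x v, Ysigma sigma v -> domL (W x v) /\ eqY (P (W x v)) 0,
      forall x v v', Ysigma sigma v -> Ysigma sigma v' -> eqY v v' ->
        eqY (W x v) (W x v'),
      forall x (a : C) v v', Ysigma sigma v -> Ysigma sigma v' ->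
        eqY (W x (a *: v + v')) (a *: W x v + W x v'),
      forall x v, Ysigma sigma v -> eqY (W (x + period kappa) v) (W x v)
    & forall U : R -> state,
        bounded_solution domL (LBop w (imag sigma + delta)) U <->
        (forall x, domL (U x)) /\
        exists v : R -> state,
          bounded_solution (Ysigma sigma) (reduced sigma P w delta W) v /\
          forall x, eqY (U x) (v x + W x (v x))].

(* A(x) is the matrix, in the basis b, of the reduced vector field. *)
Definition is_coeff_matrix (sigma : R) (P : state -> state) (w : wave) (delta : C)
    (W : R -> state -> state) (n : nat) (b : 'I_n -> state) (A : R -> 'M[C]_n) : Prop :=
  forall x j, eqY (reduced sigma P w delta W x (b j)) (\sum_(i < n) A x i j *: b i).

Definition fundamental_matrix (n : nat) (A X : R -> 'M[C]_n) : Prop :=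
  X 0 = 1%:M /\
  forall x i j, is_cderive (fun t => X t i j) x ((A x *m X x) i j).

(* Delta(i sigma + delta, k; e), for the monodromy matrix XT = X(T; sigma, delta, e). *)
Definition evans (n : nat) (XT : 'M[C]_n) (k : R) : C :=
  \det ((cexpi (k * period kappa))%:M - XT).

End SpectralProblem.

Section WeierstrassPolynomials.
Context {R : realType}.
Local Notation C := R[i].

Definition Wdelta (a1 a0 : R -> R -> C) (delta : C) (gamma eps : R) : C :=
  delta ^+ 2 + a1 gamma eps * delta + a0 gamma eps.

Definition disc (a1 a0 : R -> R -> C) (gamma eps : R) : C :=
  a1 gamma eps ^+ 2 - 4 * a0 gamma eps.

Definition Wgamma (n : nat) (b : nat -> R -> C) (gamma eps : R) : C :=
  gamma%:C%C ^+ n + \sum_(l < n) b l eps * gamma%:C%C ^+ l.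

End WeierstrassPolynomials.

(* Main.v *)
(* Only eps = 0 matters.  There the wave is trivial, and each real root k of the
   dispersion relation (s - k)^2 = F k at s = sigma + tau gives an eigenvector
   of L(i s) and a bounded solution proportional to e^(i k x).  The reduction
   turns these solutions into independent solutions of the reduced system, so
   that for small tau there are at most four real roots, and, when there are
   four, the coefficient matrix is diagonalized by them and exp (i k T) is an
   eigenvalue of the monodromy matrix.  Hence the Evans function vanishes at the
   points of the two dispersion curves through (i sigma, k_j) and
   (i sigma, k_j'), provided four real roots persist for tau near 0.

   Write omega for the odd function with omega^2 = F, so that the roots solve
   s = k + omega k or s = k - omega k.  The function omega has a single
   inflection point on k > 0, by a sign-change count for the power series of
   its second derivative.  This gives the persistence of the four roots, since
   a tangency would create a fifth root nearby, and it shows that the slopes c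
   and c' of the two curves through k_j and k_j' = k_j - kappa differ, since
   equal slopes would again force five roots.

   With tau_1 and tau_2 the two curves, W(., gamma, 0) has the roots i tau_1 and
   i tau_2, so that disc(gamma, 0) = - (tau_1 - tau_2)^2 vanishes to order exactly
   two at gamma = 0, and h(0, 0) = - (c - c')^2. *)

Require Import Defs.
From HB Require Import structures.
From mathcomp Require Import all_boot all_order all_algebra.
From mathcomp Require Import all_classical all_reals all_analysis.
From mathcomp Require Import complex measurable_realfun.
From mathcomp Require Import ring lra.

Set Implicit Arguments.
Unset Strict Implicit.
Unset Printing Implicit Defensive.

Import Order.TTheory GRing.Theory Num.Theory.
Import numFieldNormedType.Exports.

Local Open Scope classical_set_scope.
Local Open Scope ring_scope.


(** * The inflection point of the dispersion curves *)

(** Counting roots does not settle every case. If [slow] touches the level [- sigma] from below at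
    its first root and from above at its third, and crosses it only at the second, no nearby level
    need be taken more than three times. Nor does the count exclude two slow roots of the same sign
    with equal slopes. Both configurations are ruled out by the shape of the group speed, decreasing
    and then increasing on [k > 0]; the second also uses [slow kappa = 0], which says that the wave
    is steady in its own frame.

    The reduction function is known only through the correspondence of bounded solutions, so the
    reduced field is never computed. Its value on a mode is forced by uniqueness of the derivative
    in Y along an explicit exponential solution.

    States are functions compared modulo [eqY], and derivatives are pointwise, with default values
    where they do not exist. Measurability of such derivatives, and regularity of H^1 functions with
    a continuous derivative, therefore have to be established before the eigenvalue equation can be
    solved. *)

Section PowerSeries.
Context {R : realType}.
Implicit Types (c : nat -> R) (f : R -> R).

Definition entire_series c f := forall x : R,
  (fun n => \sum_(i < n) c i * x ^+ i) @ \oo --> f x.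

Lemma entire_seriesD c d f g : entire_series c f -> entire_series d g ->
  entire_series (fun i => c i + d i) (fun x => f x + g x).
Proof.
move=> cf dg x; rewrite (_ : (fun n => _) =
  (fun n => \sum_(i < n) c i * x ^+ i) \+ (fun n => \sum_(i < n) d i * x ^+ i)).
  exact: cvgD (cf x) (dg x).
by apply/funext => n /=; rewrite -big_split /=; apply: eq_bigr => i _; rewrite mulrDl.
Qed.

Lemma entire_seriesZ a c f : entire_series c f ->
  entire_series (fun i => a * c i) (fun x => a * f x).
Proof.
move=> cf x; rewrite (_ : (fun n => _) =
  (fun n => a * \sum_(i < n) c i * x ^+ i)).
  exact: cvgMr (cf x).
by apply/funext => n /=; rewrite mulr_sumr; apply: eq_bigr => i _; rewrite mulrA.
Qed.

Lemma entire_series_shift j c f : entire_series c f ->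
  entire_series (fun i => if (i < j)%N then 0 else c (i - j)%N)
                (fun x => x ^+ j * f x).
Proof.
move=> cf x; rewrite -(cvg_shiftn j).
rewrite (_ : (fun n => _) = (fun n => x ^+ j * \sum_(i < n) c i * x ^+ i)).
  exact: cvgMr (cf x).
apply/funext => n /=; rewrite addnC big_split_ord /= big1 ?add0r; last first.
  by move=> i _; rewrite ltn_ord mul0r.
rewrite mulr_sumr; apply: eq_bigr => i _.
by rewrite ltnNge leq_addr /= addKn exprD mulrCA.
Qed.

Lemma entire_series_expR a :
  entire_series (fun i => a ^+ i / i`!%:R) (fun x => expR (a * x)).
Proof.
move=> x; have := @is_cvg_series_exp_coeff R (a * x).
rewrite (_ : (fun n => _) = series (exp_coeff (a * x))) //.
apply/funext => n; rewrite /series /= big_mkord; apply: eq_bigr => i _.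
by rewrite /exp_coeff /= exprMn mulrAC.
Qed.

Lemma entire_series_Xn j : entire_series (fun i => (i == j)%:R) (fun x => x ^+ j).
Proof.
move=> x; apply: cvg_near_cst; exists j.+1 => //= n /= jn.
rewrite (bigD1 (Ordinal jn)) //= eqxx mul1r big1 ?addr0 // => i.
by rewrite -val_eqE /= => /negbTE ->; rewrite mul0r.
Qed.

Lemma eq_entire_series c d f g : c =1 d -> f =1 g -> entire_series c f ->
  entire_series d g.
Proof. by move=> /funext -> /funext ->. Qed.

(* Every term satisfies c m y^m >= (y/x)^N c m x^m. *)
Lemma entire_series_one_sign_change c f N m0 x y :
  entire_series c f -> 0 < x -> x < y ->
  (forall m, (m < N)%N -> c m <= 0) -> (forall m, (N <= m)%N -> 0 <= c m) ->
  m0 != N -> c m0 != 0 -> 0 <= f x -> 0 < f y.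
Proof.
move=> cf x0 xy cneg cpos m0N cm0 fx.
have y0 : 0 < y by exact: lt_trans xy.
pose q := y / x; have q1 : 1 < q by rewrite ltr_pdivlMr // mul1r.
pose t m := c m * y ^+ m - q ^+ N * (c m * x ^+ m).
have tE m : t m = c m * x ^+ m * (q ^+ m - q ^+ N).
  rewrite /t mulrBr [_ * q ^+ N]mulrC; congr (_ - _).
  by rewrite /q expr_div_n -mulrA; congr (_ * _); rewrite mulrCA mulfV ?mulr1 // expf_neq0 // gt_eqF.
have t0 m : 0 <= t m.
  rewrite tE; case: (ltnP m N) => mN.
    rewrite mulr_le0 //; first by rewrite mulr_le0_ge0 ?cneg // exprn_ge0 // ltW.
    by rewrite subr_le0 ler_eXn2l // ltnW.
  rewrite mulr_ge0 //; first by rewrite mulr_ge0 ?cpos // exprn_ge0 // ltW.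
  by rewrite subr_ge0 ler_eXn2l.
(* The term at [N] vanishes, so strictness has to come from another nonzero coefficient. *)
have tm0 : 0 < t m0.
  rewrite lt_def t0 andbT tE !mulf_neq0 //; first by rewrite expf_neq0 // gt_eqF.
  by rewrite subr_eq0 (inj_eq (ieexprIn (lt_trans ltr01 q1) (negbT (gt_eqF q1)))).
have ct : (fun n => \sum_(i < n) t i) @ \oo --> f y - q ^+ N * f x.
  rewrite (_ : (fun n => _) = (fun n => \sum_(i < n) c i * y ^+ i) \-
     (fun n => q ^+ N * \sum_(i < n) c i * x ^+ i)).
    by apply: cvgB; [exact: cf|apply: cvgMr; exact: cf].
  by apply/funext => n /=; rewrite sumrB mulr_sumr.
have le : t m0 <= f y - q ^+ N * f x.
  apply: (cvgr_to_ge ct); exists m0.+1 => //= n /= mn.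
  rewrite (bigD1 (Ordinal mn)) //= lerDl sumr_ge0 // => i _; exact: t0.
rewrite -subr_gt0 subr0; apply: lt_le_trans tm0 _.
by apply: le_trans le _; rewrite lerBlDr lerDl mulr_ge0 // exprn_ge0 // ltW // (lt_trans ltr01).
Qed.

End PowerSeries.
Arguments entire_seriesZ {R} a {c f}.
Arguments entire_series_shift {R} j {c f}.
Arguments entire_series_expR {R} a.
Arguments entire_series_Xn {R} j.
Section InflectionFunction.
Context {R : realType}.
Implicit Types (theta x y : R).

(** The function is even, so the coefficients of odd index cancel. Since [1 / (i - j)!] equals
    [i ^_ j / i!], the factor [x ^+ j] only brings in a falling factorial, and [i!] can serve as
    common denominator for all terms of [inflection]. *)
Lemma entire_series_parity j (a : R) : entire_series
  (fun i => (~~ odd i)%:R * (2 * (i ^_ j)%:R * a ^+ (i - j)) / i`!%:R)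
  (fun x => x ^+ j * (expR (a * x) + (- 1) ^+ j * expR (- a * x))).
Proof.
have h := entire_series_shift j (entire_seriesD (entire_series_expR a)
  (entire_seriesZ ((- 1) ^+ j) (entire_series_expR (- a)))).
apply: eq_entire_series h => // i.
have fN0 k : k`!%:R != 0 :> R by rewrite pnatr_eq0 -lt0n fact_gt0.
case: ltnP => ij; first by rewrite ffact_small // mulr0 mul0r mulr0 mul0r.
have -> : i`!%:R = (i ^_ j)%:R * (i - j)`!%:R :> R by rewrite -natrM ffact_fact.
have f0 : (i ^_ j)%:R != 0 :> R by rewrite pnatr_eq0 -lt0n ffact_gt0.
have f1 := fN0 (i - j)%N.
have -> : (- 1) ^+ j * ((- a) ^+ (i - j) / (i - j)`!%:R)
   = (- 1) ^+ i * (a ^+ (i - j) / (i - j)`!%:R).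
  by rewrite [(- a) ^+ _]exprNn !mulrA -exprD subnKC.
by rewrite -signr_odd; case: (odd i) => /=; field; rewrite f0 f1.
Qed.

Arguments entire_series_parity : clear implicits.

(* With theta = beta / 4 and x = 2 k, the sign of inflection is that of the
   second derivative of sqrt (k tanh k (1 + beta k^2)). *)
Definition inflection theta x : R := let b := theta * x ^+ 2 in
  sinh x ^+ 2 * (3 * b ^+ 2 + 6 * b - 1) + x * sinh x * (6 * b ^+ 2 + 8 * b + 2)
  + x ^+ 2 * (1 + b) ^+ 2 * (1 - 2 * cosh x).

(** For even [i], this is [i!] times the coefficient of [x ^+ i] in [inflection theta]. The powers
    of 2 come from [sinh x ^+ 2 = (cosh (2 x) - 1) / 2], the bare falling factorials from [x sinh x]
    and [cosh x], and the last bracket collects the polynomial part, hence its factor [i!]. *)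
Definition inflection_num theta (i : nat) : R :=
  - (1 / 2) * 2 ^+ i + 3 * theta * (i ^_ 2)%:R * 2 ^+ (i - 2)
  + 3 / 2 * theta ^+ 2 * (i ^_ 4)%:R * 2 ^+ (i - 4)
  + 2 * (i ^_ 1)%:R + 8 * theta * (i ^_ 3)%:R + 6 * theta ^+ 2 * (i ^_ 5)%:R
  - 2 * (i ^_ 2)%:R - 4 * theta * (i ^_ 4)%:R - 2 * theta ^+ 2 * (i ^_ 6)%:R
  + i`!%:R * ((1 / 2) * (i == 0%N)%:R + (1 - 3 * theta) * (i == 2%N)%:R
     + (2 * theta - 3 / 2 * theta ^+ 2) * (i == 4%N)%:R
     + theta ^+ 2 * (i == 6%N)%:R).

Definition inflection_coeff theta (i : nat) : R :=
  (~~ odd i)%:R * inflection_num theta i / i`!%:R.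

Lemma inflection_series theta :
  entire_series (inflection_coeff theta) (inflection theta).
Proof.
have H1 := entire_seriesZ (- (1 / 4)) (entire_series_parity 0%N (2 : R)).
have H2 := entire_seriesZ (3 / 2 * theta) (entire_series_parity 2%N (2 : R)).
have H3 := entire_seriesZ (3 / 4 * theta ^+ 2) (entire_series_parity 4%N (2 : R)).
have H4 := entire_series_parity 1%N (1 : R).
have H5 := entire_seriesZ (4 * theta) (entire_series_parity 3%N (1 : R)).
have H6 := entire_seriesZ (3 * theta ^+ 2) (entire_series_parity 5%N (1 : R)).
have H7 := entire_seriesZ (- 1) (entire_series_parity 2%N (1 : R)).
have H8 := entire_seriesZ (- (2 * theta)) (entire_series_parity 4%N (1 : R)).
have H9 := entire_seriesZ (- theta ^+ 2) (entire_series_parity 6%N (1 : R)).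
have X0 := entire_seriesZ (1 / 2 : R) (entire_series_Xn 0%N).
have X2 := entire_seriesZ (1 - 3 * theta) (entire_series_Xn 2%N).
have X4 := entire_seriesZ (2 * theta - 3 / 2 * theta ^+ 2) (entire_series_Xn 4%N).
have X6 := entire_seriesZ (theta ^+ 2) (entire_series_Xn 6%N).
have H := entire_seriesD (entire_seriesD (entire_seriesD H1 (entire_seriesD H2 H3))
  (entire_seriesD (entire_seriesD H4 (entire_seriesD H5 H6))
  (entire_seriesD H7 (entire_seriesD H8 H9))))
  (entire_seriesD (entire_seriesD X0 X2) (entire_seriesD X4 X6)).
apply: eq_entire_series H => [i|x].
  have f0 : i`!%:R != 0 :> R by rewrite pnatr_eq0 -lt0n fact_gt0.
  rewrite /inflection_coeff /inflection_num !expr1n ffactn0 subn0.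
  case: (boolP (odd i)) => oi /=; last by field.
  by do 4 (case: eqP => [ei|_]; first by rewrite ei in oi); rewrite /= !mul0r !mulr0 !addr0.
rewrite /inflection /sinh /cosh !mul1r !mulN1r !mulNr !expRN.
have -> : expR (2 * x) = expR x ^+ 2 by rewrite -expRM_natl.
have e0 : expR x != 0 by rewrite gt_eqF ?expR_gt0.
by field.
Qed.

Lemma natr_ffact j i : (j <= i)%N ->
  (i ^_ j)%:R = \prod_(k < j) (i%:R - k%:R) :> R.
Proof.
move=> ji; rewrite ffact_prod natr_prod; apply: eq_bigr => k _.
by rewrite natrB // (leq_trans _ ji) // ltnW.
Qed.

(** From 6 on every falling factorial is a full product in [z], and of the polynomial part only the
    degree 6 is left, with [6! = 720]. *)
Lemma inflection_num_ge6 theta (i : nat) : (6 <= i)%N ->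
  let z : R := i%:R in let q : R := 2 ^+ (i - 4) in
  inflection_num theta i = - 8 * q + 4 * z - 2 * z ^+ 2
  + theta * (z * (z - 1) * (12 * q + 8 * (z - 2) - 4 * (z - 2) * (z - 3)))
  + theta ^+ 2 * (z * (z - 1) * (z - 2) * (z - 3)
     * (3 / 2 * q + 6 * (z - 4) - 2 * (z - 4) * (z - 5)))
  + (i == 6%N)%:R * 720 * theta ^+ 2.
Proof.
move=> i6 z q; have i4 : (4 <= i)%N by exact: leq_trans i6.
rewrite /inflection_num.
rewrite !natr_ffact; do ?[by apply: leq_trans i6].
rewrite !big_ord_recr !big_ord0 /= -/z.
have -> : 2 ^+ i = 16 * q by rewrite -{1}(subnKC i4) exprD; congr (_ * _); ring.
have -> : 2 ^+ (i - 2) = 4 * q.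
  by rewrite /q (_ : i - 2 = 2 + (i - 4))%N ?exprD; [congr (_ * _); ring|case: i i6 {z q i4} => [|[|[|[|i]]]] //= _; rewrite !subSS !subn0].
have ine k : (k < 6)%N -> (i == k) = false by move=> k6; rewrite gtn_eqF // (leq_trans k6).
rewrite (ine 0%N) // (ine 2%N) // (ine 4%N) //.
rewrite -/q; case: (i =P 6%N) => [e6|_] /=; last by rewrite !mulr0 ?mul0r ?addr0; field.
by rewrite e6 (_ : 6`! = 720)%N //; field.
Qed.

(** The series starts at [x ^+ 4]. Expressing the index 6 through the index 4 supplies the step from
    4 to 6 of the sign count, which the general step does not reach. *)
Lemma inflection_num_small theta :
  [/\ inflection_num theta 0 = 0, inflection_num theta 2 = 0,
      inflection_num theta 4 = 288 * theta - 24
    & inflection_num theta 6 = 10 / 3 * inflection_num theta 4 + (72 * 80) * theta ^+ 2].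
Proof.
split; rewrite /inflection_num /=;
repeat match goal with
| |- context [falling_factorial ?a ?b] =>
  let v := eval vm_compute in (falling_factorial a b) in
  change (falling_factorial a b) with v
| |- context [factorial ?a] =>
  let v := eval vm_compute in (factorial a) in change (factorial a) with v
| |- context [subn ?a ?b] =>
  let v := eval vm_compute in (subn a b) in change (subn a b) with v
end; rewrite ?mulr0 ?mul0r ?mulr1 ?addr0 ?add0r; by field.
Qed.



(** This is [inflection_num theta (i + 2) - 4 * inflection_num theta i] ordered by powers of
    [t = theta], with [w = i - 6], [q = 2 ^+ (i - 4)] and [d] the indicator of [i = 6]. Each
    coefficient is nonnegative and the constant one is positive. The subtracted [30 * 96 = 4 * 720]
    is the extra term of index 6, and the product before it is at least as large. *)
Lemma inflection_step_polynomial (w q d t : R) : 0 <= w -> 4 * (w + 1) <= q ->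
  d <= 1 -> 0 < t ->
  0 < 6 * w ^+ 2 + 52 * w + 96
  + t * (48 * (4 * w + 26) * (q - 4)
    + (12 * w ^+ 4 + 160 * w ^+ 3 + 588 * w ^+ 2 + 776 * w + 30 * 96))
  + t ^+ 2 * ((w + 6) * (w + 5) * (6 * (8 * w + 44) * (q - 4 * (w + 1)) +
    (6 * w ^+ 4 + 18 * w ^+ 3 + 24 * w ^+ 2 + 576 * w + 672)) - (30 * 96) * d).
Proof.
move=> w0 q4 d1 t0.
have [w2 w3 w4] : [/\ 0 <= w ^+ 2, 0 <= w ^+ 3 & 0 <= w ^+ 4] by rewrite !exprn_ge0.
have q0 : 4 <= q by lra.
have K2 : 30 * 96 <= (w + 6) * (w + 5) * (6 * (8 * w + 44) * (q - 4 * (w + 1)) +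
    (6 * w ^+ 4 + 18 * w ^+ 3 + 24 * w ^+ 2 + 576 * w + 672)).
  
  apply: ler_pM => //; first by clear -w0 w2; rewrite mulrDl !mulrDr -expr2; lra.
  have h : 0 <= (8 * w + 44) * (q - 4 * (w + 1)).
    by rewrite mulr_ge0 ?subr_ge0 // addr_ge0 // mulr_ge0.
  by rewrite -mulrA; clear -h w0 w2 w3 w4; lra.
have h2 : 0 <= (30 * 96) * (1 - d) by rewrite mulr_ge0 ?subr_ge0.
have C0 := mulr_ge0 (exprn_ge0 2 (ltW t0)) (le_trans (_ : 0 <= _ - (30 * 96) * d) (lerB K2 (lexx _))).
have A0 : 0 < 6 * w ^+ 2 + 52 * w + 96 by clear -w0 w2; lra.
have h1 : 0 <= (4 * w + 26) * (q - 4) by apply: mulr_ge0; clear -w0 q0; lra.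
have B0 : 0 <= 48 * (4 * w + 26) * (q - 4)
    + (12 * w ^+ 4 + 160 * w ^+ 3 + 588 * w ^+ 2 + 776 * w + 30 * 96).
  by rewrite -mulrA; clear -h1 w0 w2 w3 w4; lra.
have := ltr_wpDr (C0 _) (ltr_wpDr (mulr_ge0 (ltW t0) B0) A0); apply.
by move: h2; rewrite mulrBr mulr1.
Qed.

(** The factor 4 is the growth of [2 ^+ i] over two steps: in the part free of [theta] the
    exponentials cancel, and a polynomial that is positive for [i >= 6] remains. *)
Lemma inflection_num_step theta (i : nat) : 0 < theta -> (6 <= i)%N ->
  4 * inflection_num theta i < inflection_num theta i.+2.
Proof.
move=> t0 i6; rewrite !inflection_num_ge6 //; last by rewrite (leq_trans i6) // leqW.
have -> : (i.+2 == 6%N) = false by apply: gtn_eqF; exact: leq_ltn_trans i6 _.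
have -> : 2 ^+ (i.+2 - 4) = 4 * 2 ^+ (i - 4) :> R.
  by rewrite subSn ?subSn ?exprS ?mulrA //; [congr (_ * _); ring|exact: leq_trans i6|rewrite leqW // (leq_trans _ i6)].
(* A linear lower bound, with equality at [i = 6], is all that the polynomial inequality asks of the
   exponential. *)
have q4 : 4 * (i%:R - 5) <= 2 ^+ (i - 4) :> R.
  rewrite -(subnKC i6) (_ : 6 + _ - 4 = (i - 6).+2)%N; last by rewrite !addSn !subSS.
  elim: (i - 6)%N => [|k IH]; first by rewrite addn0 expr2; lra.
  rewrite exprS; have k0 : 0 <= k%:R :> R by rewrite ler0n.
  move: IH; rewrite -(addn1 k) addnA !natrD; lra.
have i2 : i.+2%:R = i%:R + 2 :> R by rewrite -addn2 natrD.
rewrite i2; set q := 2 ^+ (i - 4) in q4 *.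
have w0 : 0 <= i%:R - 6 :> R by rewrite subr_ge0 ler_nat.
set w := i%:R - 6 in w0 *; have ew : i%:R = w + 6 :> R by rewrite /w subrK.
rewrite ew in q4 *.
have d0 : (i == 6%N)%:R <= 1 :> R by case: (i == 6%N); rewrite ?ler01 ?lexx.
set d := (_ == _)%:R in d0 *.
have q5 : 4 * (w + 1) <= q by lra.
rewrite -subr_gt0.
have := inflection_step_polynomial w0 q5 d0 t0.
by congr (is_true (_ < _)); rewrite mul0r; field.
Qed.

End InflectionFunction.
Arguments inflection_series {R} theta.
Section InflectionSign.
Context {R : realType}.
Implicit Types (theta x y : R).

Lemma inflection_num_gt0S theta i : 0 < theta -> ~~ odd i -> (4 <= i)%N ->
  0 <= inflection_num theta i -> 0 < inflection_num theta i.+2.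
Proof.
move=> t0 oi i4 Di; have [_ _ D4 D6] := inflection_num_small theta.
have [i6|] := leqP 6 i.
  by apply: le_lt_trans (inflection_num_step t0 i6); rewrite mulr_ge0.
case: i oi i4 Di => [|[|[|[|[|[|i]]]]]] //= _ _ Di _.
rewrite D6; apply: ltr_wpDl; first by rewrite mulr_ge0.
by rewrite mulr_gt0 ?exprn_gt0 // mulr_gt0.
Qed.

Lemma inflection_num_ge0_mono theta i j : 0 < theta -> ~~ odd i -> (4 <= i)%N ->
  0 <= inflection_num theta i -> 0 <= inflection_num theta (i + j.*2).
Proof.
move=> t0 oi i4 Di; elim: j => [|j IH]; first by rewrite addn0.
rewrite doubleS !addnS; apply/ltW/inflection_num_gt0S => //.
  by rewrite oddD odd_double addbF.
by rewrite (leq_trans i4) // leq_addr.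
Qed.

(** Along the even indices the coefficients never return from nonnegative to negative. A series with
    one change of sign, at index [N], has the sign of its quotient by [x ^+ N], which increases. *)
Lemma inflection_sign_change theta x y : 0 < theta -> 0 < x -> x < y ->
  0 <= inflection theta x -> 0 < inflection theta y.
Proof.
move=> t0 x0 xy; have [D0 D2 D4 D6] := inflection_num_small theta.
have S := inflection_series theta.
have f0 i : 0 < i`!%:R^-1 :> R by rewrite invr_gt0 ltr0n fact_gt0.
have D6p : 0 <= inflection_num theta 4 -> 0 < inflection_num theta 6.
  by move=> ?; apply: inflection_num_gt0S.
have [exD|nD] := pselect (exists i, ~~ odd i && (0 < inflection_num theta i)).
  case: (ex_minnP exD) => N /andP[oN DN] minN.
  have N4 : (4 <= N)%N.
    by case: N oN DN {minN} => [|[|[|[|N]]]] //= _; rewrite ?D0 ?D2 ltxx.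
  have cneg m : (m < N)%N -> inflection_coeff theta m <= 0.
    move=> mN; rewrite /inflection_coeff; case: (boolP (odd m)) => om /=.
      by rewrite mul0r mul0r.
    rewrite mul1r pmulr_lle0 // leNgt; apply/negP => Dm.
    by have := minN m; rewrite om Dm leqNgt mN => /(_ isT).
  have cpos m : (N <= m)%N -> 0 <= inflection_coeff theta m.
    move=> mN; rewrite /inflection_coeff; case: (boolP (odd m)) => om /=.
      by rewrite mul0r mul0r.
    rewrite mul1r pmulr_lge0 // -(subnKC mN).
    have oNm : ~~ odd (m - N) by rewrite oddB // (negbTE om) (negbTE oN).
    rewrite -[(m - N)%N]odd_double_half (negbTE oNm) add0n.
    by rewrite inflection_num_ge0_mono // ltW.
  have [m0 [m0N cm0]] : exists m0, m0 != N /\ inflection_coeff theta m0 != 0.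
    exists N.+2; split; first by rewrite gtn_eqF // ltnW.
    rewrite /inflection_coeff /= negbK (negbTE oN) /= mul1r mulf_neq0 // ?gt_eqF //.
    by rewrite inflection_num_gt0S // ltW.
  exact: entire_series_one_sign_change S x0 xy cneg cpos m0N cm0.
(* In the remaining case no coefficient is positive. The one of [x ^+ 4] is then negative, since
   otherwise the one of [x ^+ 6] would be positive, and [inflection theta x < 0] contradicts the
   assumption. *)
have Dle i : ~~ odd i -> inflection_num theta i <= 0.
  by move=> oi; rewrite leNgt; apply/negP => Di; apply: nD; exists i; rewrite oi Di.
have D4n : inflection_num theta 4 < 0.
  by rewrite ltNge; apply/negP => /D6p; rewrite ltNge Dle.
move=> fx; exfalso; move: fx; apply/negP; rewrite -ltNge.
apply: (@le_lt_trans _ _ (inflection_coeff theta 4 * x ^+ 4)); last first.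
  by rewrite pmulr_llt0 ?exprn_gt0 // /inflection_coeff /= mul1r pmulr_llt0.
apply: (cvgr_to_le (S x)); exists 5%N => //= n /= n5.
rewrite (bigD1 (Ordinal n5)) //= gerDl sumr_le0 // => i _.
rewrite mulr_le0_ge0 ?exprn_ge0 ?(ltW x0) // /inflection_coeff.
by case: (boolP (odd i)) => oi /=; rewrite ?mul0r // mul1r pmulr_lle0 // Dle.
Qed.

End InflectionSign.

(** * The dispersion function and its derivatives *)

Section Dispersion.
Context {R : realType}.
Variables (beta m0 : R).
Implicit Types k a b : R.

Lemma expRDN_gt0 k : 0 < expR k + expR (- k).
Proof. by rewrite addr_gt0 ?expR_gt0. Qed.

Lemma tanh_gt0 k : 0 < k -> 0 < tanh k.
Proof.
by move=> k0; rewrite divr_gt0 ?expRDN_gt0 // subr_gt0 ltr_expR; lra.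
Qed.

Lemma tanhN k : tanh (- k) = - tanh k.
Proof. by rewrite /tanh opprK -opprB mulNr [expR (- k) + _]addrC. Qed.

Lemma tanh_lt1 k : tanh k < 1.
Proof.
rewrite ltr_pdivrMr ?expRDN_gt0 // mul1r.
by have := expR_gt0 (- k); lra.
Qed.

Lemma tanh_gtN1 k : - 1 < tanh k.
Proof. by rewrite ltrNl -tanhN tanh_lt1. Qed.

Global Instance is_derive_tanh k : is_derive k 1 tanh (1 - tanh k ^+ 2).
Proof.
have e0 : expR k + expR (- k) != 0 by rewrite gt_eqF ?expRDN_gt0.
have d1 : is_derive k 1 (fun x => expR (- x)) (- expR (- k)).
  have -> : - expR (- k) = expR (- k) * - 1 by rewrite mulrN1.
  exact: is_derive1_comp.
pose N (x : R) := expR x - expR (- x); pose D (x : R) := expR x + expR (- x).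
have dN : is_derive k 1 N (expR k - - expR (- k)) by exact: is_deriveB.
have dD : is_derive k 1 D (expR k + - expR (- k)) by exact: is_deriveD.
have dV : is_derive k 1 (fun x => (D x)^-1) (- (D k) ^- 2 *: (expR k + - expR (- k))).
  exact: is_deriveV.
apply: (is_derive_eq (is_deriveM dN dV)); rewrite /N /D.
by rewrite /tanh /GRing.scale /=; field.
Qed.

(* The dispersion relation at sigma reads (sigma - k)^2 = disprel k. *)
Definition disprel k : R := m0 * (k * tanh k * (1 + beta * k ^+ 2)).
Definition disprel' k : R :=
  m0 * ((1 + 3 * beta * k ^+ 2) * tanh k + (k + beta * k ^+ 3) * (1 - tanh k ^+ 2)).
Definition disprel'' k : R :=
  m0 * (6 * beta * k * tanh k + 2 * (1 + 3 * beta * k ^+ 2) * (1 - tanh k ^+ 2)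
   - 2 * (k + beta * k ^+ 3) * tanh k * (1 - tanh k ^+ 2)).

Lemma is_derive_disprel k : is_derive k 1 disprel (disprel' k).
Proof.
have h1 : is_derive k 1 (fun x : R => m0 * (x + beta * x ^+ 3)) (m0 * (1 + beta * (3 * k ^+ 2))).
  apply: is_derive_eq; rewrite /GRing.scale /=; ring.
have := is_deriveM h1 (is_derive_tanh k).
rewrite (_ : _ * _ = disprel); last first.
  by apply/funext => x; rewrite /disprel /=; change ((m0 * (x + beta * x ^+ 3)) * tanh x = m0 * (x * tanh x * (1 + beta * x ^+ 2))); ring.
by move=> h; apply: (is_derive_eq h); rewrite /disprel' /GRing.scale /=; ring.
Qed.

Lemma is_derive_disprel' k : is_derive k 1 disprel' (disprel'' k).
Proof.
have h1 : is_derive k 1 (fun x : R => m0 * (1 + 3 * beta * x ^+ 2)) (m0 * (3 * beta * (2 * k))).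
  apply: is_derive_eq; rewrite /GRing.scale /=; ring.
have h2 : is_derive k 1 (fun x : R => m0 * (x + beta * x ^+ 3)) (m0 * (1 + beta * (3 * k ^+ 2))).
  apply: is_derive_eq; rewrite /GRing.scale /=; ring.
have h3 : is_derive k 1 (fun x : R => 1 - tanh x ^+ 2) (- 2 * tanh k * (1 - tanh k ^+ 2)).
  apply: is_derive_eq; rewrite /GRing.scale /=; ring.
have := is_deriveD (is_deriveM h1 (is_derive_tanh k)) (is_deriveM h2 h3).
rewrite (_ : _ + _ = disprel'); last first.
  apply/funext => x; rewrite /disprel'.
  change (m0 * (1 + 3 * beta * x ^+ 2) * tanh x + m0 * (x + beta * x ^+ 3) * (1 - tanh x ^+ 2)
    = m0 * ((1 + 3 * beta * x ^+ 2) * tanh x + (x + beta * x ^+ 3) * (1 - tanh x ^+ 2))).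
  by ring.
by move=> h; apply: (is_derive_eq h); rewrite /disprel'' /GRing.scale /=; ring.
Qed.

(** With [omega ^+ 2 = F], the left side is [4 F^(3/2)] times the second derivative of [omega].
    Doubling the angle turns products of hyperbolic functions of [k] into functions of [2 k], and
    [beta k^2 = (beta / 4) (2 k)^2] explains the parameter. *)
Lemma disprel_inflection k :
  2 * disprel k * disprel'' k - disprel' k ^+ 2
  = m0 ^+ 2 * (1 - tanh k ^+ 2) ^+ 2 / 4 * inflection (beta / 4) (2 * k).
Proof.
rewrite /disprel /disprel' /disprel'' /inflection /tanh /sinh /cosh.
have -> : expR (- (2 * k)) = (expR k ^+ 2)^-1 by rewrite expRN expRM_natl.
have -> : expR (2 * k) = expR k ^+ 2 by rewrite expRM_natl.
rewrite !expRN.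
have e0 : expR k != 0 by rewrite gt_eqF ?expR_gt0.
have e1 : expR k * expR k + 1 != 0.
  by rewrite gt_eqF // addr_gt0 // mulr_gt0 ?expR_gt0.
by field; rewrite e0 e1.
Qed.

End Dispersion.
Section RealFunctions.
Context {R : realType}.
Implicit Types (f : R -> R) (a b c : R).

Lemma derive_pos_lt f (df : R -> R) a b : a < b -> {within `[a, b], continuous f} ->
  (forall x, a < x < b -> is_derive x 1 f (df x)) ->
  (forall x, a < x < b -> 0 < df x) -> f a < f b.
Proof.
move=> ab cf df1 df0.
have [x] := MVT ab (fun x (xab : x \in `]a, b[) => df1 x xab) cf.
rewrite in_itv /= => /df0 dx0 e; rewrite -subr_gt0 e.
by rewrite mulr_gt0 // subr_gt0.
Qed.

Lemma derive_neg_gt f (df : R -> R) a b : a < b -> {within `[a, b], continuous f} ->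
  (forall x, a < x < b -> is_derive x 1 f (df x)) ->
  (forall x, a < x < b -> df x < 0) -> f b < f a.
Proof.
move=> ab cf df1 df0.
have [x] := MVT ab (fun x (xab : x \in `]a, b[) => df1 x xab) cf.
rewrite in_itv /= => /df0 dx0 e; rewrite -subr_lt0 e.
by rewrite pmulr_llt0 // subr_gt0.
Qed.

Lemma root_between f c a b : continuous f -> a < b ->
  (f a - c) * (f b - c) < 0 -> exists2 x, a < x < b & f x = c.
Proof.
move=> cf ab s.
have fa : f a != c by apply/eqP => e; rewrite e subrr mul0r ltxx in s.
have fb : f b != c by apply/eqP => e; rewrite e subrr mulr0 ltxx in s.
have : Num.min (f a) (f b) <= c <= Num.max (f a) (f b).
  by rewrite ge_min le_max; apply/andP; split; apply/orP;
    case: (leP (f a) c) => h1; case: (leP (f b) c) => h2;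
    try (by left); try (by right); try (by left; apply: ltW);
    try (by right; apply: ltW); exfalso; nra.
move=> /(IVT (ltW ab) (continuous_subspaceT cf)) [x xab fx]; exists x => //.
move: xab; rewrite in_itv /= => /andP[ax xb].
rewrite !lt_neqAle ax xb !andbT; apply/andP; split.
  by apply: contraNneq fa => ->; rewrite fx.
by apply: contraNneq fb => <-; rewrite fx.
Qed.

(** The intermediate value theorem puts one root into each gap of the chain. The bound [p < x] is
    carried through the induction to show that the roots are distinct. *)
Lemma roots_alternating f c (p q : R) (s : seq R) : continuous f ->
  path <%R p (q :: s) ->
  path (fun a b => (f a - c) * (f b - c) < 0) p (q :: s) ->
  exists t : seq R, [/\ uniq t, size t = (size s).+1,
    forall x, x \in t -> f x = c & forall x, x \in t -> p < x].
Proof.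
move=> cf; elim: s p q => [|q' s IH] p q /=.
  move=> /andP[pq _] /andP[fpq _]; have [x /andP[px xq] fx] := root_between cf pq fpq.
  by exists [:: x]; split => // y; rewrite inE => /eqP ->.
move=> /andP[pq h] /andP[fpq h']; have [x /andP[px xq] fx] := root_between cf pq fpq.
have [t [ut st ft qt]] := IH _ _ h h'.
exists (x :: t); split => /=.
- by rewrite ut andbT; apply/negP => /qt; rewrite ltNge (ltW xq).
- by rewrite st.
- by move=> y; rewrite inE => /orP[/eqP ->|/ft].
- by move=> y; rewrite inE => /orP[/eqP ->|/qt /(lt_trans (lt_trans px xq))].
Qed.

End RealFunctions.

Section GroupSpeed.
Context {R : realType}.
Variables (beta m0 : R).
Hypotheses (beta_gt0 : 0 < beta) (m0_gt0 : 0 < m0).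
Local Notation F := (disprel beta m0).
Local Notation F' := (disprel' beta m0).
Local Notation F'' := (disprel'' beta m0).
Implicit Types k a b c : R.

Lemma disprel0 : F 0 = 0.
Proof. by rewrite /disprel !mul0r mulr0. Qed.

Lemma disprelN k : F (- k) = F k.
Proof. by rewrite /disprel tanhN sqrrN mulrNN. Qed.

Lemma disprel_gt0_pos k : 0 < k -> 0 < F k.
Proof.
move=> k0; have h : 0 < 1 + beta * k ^+ 2.
  by apply: addr_gt0 => //; apply: mulr_gt0; rewrite ?exprn_gt0.
rewrite /disprel; apply: mulr_gt0 => //; apply: mulr_gt0 => //.
by apply: mulr_gt0; rewrite ?tanh_gt0.
Qed.

Lemma disprel_gt0 k : k != 0 -> 0 < F k.
Proof.
rewrite neq_lt => /orP[k0|]; last exact: disprel_gt0_pos.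
by rewrite -disprelN disprel_gt0_pos // oppr_gt0.
Qed.

Lemma disprel_ge0 k : 0 <= F k.
Proof. by have [->|/disprel_gt0/ltW//] := eqVneq k 0; rewrite disprel0. Qed.

Lemma sech2_gt0 k : 0 < 1 - tanh k ^+ 2.
Proof.
rewrite (_ : 1 - _ = (1 - tanh k) * (1 + tanh k)); last by ring.
by rewrite mulr_gt0 // ?subr_gt0 ?tanh_lt1 // -ltrBlDl sub0r tanh_gtN1.
Qed.

Lemma disprel'_gt0 k : 0 < k -> 0 < F' k.
Proof.
move=> k0.
have h1 : 0 < 1 + 3 * beta * k ^+ 2.
  by apply: addr_gt0 => //; apply: mulr_gt0; rewrite ?exprn_gt0 // mulr_gt0.
have h2 : 0 < k + beta * k ^+ 3.
  by apply: addr_gt0 => //; apply: mulr_gt0; rewrite ?exprn_gt0.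
by apply: mulr_gt0 => //; apply: addr_gt0; apply: mulr_gt0; rewrite ?tanh_gt0 ?sech2_gt0.
Qed.

Definition group_speed k : R := F' k / (2 * Num.sqrt (F k)).

Lemma is_derive_sqrt_disprel k : k != 0 ->
  is_derive k 1 (fun x => Num.sqrt (F x)) (group_speed k).
Proof.
move=> k0; rewrite /group_speed mulrC.
have h1 := is_derive1_sqrt (disprel_gt0 k0).
have h2 := is_derive_disprel beta m0 k.
exact: is_derive1_comp.
Qed.

Lemma is_derive_group_speed k : k != 0 -> is_derive k 1 group_speed
  ((2 * F k * F'' k - F' k ^+ 2) / (4 * F k * Num.sqrt (F k))).
Proof.
move=> k0; have F0 := disprel_gt0 k0; have s0 : 0 < Num.sqrt (F k) by rewrite sqrtr_gt0.
have h1 := is_derive_disprel' beta m0 k.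
have h2 : is_derive k 1 (fun x => 2 * Num.sqrt (F x)) (2 * group_speed k).
  have h := is_derive_sqrt_disprel k0.
  by apply: (is_derive_eq (is_deriveZ _ h)).
have h3 : is_derive k 1 (fun x => (2 * Num.sqrt (F x))^-1)
   (- (2 * Num.sqrt (F k)) ^- 2 *: (2 * group_speed k)).
  by apply: is_deriveV; rewrite gt_eqF // mulr_gt0.
apply: (is_derive_eq (is_deriveM h1 h3)); rewrite /group_speed /GRing.scale /=.
have := sqr_sqrtr (ltW F0); set s := Num.sqrt (F k) in s0 *; move=> <-.
by field; rewrite gt_eqF.
Qed.

Lemma group_speed_gt0 k : 0 < k -> 0 < group_speed k.
Proof. by move=> k0; rewrite divr_gt0 ?disprel'_gt0 // mulr_gt0 // sqrtr_gt0 disprel_gt0_pos. Qed.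

(* omega has a single inflection point, so the group speed first decreases and
   then increases. *)
Lemma group_speed_quasiconvex a b : 0 < a -> a < b ->
  group_speed a = group_speed b ->
  (forall c, 0 < c < a -> group_speed a < group_speed c) /\
  (forall c, a < c < b -> group_speed c < group_speed a).
Proof.
move=> a0 ab e; set h := inflection (beta / 4).
(* The positive factor between the derivative of the group speed and [inflection]. *)
pose w k := m0 ^+ 2 * (1 - tanh k ^+ 2) ^+ 2 / 4 / (4 * F k * Num.sqrt (F k)).
have w0 k : 0 < k -> 0 < w k.
  move=> k0; have F0 := disprel_gt0_pos k0.
  apply: divr_gt0; last by apply: mulr_gt0; [exact: mulr_gt0|rewrite sqrtr_gt0].
  by apply: divr_gt0 => //; apply: mulr_gt0; apply: exprn_gt0 => //; exact: sech2_gt0.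
have dg k : 0 < k -> is_derive k 1 group_speed (w k * h (2 * k)).
  move=> k0; apply: (is_derive_eq (is_derive_group_speed (lt0r_neq0 k0))).
  by rewrite disprel_inflection /w mulrAC.
have cg x y : 0 < x -> {within `[x, y], continuous group_speed}.
  move=> x0; apply: derivable_within_continuous => z; rewrite in_itv /= => /andP[xz _].
  by have [] := dg z (lt_le_trans x0 xz).
have hs x y : 0 < x -> x < y -> 0 <= h (2 * x) -> 0 < h (2 * y).
  move=> x0 xy; apply: inflection_sign_change; first by rewrite divr_gt0.
    by rewrite mulr_gt0.
  by rewrite ltr_pM2l.
(* Equal speeds at [a] and [b] give a zero of the derivative between them. By the single sign change
   the speed decreases up to [x] and increases after it. *)
have [x xab] : exists2 x, a < x < b & h (2 * x) = 0.
  have [x] := MVT ab (fun x (xab : x \in `]a, b[) =>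
    dg x (lt_trans a0 (proj1 (andP xab)))) (cg a b a0).
  rewrite in_itv /= => xab /eqP; rewrite e subrr eq_sym mulf_eq0 subr_eq0 (gt_eqF ab) orbF.
  rewrite mulf_eq0 gt_eqF ?w0 //=; last by case/andP: xab => /(lt_trans a0).
  by move=> /eqP hx; exists x.
move=> hx; move/andP: xab => [ax xb]; have x0 := lt_trans a0 ax.
have dec y z : 0 < y -> y < z -> z <= x -> group_speed z < group_speed y.
  move=> y0 yz zx; apply: (@derive_neg_gt _ _ (fun k => w k * h (2 * k)) _ _ yz (cg _ _ y0)) => t /andP[yt tz].
    by apply: dg; exact: lt_trans yt.
  have t0 := lt_trans y0 yt; rewrite pmulr_rlt0 ?w0 // ltNge; apply/negP => h0.
  by have := hs t x t0 (lt_le_trans tz zx) h0; rewrite hx ltxx.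
have inc y z : x <= y -> y < z -> group_speed y < group_speed z.
  move=> xy yz; have y0 := lt_le_trans x0 xy.
  apply: (@derive_pos_lt _ _ (fun k => w k * h (2 * k)) _ _ yz (cg _ _ y0)) => t /andP[yt tz].
    by apply: dg; exact: lt_trans yt.
  have t0 := lt_trans y0 yt; rewrite mulr_gt0 ?w0 //.
  by apply: (hs x t x0 (le_lt_trans xy yt)); rewrite hx.
split=> c /andP[c1 c2]; first by apply: dec => //; exact: ltW.
have [cx|xc] := leP c x; first exact: dec.
by rewrite e; apply: inc => //; exact: ltW.
Qed.

End GroupSpeed.

(** * Real roots of the dispersion relation *)

Section DispersionBranches.
Context {R : realType}.
Variables (beta m0 : R).
Hypotheses (beta_gt0 : 0 < beta) (m0_gt0 : 0 < m0).
Local Notation F := (disprel beta m0).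
Local Notation cg := (group_speed beta m0).
Implicit Types (k s x y c tau : R).

(** The sign makes [omega] increasing on the whole line. Hence [k + omega k] is injective and
    accounts for exactly one root at each positive frequency, while the others form a level set of
    [k - omega k]. *)
Definition omega k : R := Num.sg k * Num.sqrt (F k).

Lemma omega0 : omega 0 = 0.
Proof. by rewrite /omega sgr0 mul0r. Qed.

Lemma omegaN k : omega (- k) = - omega k.
Proof. by rewrite /omega sgrN disprelN mulNr. Qed.

Lemma omega_pos k : 0 <= k -> omega k = Num.sqrt (F k).
Proof.
rewrite le_eqVlt => /predU1P[<-|k0]; first by rewrite omega0 disprel0 sqrtr0.
by rewrite /omega gtr0_sg // mul1r.
Qed.

Lemma omega_gt0 k : 0 < k -> 0 < omega k.
Proof. by move=> k0; rewrite omega_pos ?ltW // sqrtr_gt0 disprel_gt0_pos. Qed.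

Lemma omega_eq0 k : (omega k == 0) = (k == 0).
Proof.
have [->|k0] := eqVneq k 0; first by rewrite omega0 eqxx.
apply/negbTE; rewrite /omega mulf_neq0 ?sgr_eq0 //.
by rewrite gt_eqF // sqrtr_gt0 disprel_gt0.
Qed.

Lemma omega_sqr k : omega k ^+ 2 = F k.
Proof.
rewrite exprMn sqr_sqrtr ?disprel_ge0 //.
have [->|k0] := eqVneq k 0; first by rewrite disprel0 mulr0.
by rewrite sqr_sg k0 mul1r.
Qed.

Lemma near_pos k : 0 < k -> \forall y \near k, 0 < y.
Proof. by move=> k0; apply: lt_nbhsr. Qed.

Lemma is_derive_omega k : k != 0 -> is_derive k 1 omega (cg `|k|).
Proof.
move=> k0; wlog k1 : k k0 / 0 < k.
  move=> H; have [/H|kn|/eqP] := ltgtP 0 k; [exact| |by rewrite eq_sym (negbTE k0)].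
  have /H h : 0 < - k by rewrite oppr_gt0.
  have h1 := h (lt0r_neq0 _).
  have -> : omega = (fun x => - omega (- x)) by apply/funext => x; rewrite omegaN opprK.
  have h2 : is_derive k 1 (fun x => omega (- x)) (cg `|- k| * - 1).
    by have := @is_derive1_comp R omega -%R k _ _ (h1 _) _; apply; rewrite oppr_gt0.
  by apply: (is_derive_eq (is_deriveN h2)); rewrite mulrN1 opprK normrN.
rewrite gtr0_norm //; have h := is_derive_sqrt_disprel beta_gt0 m0_gt0 k0.
apply: near_eq_is_derive h.
near=> y; rewrite omega_pos //; apply/ltW; near: y; exact: near_pos.
Unshelve. all: by end_near. Qed.

Lemma continuous_omega : continuous omega.
Proof.
have cF : continuous (fun x => Num.sqrt (F x)).
  move=> x; apply: (@continuous_comp _ _ _ F Num.sqrt); last exact: sqrt_continuous.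
  have [h _] := is_derive_disprel beta m0 x.
  by apply: differentiable_continuous; apply/derivable1_diffP.
move=> k; have [->|k0] := eqVneq k 0; last first.
  have [h _] := is_derive_omega k0.
  by apply: differentiable_continuous; apply/derivable1_diffP.
apply/(@cvgrPdist_lt _ R^o) => e e0.
have := cF 0 => /(@cvgrPdist_lt _ R^o) /(_ e e0); apply: filterS => x.
rewrite omega0 disprel0 sqrtr0 !sub0r !normrN; apply: le_lt_trans.
rewrite /omega normrM normr_sg ger0_norm //.
by case: (x != 0); rewrite ?mul1r // mul0r sqrtr_ge0.
Qed.

Lemma omega_mono_pos x y : 0 <= x -> x < y -> omega x < omega y.
Proof.
move=> x0 xy; apply: (@derive_pos_lt _ _ (fun k => cg `|k|) _ _ xy).
- exact: continuous_subspaceT continuous_omega.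
- by move=> z /andP[xz _]; apply: is_derive_omega; rewrite gt_eqF // (le_lt_trans x0).
- move=> z /andP[xz _]; have z0 := le_lt_trans x0 xz.
  by rewrite gtr0_norm // group_speed_gt0.
Qed.

Lemma omega_mono x y : x < y -> omega x < omega y.
Proof.
move=> xy; have [x0|x0] := leP 0 x; first exact: omega_mono_pos.
have [y0|y0] := leP y 0.
  by rewrite -ltrN2 -!omegaN omega_mono_pos ?oppr_ge0 // ltrN2.
apply: (@lt_trans _ _ 0); last exact: omega_gt0.
by rewrite -oppr_gt0 -omegaN omega_gt0 // oppr_gt0.
Qed.

(** From [exp (2 x) >= 1 + 2 x >= 3]; it serves to bound [F] below by a cubic. *)
Lemma tanh_ge_half x : 1 <= x -> 1 / 2 <= tanh x.
Proof.
move=> x1; rewrite ler_pdivlMr ?expRDN_gt0 //.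
have h := expR_ge1Dx (2 * x); have p := expR_gt0 (- x).
have : expR x = expR (2 * x) * expR (- x) by rewrite -expRD; congr expR; ring.
by move=> ->; nra.
Qed.

(* The dispersion relation at s reads s = k + omega k or s = k - omega k, that
   is, slow k = - s. *)
Definition slow k : R := omega k - k.

Lemma slow0 : slow 0 = 0. Proof. by rewrite /slow omega0 subr0. Qed.

Lemma slowN k : slow (- k) = - slow k.
Proof. by rewrite /slow omegaN; ring. Qed.

Lemma continuous_slow : continuous slow.
Proof. by move=> x; apply: cvgB; [exact: continuous_omega|exact: cvg_id]. Qed.

Lemma slow_unbounded x c : exists2 y, x < y & c < slow y.
Proof.
(* For [y >= 1] one has [F y >= a * y ^+ 3]. With [a * y > 4] this gives [omega y >= 2 * y], so that
   [slow y >= y > c]. *)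
set a := m0 * beta / 2; have a0 : 0 < a by rewrite divr_gt0 // mulr_gt0.
set y := 1 + `|x| + `|c| + 4 / a.
have a4 : 0 < 4 / a by rewrite divr_gt0.
have [nx nc] := (normr_ge0 x, normr_ge0 c).
have y1 : 1 <= y by rewrite /y; lra.
have cy : `|c| < y by rewrite /y; lra.
have ay : 4 < a * y by rewrite mulrC -ltr_pdivrMr // /y; lra.
have y0 : 0 < y by lra.
exists y; first by rewrite /y; have := ler_norm x; lra.
rewrite /slow omega_pos ?ltW // ltrBrDr.
apply: (@lt_le_trans _ _ (2 * y)); first by have := ler_norm c; lra.
have -> : 2 * y = Num.sqrt ((2 * y) ^+ 2) by rewrite sqrtr_sqr gtr0_norm // mulr_gt0.
rewrite ler_sqrt; last by rewrite disprel_ge0.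
rewrite /disprel.
have ty : 1 / 2 <= tanh y := tanh_ge_half y1.
have h1 : beta * y ^+ 2 <= 1 + beta * y ^+ 2 by lra.
have h2 : y * (1 / 2) * (beta * y ^+ 2) <= y * tanh y * (1 + beta * y ^+ 2).
  apply: ler_pM => //; first by rewrite mulr_ge0 // ltW.
    by rewrite mulr_ge0 ?exprn_ge0 // ltW.
  by rewrite ler_pM2l.
apply: (@le_trans _ _ (m0 * (y * (1 / 2) * (beta * y ^+ 2)))); last by rewrite ler_pM2l.
have -> : m0 * (y * (1 / 2) * (beta * y ^+ 2)) = y ^+ 2 * (a * y) by rewrite /a; field.
have -> : (2 * y) ^+ 2 = y ^+ 2 * 4 by ring.
by rewrite ler_pM2l ?exprn_gt0 // ltW.
Qed.

Lemma slow_unboundedN x c : exists2 y, y < x & slow y < c.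
Proof.
have [y xy cy] := slow_unbounded (- x) (- c).
by exists (- y); rewrite ?slowN ltrNl.
Qed.

Lemma is_derive_slow k : k != 0 -> is_derive k 1 slow (cg `|k| - 1).
Proof. by move=> k0; have h := is_derive_omega k0; apply: is_deriveB. Qed.

Lemma dispersion_branches s k :
  (s - k) ^+ 2 = F k <-> s = k + omega k \/ slow k = - s.
Proof.
rewrite -omega_sqr /slow; split.
  move/eqP; rewrite -subr_eq0 subr_sqr mulf_eq0 => /orP[]/eqP h; [left|right]; lra.
by case=> h; [rewrite h|rewrite (_ : s = k - omega k); [|lra]]; ring.
Qed.

Lemma fast_root s : 0 < s -> exists k1, s = k1 + omega k1.
Proof.
move=> s0.
have cf : continuous (fun k => k + omega k).
  by move=> x; apply: cvgD; [exact: cvg_id|exact: continuous_omega].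
have [|x _ ex] := root_between (c := s) cf s0; last by exists x.
rewrite omega0 addr0 sub0r addrAC subrr add0r mulNr oppr_lt0.
by rewrite mulr_gt0 // omega_gt0.
Qed.

Lemma fast_root_uniq s k k' : s = k + omega k -> s = k' + omega k' -> k = k'.
Proof.
move=> e e'; case: (ltgtP k k') => // h; have := omega_mono h; lra.
Qed.

End DispersionBranches.

(** * Slopes of the two resonant branches *)

Section FourRoots.
Context {R : realType}.
Variables (beta m0 kappa sigma r : R).
Hypotheses (beta_gt0 : 0 < beta) (m0_gt0 : 0 < m0) (kappa_gt0 : 0 < kappa).
Hypothesis disprel_kappa : disprel beta m0 kappa = kappa ^+ 2.
Hypotheses (sigma_gt0 : 0 < sigma) (r_gt0 : 0 < r).
Local Notation F := (disprel beta m0).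
Local Notation cg := (group_speed beta m0).
Local Notation omega := (omega beta m0).
Local Notation slow := (slow beta m0).
Implicit Types (k x y c tau : R) (l : seq R).

Definition dispersion_root s k := (s - k) ^+ 2 = F k.

(** Four is the dimension of the reduced system, in which distinct roots at [sigma + tau] will give
    independent modes. *)
Hypothesis at_most_four : forall tau, `|tau| < r -> forall l, uniq l ->
  (forall k, k \in l -> dispersion_root (sigma + tau) k) -> (size l <= 4)%N.

Let cslow : continuous slow := continuous_slow beta_gt0 m0_gt0.

(** The wave is steady in its own frame, so [kappa] is a slow root at frequency 0. *)
Lemma slow_kappa : slow kappa = 0.
Proof. by rewrite /slow omega_pos ?ltW // disprel_kappa sqrtr_sqr gtr0_norm // subrr. Qed.

(** One root lies on the fast branch. It is not on the slow one as well, since this would give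
    [omega k1 = 0], hence [k1 = 0] and [sigma + tau = 0]. *)
Lemma at_most_three tau l : `|tau| < r -> 0 < sigma + tau -> uniq l ->
  (forall k, k \in l -> slow k = - (sigma + tau)) -> (size l <= 3)%N.
Proof.
move=> tr st ul hl; have [k1 e1] := fast_root beta_gt0 m0_gt0 st.
have k1l : k1 \notin l.
  apply/negP => /hl; rewrite /slow => e2.
  have /eqP : omega k1 = 0 by lra.
  rewrite omega_eq0 // => /eqP k10; move: e1; rewrite k10 omega0; lra.
have := at_most_four tr (l := k1 :: l); rewrite /= k1l ul ltnS; apply => // k.
rewrite inE => /orP[/eqP ->|/hl h]; apply/dispersion_branches => //; first by left.
by right.
Qed.

(* slow takes the values 0, - sigma, 0, - sigma, 0 at - kappa, k', 0, k, kappa. *)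
Lemma opposite_slow_roots k k' : k' < 0 -> 0 < k -> k - k' = kappa ->
  slow k = - sigma -> slow k' = - sigma -> False.
Proof.
move=> k'0 k0 kk e e'.
(* The level [- (sigma - t)] lies strictly between [- sigma] and 0, and [t < r] keeps it within
   reach of the bound. Its four crossings are one more than the slow branch allows. *)
pose t := Num.min r sigma / 2.
have m0' : 0 < Num.min r sigma by rewrite lt_min r_gt0.
have t0 : 0 < t by rewrite divr_gt0.
have [tr ts] : t < r /\ t < sigma.
  by apply/andP; rewrite -lt_min /t ltr_pdivrMr //; lra.
have h := @roots_alternating R slow (- (sigma - t)) (- kappa) k' [:: 0; k; kappa] cslow.
have sK : slow (- kappa) = 0 by rewrite slowN slow_kappa oppr0.
have [l [ul sl hl _]] : exists l : seq R, [/\ uniq l, size l = 4,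
    forall x, x \in l -> slow x = - (sigma - t) & forall x, x \in l -> - kappa < x].
  apply: h; rewrite /= ?sK ?slow_kappa ?slow0 ?e ?e'.
    by rewrite k'0 k0 !andbT; apply/andP; split; lra.
  have p1 : 0 < (sigma - t) * t by rewrite mulr_gt0 // subr_gt0.
  by rewrite !andbT; apply/and4P; split; rewrite -oppr_gt0; lra.
have := @at_most_three (- t) l; rewrite normrN gtr0_norm // sl.
by move=> /(_ tr) /(_ _ ul hl); rewrite subr_gt0 => /(_ ts).
Qed.

(** Let [h x = omega x - cg a * x]. The shape of the group speed makes [h] increase on [[0, a]] and
    decrease on [[a, b]], while [slow a = slow b] and [slow kappa = 0] give [h b - h a = h kappa].
    If [kappa <= a], the two sides have opposite signs; otherwise [h kappa > h b > h b - h a]. *)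
Lemma equal_speed_same_side a b : 0 < a -> a < b -> b - a = kappa ->
  slow a = slow b -> cg a = cg b -> False.
Proof.
move=> a0 ab ba; rewrite /slow => eab ecg.
have [q1 q2] := group_speed_quasiconvex beta_gt0 m0_gt0 a0 ab ecg.
pose h x := omega x - cg a * x.
have ch x y : {within `[x, y], continuous h}.
  apply: continuous_subspaceT => z; apply: cvgB; first exact: continuous_omega.
  by apply: cvgMr; exact: cvg_id.
have dh x : 0 < x -> is_derive x 1 h (cg x - cg a).
  move=> x0; have h1 := is_derive_omega beta_gt0 m0_gt0 (lt0r_neq0 x0).
  have h2 : is_derive x 1 (fun y => cg a * y) (cg a).
    by apply: (is_derive_eq (is_deriveZ (cg a) (is_derive_id x 1))); rewrite /GRing.scale /= mulr1.
  by rewrite gtr0_norm // in h1; apply: is_deriveB.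
have inc x y : 0 <= x -> x < y -> y <= a -> h x < h y.
  move=> x0 xy ya; apply: (@derive_pos_lt _ _ (fun x => cg x - cg a) _ _ xy (ch _ _)).
    by move=> z /andP[xz _]; apply: dh; exact: le_lt_trans xz.
  by move=> z /andP[xz zy]; rewrite subr_gt0 q1 // (le_lt_trans x0 xz) (lt_le_trans zy).
have dec x y : a <= x -> x < y -> y <= b -> h y < h x.
  move=> ax xy yb; apply: (@derive_neg_gt _ _ (fun x => cg x - cg a) _ _ xy (ch _ _)).
    by move=> z /andP[xz _]; apply: dh; apply: lt_trans a0 (le_lt_trans ax xz).
  by move=> z /andP[xz zy]; rewrite subr_lt0 q2 // (le_lt_trans ax xz) (lt_le_trans zy).
have h0 : h 0 = 0 by rewrite /h omega0 mulr0 subr0.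
have hba : h b - h a = h kappa.
  have := slow_kappa; rewrite /h /slow -ba => e.
  have -> : omega (b - a) = b - a by lra.
  by lra.
have [ka|ka] := leP kappa a.
  have := inc 0 kappa (lexx _) kappa_gt0 ka; have := dec a b (lexx _) ab (lexx _); lra.
have kb : kappa < b by lra.
have := dec kappa b (ltW ka) kb (lexx _); have := inc 0 a (lexx _) a0 (lexx _); lra.
Qed.

(** Slopes on the fast branch exceed 1 and those on the slow branch are below 1, and the fast branch
    has a single root; so equal slopes make both roots slow. On opposite sides of 0 they contradict
    the count of roots, on the same side the shape of the group speed; two negative roots are
    reflected by oddness. *)
Lemma resonant_speeds_neq k k' (e e' : bool) : k - k' = kappa ->
  sigma = k + (- 1) ^+ e * omega k -> sigma = k' + (- 1) ^+ e' * omega k' ->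
  1 + (- 1) ^+ e * cg `|k| <> 1 + (- 1) ^+ e' * cg `|k'|.
Proof.
move=> kk ek ek' /addrI ee.
have nz (q : R) (d : bool) : sigma = q + (- 1) ^+ d * omega q -> q != 0.
  move=> h; apply/eqP => q0; move: h; rewrite q0 omega0 mulr0 addr0 => s0.
  by move: sigma_gt0; rewrite s0 ltxx.
have [k0 k'0] := (nz _ _ ek, nz _ _ ek').
have cg0 (q : R) : q != 0 -> 0 < cg `|q| by move=> q0; rewrite group_speed_gt0 ?normr_gt0.
have [g0 g0'] := (cg0 _ k0, cg0 _ k'0).
have {ek ek' ee nz} : (sigma = k + omega k /\ sigma = k' + omega k') \/
    [/\ slow k = - sigma, slow k' = - sigma & cg `|k| = cg `|k'|].
  rewrite /slow; case: e e' ek ek' ee => [] [] /=; rewrite ?expr1 ?expr0 ?mul1r ?mulN1r => h1 h2 h3.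
  - by right; split; lra.
  - by exfalso; lra.
  - by exfalso; lra.
  - by left.
case=> [[h1 h2]|[h1 h2 h3]].
  by have e0 := fast_root_uniq beta_gt0 m0_gt0 h1 h2; move: kk kappa_gt0; rewrite e0 subrr => <-; rewrite ltxx.
have h12 : slow k = slow k' by rewrite h1.
have [kp|kn|/eqP] := ltgtP 0 k; last by rewrite eq_sym (negbTE k0).
  have [kp'|kn'|/eqP] := ltgtP 0 k'; last by rewrite eq_sym (negbTE k'0).
    have lt : k' < k by rewrite -subr_gt0 kk.
    by move: h3; rewrite !gtr0_norm // => /esym; apply: equal_speed_same_side.
  exact: (@opposite_slow_roots k k').
have k'n : k' < 0 by apply: lt_trans kn; rewrite -subr_gt0 kk.
have lt : - k < - k' by rewrite ltrN2 -subr_gt0 kk.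
move: h3; rewrite !ltr0_norm //; apply: equal_speed_same_side => //.
- by rewrite oppr_gt0.
- by rewrite opprK addrC.
- by rewrite !slowN h12.
Qed.

Variable L : seq R.
Hypotheses (uniqL : uniq L) (size_L : size L = 4).
Hypothesis rootL : forall k, dispersion_root sigma k <-> k \in L.

Lemma slow_level_set : exists x1 x2 x3, [/\ x1 < x2, x2 < x3 &
  forall k, slow k = - sigma <-> k \in [:: x1; x2; x3]].
Proof.
have [k1 e1] := fast_root beta_gt0 m0_gt0 sigma_gt0.
have k1L : k1 \in L by apply/rootL/dispersion_branches => //; left.
pose l := sort <=%R (rem k1 L).
have ul : uniq l by rewrite sort_uniq rem_uniq.
have sl : size l = 3 by rewrite size_sort size_rem // size_L.
have ol : sorted <=%R l by apply: sort_sorted; exact: le_total.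
have hl k : slow k = - sigma <-> k \in l.
  rewrite mem_sort mem_rem_uniq // inE /=; split.
    move=> e; apply/andP; split; last by apply/rootL/dispersion_branches => //; right.
    apply/eqP => ek; move: e; rewrite ek /slow => e2.
    have /eqP : omega k1 = 0 by lra.
    by rewrite omega_eq0 // => /eqP k10; move: e1 sigma_gt0; rewrite k10 omega0 addr0 => ->; rewrite ltxx.
  move=> /andP[kk1 /rootL]; rewrite /dispersion_root => h.
  have [ek|//] := (dispersion_branches beta_gt0 m0_gt0 _ _).1 h.
  by move: kk1; rewrite (fast_root_uniq beta_gt0 m0_gt0 ek e1) eqxx.
move: ul sl ol hl; case: l => [|x1 [|x2 [|x3 [|]]]] //= + _.
rewrite !inE !negb_or => /andP[/andP[n12 n13] /andP[n23 _]] /and3P[l12 l23 _] hl.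
by exists x1, x2, x3; split => //; rewrite lt_neqAle ?n12 ?n23.
Qed.

End FourRoots.

(** * Level sets with three points *)

Section LevelSets.
Context {R : realType}.
Implicit Types (f : R -> R) (c x eta : R).

Definition level_bound f c eta (n : nat) := forall c', `|c' - c| < eta ->
  forall l : seq R, uniq l -> (forall x, x \in l -> f x = c') -> (size l <= n)%N.

Lemma lt_pos_seq (l : seq R) : (forall x, x \in l -> 0 < x) ->
  exists2 eps, 0 < eps & forall x, x \in l -> eps < x.
Proof.
elim: l => [|y l IH] h; first by exists 1.
have [|e e0 he] := IH; first by move=> x xl; apply: h; rewrite inE xl orbT.
have y0 : 0 < y by apply: h; rewrite inE eqxx.
exists (Num.min e (y / 2)); first by rewrite lt_min e0 divr_gt0.
move=> x; rewrite inE gt_min => /orP[/eqP ->|/he ->//].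
by rewrite [y / 2 < y]ltr_pdivrMr // ltr_pMr // ltr1n orbT.
Qed.

Lemma same_sign_gap f c a b x y : continuous f ->
  (forall z, a < z < b -> f z != c) -> a < x < b -> a < y < b ->
  f x < c -> f y < c.
Proof.
move=> cf nr; wlog : x y / x < y => [H|xy].
  have [xy|yx|->//] := ltgtP x y; first exact: H.
  move=> xab yab fx; rewrite ltNge; apply/negP => fy.
  have {}fy : c < f y by rewrite lt_neqAle fy andbT eq_sym nr.
  have [|z /andP[yz zx] /eqP] := @root_between _ f c y x cf yx; first by nra.
  by apply/negP/nr; case/andP: xab => _ xb; case/andP: yab => ay _; rewrite (lt_trans ay) ?(lt_trans zx).
move=> xab yab fx; rewrite ltNge; apply/negP => fy.
have {}fy : c < f y by rewrite lt_neqAle fy andbT eq_sym nr.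
have [|z /andP[yz zx] /eqP] := @root_between _ f c x y cf xy; first by nra.
by apply/negP/nr; case/andP: xab => ax _; case/andP: yab => _ yb; rewrite (lt_trans ax) ?(lt_trans zx).
Qed.

Lemma same_sign_gapN f c a b x y : continuous f ->
  (forall z, a < z < b -> f z != c) -> a < x < b -> a < y < b ->
  c < f x -> c < f y.
Proof.
move=> cf nr xab yab; rewrite -(ltrN2 (f x)) -(ltrN2 (f y)).
apply: (@same_sign_gap (fun z => - f z) (- c) a b x y) => //.
  by move=> z; apply: cvgN; exact: cf.
by move=> z /nr; rewrite eqr_opp.
Qed.

Variables (f : R -> R) (c x1 x2 x3 eta : R).
Hypotheses (cf : continuous f) (x12 : x1 < x2) (x23 : x2 < x3).
Hypothesis level : forall x, f x = c <-> x \in [:: x1; x2; x3].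
Hypothesis unbounded : forall x d, exists2 y, x < y & d < f y.
Hypothesis unboundedN : forall x d, exists2 y, y < x & f y < d.

Let m1 := (x1 + x2) / 2.
Let m2 := (x2 + x3) / 2.

Let fx1 : f x1 = c. Proof. by apply/level; rewrite !inE eqxx. Qed.
Let fx2 : f x2 = c. Proof. by apply/level; rewrite !inE eqxx orbT. Qed.
Let fx3 : f x3 = c. Proof. by apply/level; rewrite !inE eqxx !orbT. Qed.

Let x1m1 : x1 < m1. Proof. by move: x12; rewrite /m1 ltr_pdivlMr //; lra. Qed.
Let m1x2 : m1 < x2. Proof. by move: x12; rewrite /m1 ltr_pdivrMr //; lra. Qed.
Let x2m2 : x2 < m2. Proof. by move: x23; rewrite /m2 ltr_pdivlMr //; lra. Qed.
Let m2x3 : m2 < x3. Proof. by move: x23; rewrite /m2 ltr_pdivrMr //; lra. Qed.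

Let nroot x : x != x1 -> x != x2 -> x != x3 -> f x != c.
Proof.
move=> n1 n2 n3; apply/eqP => /level.
by rewrite !inE (negbTE n1) (negbTE n2) (negbTE n3).
Qed.

Lemma below_before x : x < x1 -> f x < c.
Proof.
move=> xx1; rewrite ltNge; apply/negP => fx.
have {}fx : c < f x.
  by rewrite lt_neqAle fx eq_sym nroot // lt_eqF // (lt_trans xx1) // (lt_trans x12).
have [y yx fy] := unboundedN x c.
have [|z /andP[yz zx] /level] := @root_between _ f c y x cf yx; first by nra.
have zx1 := lt_trans zx xx1.
by rewrite !inE (lt_eqF zx1) (lt_eqF (lt_trans zx1 x12)) (lt_eqF (lt_trans zx1 (lt_trans x12 x23))).
Qed.

Lemma above_after x : x3 < x -> c < f x.
Proof.
move=> xx3; rewrite ltNge; apply/negP => fx.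
have {}fx : f x < c.
  by rewrite lt_neqAle fx nroot // gt_eqF // (lt_trans _ xx3) // (lt_trans x12).
have [y yx fy] := unbounded x c.
have [|z /andP[yz zx] /level] := @root_between _ f c x y cf yx; first by nra.
have zx3 := lt_trans xx3 yz.
by rewrite !inE (gt_eqF zx3) (gt_eqF (lt_trans x23 zx3)) (gt_eqF (lt_trans x12 (lt_trans x23 zx3))).
Qed.

(** [f] is below [c] before [x1] and above it after [x3], so the signs at [m1] and [m2] leave four
    patterns. Two equal signs give four points on a nearby level. Above then below means three
    crossings; below then above, with [x2] the only change of sign, is left open by the count. *)
Lemma level_dichotomy : 0 < eta -> level_bound f c eta 3 ->
  (c < f m1 /\ f m2 < c) \/
  ((forall x, x < x2 -> f x <= c) /\ (forall x, x2 < x -> c <= f x)).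
Proof.
move=> eta0 bnd.
have n1 : f m1 != c by rewrite nroot // ?(gt_eqF x1m1) ?(lt_eqF m1x2) // lt_eqF // (lt_trans m1x2).
have n2 : f m2 != c by rewrite nroot // ?(gt_eqF x2m2) ?(lt_eqF m2x3) // gt_eqF // (lt_trans x12).
have m0 : f (x1 - 1) < c by apply: below_before; rewrite gtrBl.
have [h1|h1|/eqP] := ltgtP (f m1) c; last by rewrite (negbTE n1).
  have [h2|h2|/eqP] := ltgtP (f m2) c; last by rewrite (negbTE n2).
    (* Below on both gaps: the level [c - e] is crossed between consecutive points of [x1 - 1],
       [x1], [m1], [x2], [m2]. *)
    exfalso; have [|e e0 he] := @lt_pos_seq [:: eta; c - f (x1 - 1); c - f m1; c - f m2].
      by move=> y; rewrite !inE => /or4P[] /eqP -> //; rewrite subr_gt0.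
    have e1 : e < eta by apply: he; rewrite !inE eqxx.
    have e2 : e < c - f (x1 - 1) by apply: he; rewrite !inE eqxx !orbT.
    have e3 : e < c - f m1 by apply: he; rewrite !inE eqxx !orbT.
    have e4 : e < c - f m2 by apply: he; rewrite !inE eqxx !orbT.
    have [||l [ul sl hl _]] := @roots_alternating R f (c - e) (x1 - 1) x1 [:: m1; x2; m2] cf.
    - by rewrite /= x1m1 m1x2 x2m2 !andbT gtrBl.
    - by rewrite /= fx1 fx2 !andbT; apply/and4P; split; nra.
    have ce : `|c - e - c| < eta by rewrite addrAC subrr add0r normrN gtr0_norm.
    by have := bnd (c - e) ce l ul hl; rewrite sl.
  right; split=> x.
    move=> xx2; have [xx1|xx1|->] := ltgtP x x1; last by rewrite fx1.
      by apply/ltW/below_before.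
    apply/ltW/(@same_sign_gap f c x1 x2 m1 x cf); rewrite ?x1m1 ?xx1 // => z /andP[z1 z2].
    by rewrite nroot // ?(gt_eqF z1) ?(lt_eqF z2) // lt_eqF // (lt_trans z2).
  move=> xx2; have [xx3|xx3|->] := ltgtP x x3; last by rewrite fx3.
    apply/ltW/(@same_sign_gapN f c x2 x3 m2 x cf); rewrite ?x2m2 ?xx2 // => z /andP[z1 z2].
    by rewrite nroot // ?(gt_eqF z1) ?(lt_eqF z2) // gt_eqF // (lt_trans x12).
  by apply/ltW/above_after.
have [h2|h2|/eqP] := ltgtP (f m2) c; last by rewrite (negbTE n2).
  by left.
(* Above on both gaps: the level [c + e] is crossed between consecutive points of [x1], [m1], [x2],
   [m2], [x3]. *)
exfalso; have [|e e0 he] := @lt_pos_seq [:: eta; f m1 - c; f m2 - c].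
  by move=> y; rewrite !inE => /or3P[] /eqP -> //; rewrite subr_gt0.
have e1 : e < eta by apply: he; rewrite !inE eqxx.
have e3 : e < f m1 - c by apply: he; rewrite !inE eqxx !orbT.
have e4 : e < f m2 - c by apply: he; rewrite !inE eqxx !orbT.
have [||l [ul sl hl _]] := @roots_alternating R f (c + e) x1 m1 [:: x2; m2; x3] cf.
- by rewrite /= x1m1 m1x2 x2m2 m2x3.
- by rewrite /= fx1 fx2 fx3 !andbT; apply/and4P; split; nra.
have ce : `|c + e - c| < eta by rewrite addrAC subrr add0r gtr0_norm.
by have := bnd (c + e) ce l ul hl; rewrite sl.
Qed.

(** The values at [x1 - 1], [m1], [m2], [x3 + 1] alternate strictly around [c], hence around every
    level closer to [c] than all four values. *)
Lemma crossing_roots_persist : c < f m1 -> f m2 < c ->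
  exists2 e, 0 < e & forall c', `|c' - c| < e ->
  exists l : seq R, [/\ uniq l, size l = 3 & forall x, x \in l -> f x = c'].
Proof.
move=> h1 h2.
have m0 : f (x1 - 1) < c by apply: below_before; rewrite gtrBl.
have m3 : c < f (x3 + 1) by apply: above_after; rewrite ltrDl.
have [|e e0 he] := @lt_pos_seq [:: f (x3 + 1) - c; c - f (x1 - 1); f m1 - c; c - f m2].
  by move=> y; rewrite !inE => /or4P[] /eqP -> //; rewrite subr_gt0.
have e1 : e < f (x3 + 1) - c by apply: he; rewrite !inE eqxx.
have e2 : e < c - f (x1 - 1) by apply: he; rewrite !inE eqxx !orbT.
have e3 : e < f m1 - c by apply: he; rewrite !inE eqxx !orbT.
have e4 : e < c - f m2 by apply: he; rewrite !inE eqxx !orbT.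
exists e => // c'; rewrite ltr_norml => /andP[c1 c2].
have [||l [ul sl hl _]] := @roots_alternating R f c' (x1 - 1) m1 [:: m2; x3 + 1] cf.
- rewrite /= !andbT; apply/and3P; split.
  + by rewrite (lt_trans _ x1m1) // gtrBl.
  + exact: lt_trans x2m2.
  + by rewrite (lt_trans m2x3) // ltrDl.
- by rewrite /= !andbT; apply/and3P; split; nra.
by exists l.
Qed.

End LevelSets.
Section Persistence.
Context {R : realType}.
Variables (beta m0 kappa sigma r : R).
Hypotheses (beta_gt0 : 0 < beta) (m0_gt0 : 0 < m0) (kappa_gt0 : 0 < kappa).
Hypothesis disprel_kappa : disprel beta m0 kappa = kappa ^+ 2.
Hypotheses (sigma_gt0 : 0 < sigma) (r_gt0 : 0 < r).
Local Notation cg := (group_speed beta m0).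
Local Notation omega := (omega beta m0).
Local Notation slow := (slow beta m0).
Local Notation dispersion_root := (dispersion_root beta m0).
Implicit Types (k x y c tau : R) (l : seq R).

Hypothesis at_most_four : forall tau, `|tau| < r -> forall l, uniq l ->
  (forall k, k \in l -> dispersion_root (sigma + tau) k) -> (size l <= 4)%N.
Variable L : seq R.
Hypotheses (uniqL : uniq L) (size_L : size L = 4%N).
Hypothesis rootL : forall k, dispersion_root sigma k <-> k \in L.

Let cslow : continuous slow := continuous_slow beta_gt0 m0_gt0.

(** Fermat's rule. The interval is first shrunk to points at distance less than [|x|] from [x], away
    from 0, where no derivative of [slow] is available. *)
Lemma group_speed_at_max x a b : x != 0 -> a < x < b ->
  (forall y, a < y < b -> slow y <= slow x) -> cg `|x| = 1.
Proof.
move=> x0 /andP[ax xb] h.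
have dx := is_derive_slow beta_gt0 m0_gt0 x0.
have xn : 0 < `|x| by rewrite normr_gt0.
pose a' := Num.max a (x - `|x|); pose b' := Num.min b (x + `|x|).
have a'x : a' < x by rewrite gt_max ax gtrBl.
have xb' : x < b' by rewrite lt_min xb ltrDl.
suff [_ e] : is_derive x 1 slow 0 by have [_ e'] := dx; rewrite e' in e; lra.
apply: (@derive1_at_max R slow a' b' x (ltW (lt_trans a'x xb'))).
- move=> t; rewrite in_itv /= gt_max lt_min => /andP[/andP[_ h1] /andP[_ h2]].
  have t0 : t != 0.
    by apply/eqP => t0; move: h1 h2; rewrite t0; case: (ltrgt0P x) x0 => //; lra.
  by have [] := is_derive_slow beta_gt0 m0_gt0 t0.
- by rewrite in_itv /= a'x.
- move=> t; rewrite in_itv /= gt_max lt_min => /andP[/andP[h1 _] /andP[h2 _]].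
  by apply: h; rewrite h1.
Qed.

Lemma group_speed_at_min x a b : x != 0 -> a < x < b ->
  (forall y, a < y < b -> slow x <= slow y) -> cg `|x| = 1.
Proof.
move=> x0 /andP[ax xb] h; rewrite -normrN.
apply: (@group_speed_at_max (- x) (- b) (- a)); rewrite ?oppr_eq0 ?ltrN2 ?ax ?xb //.
move=> y /andP[y1 y2]; rewrite slowN -[y]opprK slowN lerN2 h //.
by rewrite ltrNr y2 ltrNl.
Qed.

(** A local maximum at [x1] and a local minimum at [x3] make the group speed 1 at [|x1|] and [|x3|].
    Between two positive points of speed 1 [slow] decreases ([dec]), and from 0 to the smaller one
    it increases ([inc]). On one side of 0 the first fact contradicts the equal values; on opposite
    sides the second is played against the oddness of [slow]. *)
Lemma not_tangent x1 x2 x3 : x1 < x2 -> x2 < x3 ->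
  slow x1 = - sigma -> slow x3 = - sigma ->
  (forall x, slow x = - sigma <-> x \in [:: x1; x2; x3]) ->
  (forall x, x < x2 -> slow x <= - sigma) ->
  (forall x, x2 < x -> - sigma <= slow x) -> False.
Proof.
move=> x12 x23 e1 e3 lev below above.
have nz x : slow x = - sigma -> x != 0.
  move=> e; apply/eqP => x0; move: e sigma_gt0; rewrite x0 slow0 => /esym/eqP.
  by rewrite oppr_eq0 => /eqP ->; rewrite ltxx.
have [n1 n3] := (nz _ e1, nz _ e3).
have g1 : cg `|x1| = 1.
  apply: (@group_speed_at_max _ (x1 - 1) x2 n1); first by rewrite gtrBl ltr01.
  by move=> y /andP[_ y2]; rewrite e1 below.
have g3 : cg `|x3| = 1.
  apply: (@group_speed_at_min _ x2 (x3 + 1) n3); first by rewrite x23 ltrDl ltr01.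
  by move=> y /andP[y2 _]; rewrite e3 above.
have dec a b : 0 < a -> a < b -> cg a = 1 -> cg b = 1 -> slow b < slow a.
  move=> a0 ab ga gb.
  have [_ q] := group_speed_quasiconvex beta_gt0 m0_gt0 a0 ab (etrans ga (esym gb)).
  apply: (@derive_neg_gt _ _ (fun x => cg `|x| - 1) _ _ ab).
  - exact: continuous_subspaceT cslow.
  - by move=> x /andP[ax _]; apply: is_derive_slow => //; rewrite gt_eqF // (lt_trans a0).
  - move=> x /andP[ax xb]; rewrite gtr0_norm ?(lt_trans a0) // subr_lt0 -ga q //.
    by rewrite ax xb.
have inc a b y : 0 < a -> a < b -> cg a = 1 -> cg b = 1 -> 0 <= y -> y < a -> slow y < slow a.
  move=> a0 ab ga gb y0 ya.
  have [q _] := group_speed_quasiconvex beta_gt0 m0_gt0 a0 ab (etrans ga (esym gb)).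
  apply: (@derive_pos_lt _ _ (fun x => cg `|x| - 1) _ _ ya).
  - exact: continuous_subspaceT cslow.
  - by move=> x /andP[yx _]; apply: is_derive_slow => //; rewrite gt_eqF // (le_lt_trans y0).
  - move=> x /andP[yx xa]; have x0 := le_lt_trans y0 yx.
    by rewrite gtr0_norm // subr_gt0 -ga q // x0 xa.
have x13 := lt_trans x12 x23.
have [p1|p1|/eqP] := ltgtP 0 x1; last by rewrite eq_sym (negbTE n1).
  have p3 := lt_trans p1 x13; rewrite gtr0_norm // in g1; rewrite gtr0_norm // in g3.
  by have := dec _ _ p1 x13 g1 g3; rewrite e1 e3 ltxx.
have [p3|p3|/eqP] := ltgtP 0 x3; last by rewrite eq_sym (negbTE n3).
  rewrite ltr0_norm // in g1; rewrite gtr0_norm // in g3.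
  have [p1' eN] : 0 < - x1 /\ slow (- x1) = sigma by rewrite slowN e1 opprK oppr_gt0.
  (* If [x3 < - x1], [slow] would increase from 0 to the negative value [- sigma] on [[0, x3]]; if
     [x3 = - x1], its value there would be both [sigma] and [- sigma]. *)
  have [h|h|h] := ltgtP (- x1) x3; last 2 first.
  - by have := inc _ _ 0 p3 h g3 g1 (lexx _) p3; rewrite slow0 e3; move: sigma_gt0; lra.
  - by move: eN sigma_gt0; rewrite h e3; lra.
  (* A point [z > x1] before both [x2] and 0: [slow (- z) < slow (- x1) = sigma] reads
     [slow z > - sigma], against the maximum at [x1]. *)
  pose y := Num.min x2 0; pose z := (x1 + y) / 2.
  have x1y : x1 < y by rewrite lt_min x12 p1.
  have x1z : x1 < z by rewrite /z ltr_pdivlMr //; lra.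
  have zy : z < y by rewrite /z ltr_pdivrMr //; lra.
  have z2 : z < x2 by rewrite (lt_le_trans zy) // ge_min lexx.
  have z0 : z < 0 by rewrite (lt_le_trans zy) // ge_min lexx orbT.
  have := inc _ _ (- z) p1' h g1 g3 _ _; rewrite oppr_ge0 ltrN2 ltW // => /(_ isT x1z).
  by rewrite slowN eN => zs; have := below z z2; lra.
rewrite ltr0_norm // in g1; rewrite ltr0_norm // in g3.
have := dec (- x3) (- x1) _ _ g3 g1; rewrite oppr_gt0 ltrN2 => /(_ p3 x13).
by rewrite !slowN e1 e3 ltxx.
Qed.

(** Once the tangential pattern is excluded, the slow branch crosses its level three times and the
    crossings persist; the fast root is the fourth. *)
Lemma four_roots_persist : exists2 e, 0 < e & forall tau, `|tau| < e ->
  exists l : seq R, [/\ uniq l, size l = 4%N &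
    forall k, k \in l -> dispersion_root (sigma + tau) k].
Proof.
have [x1 [x2 [x3 [x12 x23 lev]]]] :=
  slow_level_set beta_gt0 m0_gt0 sigma_gt0 uniqL size_L rootL.
pose eta := Num.min r sigma.
have eta0 : 0 < eta by rewrite lt_min r_gt0.
have bnd : level_bound slow (- sigma) eta 3.
  move=> c ce l ul hl; pose tau := - c - sigma.
  have ts : `|tau| < eta by rewrite /tau -normrN opprB opprK addrC -[sigma in X in `|X|]opprK.
  move: ts; rewrite lt_min => /andP[tr ts].
  apply: (at_most_three beta_gt0 m0_gt0 at_most_four tr _ ul).
    by move: ts; rewrite ltr_norml => /andP[]; lra.
  by move=> k /hl ->; rewrite /tau; lra.
have unb := slow_unbounded beta_gt0 m0_gt0.
have unbN := slow_unboundedN beta_gt0 m0_gt0.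
have [[h1 h2]|[h1 h2]] := level_dichotomy cslow x12 x23 lev unb unbN eta0 bnd; last first.
  by exfalso; apply: (@not_tangent x1 x2 x3) => //; apply/lev; rewrite !inE eqxx ?orbT.
have [e e0 he] := crossing_roots_persist cslow x12 x23 lev unb unbN h1 h2.
exists (Num.min e sigma); first by rewrite lt_min e0.
move=> tau; rewrite lt_min => /andP[te ts].
have st : 0 < sigma + tau by move: ts; rewrite ltr_norml => /andP[]; lra.
have [|l [ul sl hl]] := he (- (sigma + tau)).
  by rewrite opprD opprK addrAC addNr add0r normrN.
have [k1 e1] := fast_root beta_gt0 m0_gt0 st.
exists (k1 :: l); split => /=; last 2 first.
- by rewrite sl.
- move=> k; rewrite inE => /orP[/eqP ->|/hl h]; apply/dispersion_branches => //; first by left.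
  by right.
rewrite ul andbT; apply/negP => /hl; rewrite /slow => e2.
have /eqP : omega k1 = 0 by lra.
by rewrite omega_eq0 // => /eqP k10; move: e1 st; rewrite k10 omega0 addr0 => ->; rewrite ltxx.
Qed.

End Persistence.

(** * Function spaces on the unit interval *)

Section RealL2.
Context {R : realType}.
Local Notation mu := (@lebesgue_measure R).
Local Notation I01 := (`](0 : R), 1[%classic : set R).
Implicit Types (f g : R -> R) (a c : R).

Definition rL2 f := measurable_fun I01 f /\
  mu.-integrable I01 (fun y => (f y ^+ 2)%:E).

Lemma mu_I01 : (mu I01 < +oo)%E.
Proof. by rewrite lebesgue_measure_itv /= lte01 oppr0 adde0 ltry. Qed.

Lemma eq_integrable01 (f g : R -> \bar R) : (forall y, I01 y -> f y = g y) ->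
  mu.-integrable I01 f -> mu.-integrable I01 g.
Proof.
move=> fg; apply: (@eq_integrable _ _ _ mu I01).
  exact: measurable_itv.
by move=> y /set_mem; exact: fg.
Qed.

Lemma integrableZl01 c (f : R -> \bar R) :
  mu.-integrable I01 f -> mu.-integrable I01 (fun y => c%:E * f y)%E.
Proof. by move=> If; apply: (@integrableZl _ _ _ mu I01) => //; exact: measurable_itv. Qed.

Lemma integrableD01 (f g : R -> \bar R) : mu.-integrable I01 f -> mu.-integrable I01 g ->
  mu.-integrable I01 (fun y => f y + g y)%E.
Proof. by move=> If Ig; apply: (@integrableD _ _ _ mu I01) => //; exact: measurable_itv. Qed.

Lemma le_integrable01 (f g : R -> R) : measurable_fun I01 f ->
  (forall y, I01 y -> `|f y| <= g y) ->
  mu.-integrable I01 (EFin \o g) -> mu.-integrable I01 (EFin \o f).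
Proof.
move=> mf fg; apply: (@le_integrable _ _ _ mu I01).
- exact: measurable_itv.
- exact/measurable_EFinP.
- move=> y y01 /=; rewrite lee_fin (le_trans (fg y y01)) //; exact: ler_norm.
Qed.

Lemma rL2_lin a f g : rL2 f -> rL2 g -> rL2 (fun y => a * f y + g y).
Proof.
move=> [mf If] [mg Ig].
have m : measurable_fun I01 (fun y => a * f y + g y).
  by apply: measurable_funD => //; apply: measurable_funM => //; exact: measurable_cst.
split => //; apply: (@le_integrable01 _ (fun y => (2 * a ^+ 2) * f y ^+ 2 + 2 * g y ^+ 2)).
- exact: measurable_funX.
- move=> y _; rewrite ger0_norm ?sqr_ge0 //.
  have := sqr_ge0 (a * f y - g y); nra.
- apply: (@eq_integrable01 (fun y => (2 * a ^+ 2)%:E * (f y ^+ 2)%:E + 2%:E * (g y ^+ 2)%:E)%E).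
    by move=> y _ /=; rewrite -!EFinM -EFinD.
  by apply: integrableD01; apply: integrableZl01.
Qed.

Lemma rL2_integrable f : rL2 f -> mu.-integrable I01 (EFin \o f).
Proof.
move=> [mf If]; apply: (@le_integrable01 _ (fun y => 1 + f y ^+ 2)) => //.
  move=> y _; rewrite -[f y ^+ 2]real_normK ?num_real //.
  by have := sqr_ge0 (`|f y| - 1); nra.
apply: (@eq_integrable01 (fun y => (cst 1 y)%:E + (f y ^+ 2)%:E)%E) => //.
apply: integrableD01 => //.
apply: measurable_bounded_integrable.
- exact: measurable_itv.
- exact: mu_I01.
- exact: measurable_cst.
- exact: bounded_cst.
Qed.

Lemma bounded_measurable_rL2 f (M : R) : measurable_fun I01 f ->
  (forall y, I01 y -> `|f y| <= M) -> rL2 f.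
Proof.
move=> mf fM; split => //; apply: measurable_bounded_integrable.
- exact: measurable_itv.
- exact: mu_I01.
- exact: measurable_funX.
- exists (M ^+ 2); split; first exact: num_real.
  move=> N MN y y01; rewrite /= ger0_norm ?sqr_ge0 // (le_trans _ (ltW MN)) //.
  by rewrite -real_normK ?num_real // lerXn2r ?nnegrE ?fM // (le_trans _ (fM y y01)).
Qed.

Lemma continuous_rL2 f : continuous f -> rL2 f.
Proof.
move=> cf; have cw : {within `[(0:R), 1], continuous f} by exact: continuous_subspaceT.
have [x _ xM] := EVT_max ler01 cw; have [z _ zm] := EVT_min ler01 cw.
apply: (@bounded_measurable_rL2 _ (`|f x| + `|f z|)).
  exact: measurable_funS (continuous_measurable_fun cf).
move=> y /=; rewrite in_itv /= => /andP[y0 y1].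
have y01 : y \in `[0, 1] by rewrite in_itv /= !ltW.
have := xM _ y01; have := zm _ y01; have := ler_norm (f x); have := ler_norm (- f z).
have := normr_ge0 (f x); have := normr_ge0 (f z).
by rewrite normrN ler_norml => *; apply/andP; split; lra.
Qed.

Lemma ae_eq_rL2 f g : measurable_fun I01 f -> rL2 g ->
  {ae mu, forall y, I01 y -> f y = g y} -> rL2 f.
Proof.
move=> mf [mg /integrableP[mg2 Ig]] fg; split => //; apply/integrableP; split.
  by apply/measurable_EFinP; exact: measurable_funX.
move: Ig; congr (_ < _)%E; apply: ge0_ae_eq_integral.
- exact: measurable_itv.
- exact: measurableT_comp mg2.
- by apply: measurableT_comp => //; apply/measurable_EFinP; exact: measurable_funX.
- by move=> y _; exact: abse_ge0.
- by move=> y _; exact: abse_ge0.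
- apply: (filterS _ fg); first exact: (ae_filter_ringOfSetsType mu).
  by move=> y h y01 /=; rewrite h.
Qed.

End RealL2.
Section RealH1.
Context {R : realType}.
Local Notation mu := (@lebesgue_measure R).
Local Notation I01 := (`](0 : R), 1[%classic : set R).
Implicit Types (f g : R -> R) (a c : R).

(** Cutting [g] off outside []0, 1[] and integrating from minus infinity yields a function
    continuous on the whole line, from which boundary values at 0 and 1 can be read. *)
Definition primitive g (y : R) : R := \int[mu]_(t in `]-oo, y]) (g \_ I01) t.

Lemma integrable_patch01 g : rL2 g -> mu.-integrable setT (EFin \o (g \_ I01)).
Proof.
move=> /rL2_integrable Ig; rewrite -restrict_EFin.
exact: (@integrable_mkcond _ _ _ mu I01 _ (measurable_itv _)).1 Ig.
Qed.

Lemma integrable_patchS g (A : set R) : measurable A -> rL2 g ->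
  mu.-integrable A (EFin \o (g \_ I01)).
Proof. by move=> mA /integrable_patch01; apply: integrableS. Qed.

Lemma integral_primitive g y : rL2 g -> 0 < y < 1 ->
  \int[mu]_(t in `[0, y]) g t = primitive g y.
Proof.
move=> g2 /andP[y0 y1]; rewrite -Rintegral_itv_obnd_cbnd; last first.
  apply: integrableS (rL2_integrable g2); [exact: measurable_itv|exact: measurable_itv|].
  by move=> t /=; rewrite !in_itv /= => /andP[-> /le_lt_trans ->].
rewrite /primitive Rintegral_mkcond [RHS]Rintegral_mkcond; apply: eq_Rintegral => t _.
rewrite !patchE; case: ifPn => [|tn].
  rewrite inE /= in_itv /= => /andP[t0 ty].
  by rewrite !mem_set //= in_itv //= t0 (le_lt_trans ty).
case: ifPn => //; rewrite inE /= in_itv /= => ty.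
case: ifPn => //; rewrite inE /= in_itv /= => /andP[t0 t1].
by move: tn; rewrite mem_set //= in_itv /= t0 ty.
Qed.

Lemma continuous_primitive g : rL2 g -> continuous (primitive g).
Proof.
move=> g2; set f := g \_ I01.
have If : mu.-integrable setT (EFin \o f) := integrable_patch01 g2.
have H : forall e : R, 0 < e -> exists2 d : R, 0 < d &
    forall y x, y <= x -> x - y < d -> `|primitive g x - primitive g y| < e.
  move=> e e0; have [d [d0 hd]] := integral_normr_continuous If e0.
  exists d => // y x yx xyd.
  rewrite /primitive Rintegral_itvB //; last exact: integrable_patchS.
  apply: le_lt_trans (le_normr_Rintegral _ _) _.
  - exact: measurable_itv.
  - by apply: integrable_patchS => //; exact: measurable_itv.
  apply: hd; first exact: measurable_itv.
  suff : (mu `]y, x]%classic < d%:E)%E by [].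
  rewrite lebesgue_measure_itv /= lte_fin.
  by case: ifPn => _; rewrite lte_fin.
move=> x; apply/cvgrPdist_lt => e e0; have [d d0 hd] := H e e0.
near=> y.
have : `|x - y| < d by near: y; apply/nbhs_ballP; exists d.
have [xy|yx] := leP x y => h.
  by rewrite distrC; apply: hd => //; rewrite distrC ger0_norm ?subr_ge0 in h.
by apply: hd; rewrite ?(ltW yx) //; rewrite ger0_norm ?subr_ge0 ?(ltW yx) in h.
Unshelve. all: by end_near. Qed.

Lemma ae_derive_primitive g : rL2 g ->
  {ae mu, forall y, I01 y -> is_derive y 1 (primitive g) (g y)}.
Proof.
move=> g2; have If := integrable_patch01 g2.
have := @FTC1Ny R (g \_ I01) (fun y => integrable_patchS (measurable_itv _) g2).
have lf : locally_integrable setT (g \_ I01) by apply: integrable_locally (rL2_integrable g2); exact: measurable_itv.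
move=> /(_ lf); apply: filterS; first exact: (ae_filter_ringOfSetsType mu).
move=> y [dy ey] y01; apply: DeriveDef => //.
by move: ey; rewrite derive1E patchE mem_set.
Qed.

Definition rH1 f := exists g c, rL2 g /\
  forall y, 0 < y < 1 -> f y = c + \int[mu]_(t in `[0, y]) g t.

Lemma rH1P f : rH1 f <-> exists g c, rL2 g /\
  forall y, 0 < y < 1 -> f y = c + primitive g y.
Proof.
by split=> -[g [c [g2 H]]]; exists g, c; split => // y y01; rewrite H // integral_primitive.
Qed.

Lemma primitive_lin a f g y : rL2 f -> rL2 g ->
  primitive (fun t => a * f t + g t) y = a * primitive f y + primitive g y.
Proof.
move=> f2 g2; have m : measurable (`]-oo, y]%classic : set R) by exact: measurable_itv.
rewrite /primitive -RintegralZl ?integrable_patchS // -RintegralD ?integrable_patchS //.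
- apply: eq_Rintegral => t _; rewrite !patchE; case: ifPn => // _.
  by rewrite mulr0 addr0.
- apply: (@eq_integrable _ _ _ mu _ m (fun t => a%:E * (EFin \o (f \_ I01)) t)%E) => //.
  by apply: integrableZl => //; exact: integrable_patchS.
Qed.

Lemma rH1_lin a f g : rH1 f -> rH1 g -> rH1 (fun y => a * f y + g y).
Proof.
move=> /rH1P[f' [c [f2 Hf]]] /rH1P[g' [d [g2 Hg]]]; apply/rH1P.
exists (fun y => a * f' y + g' y), (a * c + d); split; first exact: rL2_lin.
by move=> y y01; rewrite primitive_lin // Hf // Hg //; ring.
Qed.

Lemma eq_rH1 f g : (forall y, 0 < y < 1 -> f y = g y) -> rH1 f -> rH1 g.
Proof.
by move=> fg [h [c [h2 H]]]; exists h, c; split => // y y01; rewrite -fg // H.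
Qed.

Lemma rH1_continuous f : rH1 f -> exists F : R -> R, continuous F /\
  forall y, 0 < y < 1 -> f y = F y.
Proof.
move=> /rH1P[g [c [g2 H]]]; exists (fun y => c + primitive g y); split => //.
by move=> y; apply: cvgD; [exact: cvg_cst|exact: continuous_primitive].
Qed.

Lemma near_I01 (y : R) : 0 < y < 1 -> \forall z \near y, 0 < z < 1.
Proof.
move=> y01; have : y \in `]0, 1[ by rewrite in_itv.
by move=> /near_in_itvoo; apply: filterS => z; rewrite in_itv.
Qed.

Lemma near_eq_derive1 f g (y : R) : (\forall z \near y, f z = g z) ->
  derive1 f y = derive1 g y.
Proof. by move=> fg; rewrite !derive1E; exact: near_eq_derive. Qed.

Lemma eq01_derive1 f g (y : R) : (forall z, 0 < z < 1 -> f z = g z) -> 0 < y < 1 ->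
  derive1 f y = derive1 g y.
Proof.
by move=> fg /near_I01 h; apply: near_eq_derive1; apply: filterS h => z /fg.
Qed.

Lemma eq01_is_derive f g (y d : R) : (forall z, 0 < z < 1 -> f z = g z) -> 0 < y < 1 ->
  is_derive y 1 f d -> is_derive y 1 g d.
Proof.
by move=> fg /near_I01 h; apply: near_eq_is_derive; apply: filterS h => z /fg.
Qed.

Lemma rH1_ae_derive f : rH1 f -> exists g, rL2 g /\
  {ae mu, forall y, I01 y -> is_derive y 1 f (g y)}.
Proof.
move=> /rH1P[g [c [g2 H]]]; exists g; split => //.
have := ae_derive_primitive g2; apply: filterS; first exact: (ae_filter_ringOfSetsType mu).
move=> y h y01; have d := h y01; have y01' : 0 < y < 1 by move: y01; rewrite /= in_itv.
apply: (@eq01_is_derive (fun y => c + primitive g y)) => //.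
  by move=> z /H.
by apply: (is_derive_eq (is_deriveD (is_derive_cst c y 1) d)); rewrite add0r.
Qed.

Lemma derivable_primitive (F : R -> R) (y : R) : continuous F -> 0 < y < 1 -> is_derive y 1 (primitive F) (F y).
Proof.
move=> cF y01; have F2 := continuous_rL2 cF.
have If : mu.-integrable `]-oo, (y + 1)] (EFin \o (F \_ I01)).
  by apply: integrable_patchS => //; exact: measurable_itv.
have cP : {for y, continuous (F \_ I01)}.
  rewrite /prop_for /continuous_at patchE mem_set /= ?in_itv //.
  apply: cvg_trans (cF y); apply: near_eq_cvg; apply: filterS (near_I01 y01) => z z01.
  by rewrite patchE mem_set //= in_itv.
have yy : y < y + 1 by rewrite ltrDl.
have [d e] := continuous_FTC1 yy If (ltNyr y) cP.
by apply: DeriveDef => //; rewrite -derive1E e patchE mem_set //= in_itv.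
Qed.

(** An H^1 function is, up to a constant, the primitive of its almost everywhere derivative. If this
    agrees almost everywhere with a continuous [G], the function is a primitive of [G], hence
    differentiable at every point. *)
Lemma rH1_derive_continuous f G : rH1 f -> continuous G ->
  {ae mu, forall y, I01 y -> derive1 f y = G y} ->
  forall y : R, 0 < y < 1 -> is_derive y 1 f (G y).
Proof.
move=> f1 cG ae y y01.
have [g [c [g2 H]]] := (rH1P f).1 f1.
suff HG z : 0 < z < 1 -> f z = c + primitive G z.
  apply: (@eq01_is_derive (fun z => c + primitive G z)) => //; first by move=> z /HG.
  apply: (is_derive_eq (is_deriveD (is_derive_cst c y 1) (derivable_primitive cG y01))).
  by rewrite add0r.
move=> z01; rewrite H //; congr (_ + _); rewrite /primitive /Rintegral; congr fine.
have G2 := continuous_rL2 cG.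
apply: (@ae_eq_integral _ _ _ mu `]-oo, z]%classic (EFin \o (G \_ I01)) (EFin \o (g \_ I01))).
- exact: measurable_itv.
- exact: measurable_int (integrable_patchS (measurable_itv _) g2).
- exact: measurable_int (integrable_patchS (measurable_itv _) G2).
have := ae_derive_primitive g2.
apply: (@filterS2 _ _ (ae_filter_ringOfSetsType mu) _ _ _ _ ae) => t ft ht _.
congr EFin; rewrite !patchE; case: ifPn => //; rewrite inE => t01.
have d := ht t01; have t01' : 0 < t < 1 by move: t01; rewrite /= in_itv.
rewrite -(ft t01).
have : is_derive t 1 f (g t).
  apply: (@eq01_is_derive (fun y => c + primitive g y)) => //; first by move=> u /H.
  by apply: (is_derive_eq (is_deriveD (is_derive_cst c t 1) d)); rewrite add0r.
by case=> _; rewrite derive1E.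
Qed.

(** [derive1] takes a default value where no derivative exists, so its being H^1 does not by itself
    make [f] differentiable. Its agreement with a continuous function does. *)
Lemma rH1_is_derive f (y : R) : rH1 f -> rH1 (derive1 f) -> 0 < y < 1 ->
  is_derive y 1 f (derive1 f y).
Proof.
move=> f1 df1 y01; have [G [cG eG]] := rH1_continuous df1.
rewrite eG //; apply: rH1_derive_continuous => //; apply: aeW => t.
by rewrite /= in_itv; exact: eG.
Qed.

Lemma C1_rH1 f (df : R -> R) : (forall y : R, is_derive y 1 f (df y)) -> continuous df -> rH1 f.
Proof.
move=> dfP cdf; exists df, (f 0); split; first exact: continuous_rL2.
move=> y /andP[y0 y1]; rewrite /Rintegral.
have cf z : {for z, continuous f}.
  by apply: differentiable_continuous; apply/derivable1_diffP; have [] := dfP z.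
rewrite (@continuous_FTC2 _ df f 0 y y0) //=; first by rewrite subrKC.
- exact: continuous_subspaceT.
- split.
  + by move=> z _; have [] := dfP z.
  + by apply: cvg_at_right_filter; exact: cf.
  + by apply: cvg_at_left_filter; exact: cf.
- by move=> z _; rewrite derive1E; have [_ ->] := dfP z.
Qed.

End RealH1.

(** * Borel measurability of the pointwise derivative *)

Section MeasurableDerivative.
Context {R : realType}.
Implicit Types (F : R -> R) (h y : R).

Definition slope F h y : R := h^-1 * (F (h + y) - F y).

Lemma continuous_slope F h : continuous F -> continuous (slope F h).
Proof.
move=> cF y; apply: cvgMr; apply: cvgB; last exact: cF.
apply: (@continuous_comp _ _ _ (fun z : R => h + z) F); last exact: cF.
by apply: cvgD; [exact: cvg_cst|exact: cvg_id].
Qed.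

Lemma continuous_slope_step F h y : continuous F -> h != 0 ->
  {for h, continuous (slope F ^~ y)}.
Proof.
move=> cF h0; apply: cvgM; first exact: cvgV (cvg_id).
apply: cvgB; last exact: cvg_cst.
apply: (@continuous_comp _ _ _ (fun z : R => z + y) F); last exact: cF.
by apply: cvgD; [exact: cvg_id|exact: cvg_cst].
Qed.

(** An enumeration of pairs of rationals, so that intersections over them are countable. Integers
    that code no pair give [(0, 0)], which [small_steps] discards. *)
Definition rat_pair (k : nat) : rat * rat := odflt (0, 0) (unpickle k).

Definition small_steps (m k : nat) : bool :=
  let p : R := ratr (rat_pair k).1 in let q : R := ratr (rat_pair k).2 in
  [&& p != 0, q != 0, `|p| < m.+1%:R^-1 & `|q| < m.+1%:R^-1].

Definition slopes_close F (n k : nat) : set R :=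
  [set y | `|slope F (ratr (rat_pair k).1) y - slope F (ratr (rat_pair k).2) y|
           <= n.+1%:R^-1].

(* Cauchy's criterion for the slopes of F over rational steps. *)
Definition derivable_set F : set R := \bigcap_n \bigcup_m \bigcap_k
  (if small_steps m k then slopes_close F n k else setT).

Lemma measurable_derivable_set F : continuous F -> measurable (derivable_set F).
Proof.
move=> cF; apply: bigcapT_measurable => n; apply: bigcupT_measurable => m.
apply: bigcapT_measurable => k; case: ifP => _ //; rewrite -[slopes_close _ _ _]setTI.
apply: measurable_fun_le => //.
apply: measurableT_comp => //; apply: measurable_funB;
  by apply: continuous_measurable_fun; exact: continuous_slope.
Qed.

Lemma derivableE F y : derivable F y 1 <-> cvg (slope F h y @[h --> (0 : R)^']).
Proof.
rewrite /derivable /slope (_ : (fun h => _) = (fun h => h^-1 * (F (h + y) - F y))) //.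
by apply/funext => h; rewrite /GRing.scale /= mulr1.
Qed.

(** The slope is continuous in its nonzero step. Rational steps therefore suffice to test
    differentiability, which makes it a countable condition. *)
Lemma rat_step F y h (d e : R) : continuous F -> h != 0 -> `|h| < d -> 0 < e ->
  exists p : rat, [/\ ratr p != 0 :> R, `|ratr p| < d & `|slope F h y - slope F (ratr p) y| < e].
Proof.
move=> cF h0 hd e0.
have : \forall z \near h, [/\ z != 0, `|z| < d & `|slope F h y - slope F z y| < e].
  near=> z; split.
  - near: z; apply: (@open_nbhs_nbhs _ h); split => //; exact: open_neq.
  - near: z; have cn := @norm_continuous _ R^o h; exact: (cvgr_lt _ cn).
  - near: z; have := @continuous_slope_step F h y cF h0 => /cvgrPdist_lt; exact.
move=> /nbhs_ballP[r r0 hr].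
have [|p] := @rat_in_itvoo R (h - r) (h + r); first by rewrite ltrD2l gtrN.
rewrite in_itv /= => /andP[p1 p2]; exists p; apply: hr.
by rewrite /ball /= ltr_norml; apply/andP; split; lra.
Unshelve. all: by end_near. Qed.

Lemma derivable_setP F y : continuous F -> derivable_set F y <-> derivable F y 1.
Proof.
move=> cF; rewrite derivableE; split=> [H|].
  apply/cauchy_cvgP/cauchyP => e e0.
  have [n _ ne] : exists2 n : nat, True & n.+1%:R^-1 < e / 2.
    have [n _ hn] := @near_infty_natSinv_lt R (PosNum (divr_gt0 e0 (ltr0Sn R 1))).
    by exists n => //; apply: (hn n) => /=.
  have [m _ Hm] := H n I.
  (* A fixed admissible step, whose slope is the centre for Cauchy's criterion: the slope at a real
     step is close to one at a rational step, which is compared with that at [p0]. *)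
  pose p0 : rat := m.+2%:R^-1.
  have p0E : ratr p0 = m.+2%:R^-1 :> R by rewrite /p0 fmorphV rmorph_nat.
  have p00 : (ratr p0 : R) != 0 by rewrite p0E invr_eq0 pnatr_eq0.
  have p0m : `|ratr p0 : R| < m.+1%:R^-1.
    by rewrite p0E gtr0_norm ?invr_gt0 ?ltr0n // ltf_pV2 ?posrE ?ltr0n // ltr_nat.
  have m0 : 0 < m.+1%:R^-1 :> R by rewrite invr_gt0 ltr0n.
  have n0 : 0 < n.+1%:R^-1 :> R by rewrite invr_gt0 ltr0n.
  exists (slope F (ratr p0) y); 
  change (\forall h \near (0 : R)^', ball (slope F (ratr p0) y) e (slope F h y)).
  near=> h; have h0 : h != 0 by near: h; apply/nbhs_ballP; exists 1 => //= z _ zn.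
  have hm : `|h| < m.+1%:R^-1 by near: h; exact: dnbhs0_lt.
  have [p [pp0 pm hp]] := rat_step y cF h0 hm n0.
  have := Hm (pickle (p, p0)) I; rewrite /small_steps /slopes_close /rat_pair pickleK /=.
  rewrite pp0 p00 pm p0m /= => hc.
  rewrite /ball /= distrC -(subrK (slope F (ratr p) y) (slope F h y)) -addrA.
  by rewrite (le_lt_trans (ler_normD _ _)) // (splitr e) ltrD // ?(lt_trans hp) // (le_lt_trans hc).
move=> /cvg_ex[l hl] n _.
have n0 : 0 < n.+1%:R^-1 / 2 :> R by rewrite divr_gt0 // invr_gt0 ltr0n.
have : \forall h \near (0 : R)^', `|l - slope F h y| < n.+1%:R^-1 / 2.
  by move/cvgrPdist_lt : hl; exact.
move=> /nbhs_ballP[d /= d0 hd].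
have [m _ hm] := @near_infty_natSinv_lt R (PosNum d0).
exists m => // k _; case: ifP => // /and4P[p0 q0 pm qm].
have md : m.+1%:R^-1 < d by apply: (hm m) => /=.
rewrite /slopes_close /=.
have B (z : R) : `|z| < m.+1%:R^-1 -> ball (0 : R) d z.
  by move=> zm; rewrite /ball /= sub0r normrN (lt_trans zm).
have h1 := hd _ (B _ pm) p0; have h2 := hd _ (B _ qm) q0.
rewrite -(subrK l (slope F _ y)) -addrA (le_trans (ler_normD _ _)) // (splitr n.+1%:R^-1).
by rewrite lerD // ltW // distrC.
Unshelve. all: by end_near. Qed.

Lemma derive1_slope F y : derivable F y 1 ->
  (fun n : nat => slope F n.+1%:R^-1 y) @ \oo --> derive1 F y.
Proof.
move=> dF; have := dF; rewrite derivableE => /cvg_ex[l hl].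
have -> : derive1 F y = l by apply/cvg_lim.
move/cvgr_dnbhsP : hl; apply; split; last exact: cvg_harmonic.
by move=> n; rewrite invr_eq0 pnatr_eq0.
Qed.

Lemma measurable_derive1 F : continuous F -> measurable_fun setT (derive1 F).
Proof.
move=> cF; have mD := measurable_derivable_set cF.
rewrite -(setUv (derivable_set F)); apply/measurable_funU => //; first exact: measurableC.
split.
  apply: (@measurable_fun_cvg _ _ _ _ (fun n => slope F n.+1%:R^-1)).
    move=> n; apply: measurable_funTS; apply: continuous_measurable_fun.
    exact: continuous_slope.
  by move=> y /derivable_setP -/(_ cF); exact: derive1_slope.
(* Where the slopes have no limit, [lim] returns the default [point], so [derive1 F] is constant off
   [derivable_set F]. *)
apply: (eq_measurable_fun (cst (point : R))); last exact: measurable_cst.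
move=> y; rewrite inE /= => nd; rewrite /derive1 /lim /lim_in getPN //.
move=> l hl; apply: nd; apply/derivable_setP => //; apply/derivableE; apply/cvg_ex.
by exists l.
Qed.

End MeasurableDerivative.
Section ComplexSpaces.
Context {R : realType}.
Local Notation C := R[i].
Local Notation mu := (@lebesgue_measure R).
Local Notation I01 := (`](0 : R), 1[%classic : set R).
Local Notation Re := (@complex.Re R).
Local Notation Im := (@complex.Im R).
Implicit Types (f g : R -> C) (a c z : C) (y : R).

Lemma ae_imply (P Q : R -> Prop) : (forall y, P y -> Q y) ->
  {ae mu, forall y, P y} -> {ae mu, forall y, Q y}.
Proof. by move=> PQ; apply: (@filterS _ _ (ae_filter_ringOfSetsType mu)). Qed.

Lemma ae_imply2 (P Q S : R -> Prop) : (forall y, P y -> Q y -> S y) ->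
  {ae mu, forall y, P y} -> {ae mu, forall y, Q y} -> {ae mu, forall y, S y}.
Proof. by move=> PQS; apply: (@filterS2 _ _ (ae_filter_ringOfSetsType mu)). Qed.

Lemma ReD a c : Re (a + c) = Re a + Re c. Proof. by case: a c => ? ? [? ?]. Qed.
Lemma ImD a c : Im (a + c) = Im a + Im c. Proof. by case: a c => ? ? [? ?]. Qed.
Lemma ReN a : Re (- a) = - Re a. Proof. by case: a. Qed.
Lemma ImN a : Im (- a) = - Im a. Proof. by case: a. Qed.
Lemma ReM a c : Re (a * c) = Re a * Re c - Im a * Im c. Proof. by case: a c => ? ? [? ?]. Qed.
Lemma ImM a c : Im (a * c) = Re a * Im c + Im a * Re c. Proof. by case: a c => ? ? [? ?]. Qed.
Lemma complexP a c : Re a = Re c -> Im a = Im c -> a = c.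
Proof. by case: a c => ? ? [? ?] /= -> ->. Qed.
Definition complexE := (ReD, ImD, ReN, ImN, ReM, ImM).

Lemma cmod_sqr z : cmod z ^+ 2 = Re z ^+ 2 + Im z ^+ 2.
Proof. by case: z => x y; rewrite /cmod /= sqr_sqrtr // addr_ge0 ?sqr_ge0. Qed.

Lemma cmod_ge0 z : 0 <= cmod z. Proof. by case: z => x y; rewrite /cmod /= sqrtr_ge0. Qed.

Lemma cmodM a c : cmod (a * c) = cmod a * cmod c.
Proof. exact: ComplexField.Normc.normcM. Qed.

Lemma cmod0 : cmod (0 : C) = 0. Proof. exact: ComplexField.Normc.normc0. Qed.

Lemma cmod_eq0 z : cmod z = 0 -> z = 0.
Proof. exact: ComplexField.Normc.eq0_normc. Qed.

Lemma cmodD a c : cmod (a + c) <= cmod a + cmod c.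
Proof. exact: le_normcD. Qed.

Lemma L2P f : L2 f <-> rL2 (fun y => Re (f y)) /\ rL2 (fun y => Im (f y)).
Proof.
split=> [[mr mi If]|[[mr Ir] [mi Ii]]].
  split; split => //; apply: (le_integrable01 _ _ If).
  - exact: measurable_funX.
  - by move=> y _; rewrite ger0_norm ?sqr_ge0 // cmod_sqr lerDl sqr_ge0.
  - exact: measurable_funX.
  - by move=> y _; rewrite ger0_norm ?sqr_ge0 // cmod_sqr lerDr sqr_ge0.
split => //; apply: (eq_integrable01 _ (integrableD01 Ir Ii)).
by move=> y _; rewrite -EFinD cmod_sqr.
Qed.

Lemma H1P f : H1 f <-> rH1 (fun y => Re (f y)) /\ rH1 (fun y => Im (f y)).
Proof.
split=> [[g [c [g2 H]]]|[[gr [cr [gr2 Hr]]] [gi [ci [gi2 Hi]]]]].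
  have [g2r g2i] := (L2P g).1 g2; split.
    by exists (fun y => Re (g y)), (Re c); split => // y y01; rewrite H // ReD.
  by exists (fun y => Im (g y)), (Im c); split => // y y01; rewrite H // ImD.
exists (fun y => Complex (gr y) (gi y)), (Complex cr ci); split; first exact/L2P.
by move=> y y01; apply: complexP; rewrite ?ReD ?ImD ?Hr ?Hi.
Qed.

Lemma L2_lin a f g : L2 f -> L2 g -> L2 (fun y => a * f y + g y).
Proof.
move=> /L2P[fr fi] /L2P[gr gi]; apply/L2P; split.
  rewrite (_ : (fun y => _) = (fun y => Re a * Re (f y) + (- Im a * Im (f y) + Re (g y)))).
    by apply: rL2_lin => //; apply: rL2_lin.
  by apply/funext => y; rewrite !complexE; ring.
rewrite (_ : (fun y => _) = (fun y => Re a * Im (f y) + (Im a * Re (f y) + Im (g y)))).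
  by apply: rL2_lin => //; apply: rL2_lin.
by apply/funext => y; rewrite !complexE; ring.
Qed.

Lemma H1_lin a f g : H1 f -> H1 g -> H1 (fun y => a * f y + g y).
Proof.
move=> /H1P[fr fi] /H1P[gr gi]; apply/H1P; split.
  rewrite (_ : (fun y => _) = (fun y => Re a * Re (f y) + (- Im a * Im (f y) + Re (g y)))).
    by apply: rH1_lin => //; apply: rH1_lin.
  by apply/funext => y; rewrite !complexE; ring.
rewrite (_ : (fun y => _) = (fun y => Re a * Im (f y) + (Im a * Re (f y) + Im (g y)))).
  by apply: rH1_lin => //; apply: rH1_lin.
by apply/funext => y; rewrite !complexE; ring.
Qed.

Lemma eq_H1 f g : (forall y, 0 < y < 1 -> f y = g y) -> H1 f -> H1 g.
Proof.
by move=> fg /H1P[fr fi]; apply/H1P; split;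
  [apply: eq_rH1 fr|apply: eq_rH1 fi] => y /fg ->.
Qed.

Definition ccontinuous f := continuous (fun y => Re (f y)) /\ continuous (fun y => Im (f y)).

Lemma ccontinuous_L2 f : ccontinuous f -> L2 f.
Proof. by move=> [cr ci]; apply/L2P; split; exact: continuous_rL2. Qed.

Lemma H1_ccontinuous f : H1 f -> exists F, ccontinuous F /\
  forall y, 0 < y < 1 -> f y = F y.
Proof.
move=> /H1P[/rH1_continuous[Fr [cr er]] /rH1_continuous[Fi [ci ei]]].
exists (fun y => Complex (Fr y) (Fi y)); split; first by split.
by move=> y y01; apply: complexP; [exact: er|exact: ei].
Qed.

Lemma C1_H1 f (df : R -> C) : (forall y, is_cderive f y (df y)) -> ccontinuous df -> H1 f.
Proof.
move=> dfP [cr ci]; apply/H1P; split.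
  by apply: (C1_rH1 _ cr) => y; have [] := dfP y.
by apply: (C1_rH1 _ ci) => y; have [] := dfP y.
Qed.

Lemma is_cderiveE f y c : is_cderive f y c -> cderiv f y = c.
Proof.
by case=> [[_ r] [_ i]]; apply: complexP; rewrite /cderiv /= derive1E.
Qed.

Lemma is_cderive_lin a f g y c d : is_cderive f y c -> is_cderive g y d ->
  is_cderive (fun t => a * f t + g t) y (a * c + d).
Proof.
move=> [fr fi] [gr gi]; split; rewrite !complexE.
  have h := is_deriveD (is_deriveB (is_deriveZ (Re a) fr) (is_deriveZ (Im a) fi)) gr.
  by rewrite (_ : (fun t => _) = (fun t => Re a * Re (f t) - Im a * Im (f t) + Re (g t))) //;
    apply/funext => t; rewrite !complexE.
have h := is_deriveD (is_deriveD (is_deriveZ (Re a) fi) (is_deriveZ (Im a) fr)) gi.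
by rewrite (_ : (fun t => _) = (fun t => Re a * Im (f t) + Im a * Re (f t) + Im (g t))) //;
  apply/funext => t; rewrite !complexE.
Qed.

Lemma eq01_cderiv f g y : (forall t, 0 < t < 1 -> f t = g t) -> 0 < y < 1 ->
  cderiv f y = cderiv g y.
Proof.
move=> fg y01; congr Complex; apply: eq01_derive1 => //; by move=> z /fg ->.
Qed.

Lemma H2_is_cderive f y : H2 f -> 0 < y < 1 -> is_cderive f y (cderiv f y).
Proof.
move=> [/H1P[fr fi] /H1P[dr di]] y01; split; exact: rH1_is_derive.
Qed.

Lemma H1_ae_cderive f : H1 f -> exists g, L2 g /\
  {ae mu, forall y, I01 y -> is_cderive f y (g y)}.
Proof.
move=> /H1P[/rH1_ae_derive[gr [gr2 hr]] /rH1_ae_derive[gi [gi2 hi]]].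
exists (fun y => Complex (gr y) (gi y)); split; first exact/L2P.
apply: ae_imply2 hr hi => y h1 h2 y01.
by split; [exact: h1|exact: h2].
Qed.

Lemma lim_at_left1 (f F : R -> R) : continuous F -> (forall y, 0 < y < 1 -> f y = F y) ->
  lim (f y @[y --> 1^'-]) = F 1.
Proof.
move=> cF fF; apply/cvg_lim; first exact: Rhausdorff.
apply: cvg_trans (cvg_at_left_filter (cF 1)); apply: near_eq_cvg; near=> y.
by rewrite fF //; apply/andP; split; near: y; [exact: nbhs_left_gt|exact: nbhs_left_lt].
Unshelve. all: by end_near. Qed.

Lemma lim_at_right0 (f F : R -> R) : continuous F -> (forall y, 0 < y < 1 -> f y = F y) ->
  lim (f y @[y --> 0^'+]) = F 0.
Proof.
move=> cF fF; apply/cvg_lim; first exact: Rhausdorff.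
apply: cvg_trans (cvg_at_right_filter (cF 0)); apply: near_eq_cvg; near=> y.
by rewrite fF //; apply/andP; split; near: y; [exact: nbhs_right_gt|exact: nbhs_right_lt].
Unshelve. all: by end_near. Qed.

Lemma tr1E f F : ccontinuous F -> (forall y, 0 < y < 1 -> f y = F y) -> tr1 f = F 1.
Proof.
move=> [cr ci] fF; apply: complexP => /=.
  by apply: (lim_at_left1 cr) => y /fF ->.
by apply: (lim_at_left1 ci) => y /fF ->.
Qed.

Lemma tr0E f F : ccontinuous F -> (forall y, 0 < y < 1 -> f y = F y) -> tr0 f = F 0.
Proof.
move=> [cr ci] fF; apply: complexP => /=.
  by apply: (lim_at_right0 cr) => y /fF ->.
by apply: (lim_at_right0 ci) => y /fF ->.
Qed.

Lemma ccontinuous_lin a f g : ccontinuous f -> ccontinuous g ->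
  ccontinuous (fun y => a * f y + g y).
Proof.
move=> [fr fi] [gr gi]; split => y.
  rewrite (_ : (fun t => _) = (fun t => Re a * Re (f t) - Im a * Im (f t) + Re (g t))); last first.
    by apply/funext => t; rewrite !complexE.
  by apply: cvgD; [apply: cvgB; apply: cvgMr; [exact: fr|exact: fi]|exact: gr].
rewrite (_ : (fun t => _) = (fun t => Re a * Im (f t) + Im a * Re (f t) + Im (g t))); last first.
  by apply/funext => t; rewrite !complexE.
by apply: cvgD; [apply: cvgD; apply: cvgMr; [exact: fi|exact: fr]|exact: gi].
Qed.

Lemma tr1_lin a f g : H1 f -> H1 g -> tr1 (fun y => a * f y + g y) = a * tr1 f + tr1 g.
Proof.
move=> /H1_ccontinuous[F [cF fF]] /H1_ccontinuous[G [cG gG]].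
rewrite (tr1E cF fF) (tr1E cG gG); apply: (tr1E (ccontinuous_lin a cF cG)).
by move=> y y01; rewrite fF // gG.
Qed.

Lemma tr0_lin a f g : H1 f -> H1 g -> tr0 (fun y => a * f y + g y) = a * tr0 f + tr0 g.
Proof.
move=> /H1_ccontinuous[F [cF fF]] /H1_ccontinuous[G [cG gG]].
rewrite (tr0E cF fF) (tr0E cG gG); apply: (tr0E (ccontinuous_lin a cF cG)).
by move=> y y01; rewrite fF // gG.
Qed.

Lemma eq_tr1 f g : H1 g -> (forall y, 0 < y < 1 -> f y = g y) -> tr1 f = tr1 g.
Proof.
move=> /H1_ccontinuous[G [cG gG]] fg; rewrite (tr1E cG gG); apply: tr1E => // y y01.
by rewrite fg // gG.
Qed.

Lemma eq_tr0 f g : H1 g -> (forall y, 0 < y < 1 -> f y = g y) -> tr0 f = tr0 g.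
Proof.
move=> /H1_ccontinuous[G [cG gG]] fg; rewrite (tr0E cG gG); apply: tr0E => // y y01.
by rewrite fg // gG.
Qed.

Lemma H2_lin a f g : H2 f -> H2 g -> H2 (fun y => a * f y + g y).
Proof.
move=> f2 g2; split; first exact: (H1_lin _ f2.1 g2.1).
apply: (@eq_H1 (fun y => a * cderiv f y + cderiv g y)); last exact: (H1_lin _ f2.2 g2.2).
move=> y y01; apply/esym/is_cderiveE.
by apply: is_cderive_lin; exact: H2_is_cderive.
Qed.

(* The pointwise second derivative of an H^2 function is Borel measurable, even
   at the points where it takes the junk value of lim. *)
Lemma H1_cderiv_L2 f : H1 f -> L2 (cderiv f).
Proof.
move=> f1; have [F [[cr ci] eF]] := H1_ccontinuous f1.
have [g [g2 H]] := H1_ae_cderive f1; have [gr gi] := (L2P g).1 g2.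
have m (u U : R -> R) : continuous U -> (forall y, 0 < y < 1 -> u y = U y) ->
    measurable_fun I01 (derive1 u).
  move=> cU uU; apply: (eq_measurable_fun (derive1 U)).
    by move=> y; rewrite inE /= in_itv /= => y01; apply/esym/eq01_derive1.
  by apply: measurable_funTS; exact: measurable_derive1.
apply/L2P; split.
  apply: (ae_eq_rL2 _ gr); first by apply: (m _ _ cr) => y /eF ->.
  by apply: ae_imply H => y h y01; rewrite -(is_cderiveE (h y01)).
apply: (ae_eq_rL2 _ gi); first by apply: (m _ _ ci) => y /eF ->.
by apply: ae_imply H => y h y01; rewrite -(is_cderiveE (h y01)).
Qed.

End ComplexSpaces.
Section StateSpace.
Context {R : realType}.
Local Notation C := R[i].
Local Notation state := (@state R).
Local Notation mu := (@lebesgue_measure R).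
Local Notation I01 := (`](0 : R), 1[%classic : set R).
Implicit Types (f g : R -> C) (a : C) (U V W : state).

Lemma s_phi_lin a U V : s_phi (a *: U + V) = fun y => a * s_phi U y + s_phi V y.
Proof. by []. Qed.
Lemma s_u_lin a U V : s_u (a *: U + V) = fun y => a * s_u U y + s_u V y.
Proof. by []. Qed.
Lemma s_eta_lin a U V : s_eta (a *: U + V) = a * s_eta U + s_eta V.
Proof. by []. Qed.
Lemma s_z_lin a U V : s_z (a *: U + V) = a * s_z U + s_z V.
Proof. by []. Qed.

Lemma eqY_refl U : eqY U U.
Proof. by split => //; apply: aeW. Qed.

Lemma eqY_sym U V : eqY U V -> eqY V U.
Proof.
move=> [h1 h2 h3 h4]; split => //; first by move=> y /h1.
by apply: ae_imply h2 => y h /h.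
Qed.

Lemma eqY_trans V U W : eqY U V -> eqY V W -> eqY U W.
Proof.
move=> [h1 h2 h3 h4] [k1 k2 k3 k4]; split.
- by move=> y y01; rewrite h1 // k1.
- by apply: ae_imply2 h2 k2 => y h k y01; rewrite h // k.
- by rewrite h3.
- by rewrite h4.
Qed.

Lemma eqY_lin a U U' V V' : eqY U U' -> eqY V V' -> eqY (a *: U + V) (a *: U' + V').
Proof.
move=> [h1 h2 h3 h4] [k1 k2 k3 k4]; split.
- by move=> y y01; rewrite !s_phi_lin h1 // k1.
- by apply: ae_imply2 h2 k2 => y h k y01; rewrite !s_u_lin h // k.
- by rewrite !s_eta_lin h3 k3.
- by rewrite !s_z_lin h4 k4.
Qed.

Lemma eqYZ a U V : eqY U V -> eqY (a *: U) (a *: V).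
Proof. by move=> h; have := eqY_lin a h (eqY_refl 0); rewrite !addr0. Qed.

Lemma eqYD U U' V V' : eqY U U' -> eqY V V' -> eqY (U + V) (U' + V').
Proof. by move=> h k; have := eqY_lin 1 h k; rewrite !scale1r. Qed.

Lemma eqYB U U' V V' : eqY U U' -> eqY V V' -> eqY (U - V) (U' - V').
Proof. by move=> h k; apply: eqYD => //; rewrite -(scaleN1r V) -(scaleN1r V'); exact: eqYZ. Qed.

Lemma eqY_subr0 U V : eqY (U - V) 0 -> eqY U V.
Proof.
move=> h; have := eqYD h (eqY_refl V); by rewrite subrK add0r.
Qed.

Lemma eqY_sum n (F G : 'I_n -> state) : (forall i, eqY (F i) (G i)) ->
  eqY (\sum_(i < n) F i) (\sum_(i < n) G i).
Proof.
elim: n F G => [|n IH] F G h; first (rewrite 2!big_ord0; exact: eqY_refl).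
rewrite 2!big_ord_recr /=. apply: eqYD; last exact: h. exact: IH.
Qed.

Lemma eq_L2 f g : (forall y, 0 < y < 1 -> f y = g y) -> L2 f -> L2 g.
Proof.
have E (u v : R -> R) : (forall y, 0 < y < 1 -> u y = v y) -> rL2 u -> rL2 v.
  move=> uv [m2 I2]; split.
    by apply: eq_measurable_fun m2 => y; rewrite inE /= in_itv /= => /uv.
  by apply: eq_integrable01 I2 => y; rewrite /= in_itv /= => /uv ->.
by move=> fg /L2P[fr fi]; apply/L2P; split; [apply: E fr|apply: E fi] => y /fg ->.
Qed.

Lemma H1_L2 f : H1 f -> L2 f.
Proof.
move=> /H1_ccontinuous[F [cF fF]]; apply: (eq_L2 _ (ccontinuous_L2 cF)).
by move=> y /fF.
Qed.

Lemma ccontinuous_cst a : ccontinuous (fun=> a).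
Proof. by split => y; exact: cvg_cst. Qed.

Lemma is_cderive_cst a (y : R) : is_cderive (fun=> a) y 0.
Proof. by split; exact: is_derive_cst. Qed.

Lemma H1_cst a : H1 (fun=> a).
Proof. by apply: (@C1_H1 _ _ (fun=> 0)); [move=> y; exact: is_cderive_cst|exact: ccontinuous_cst]. Qed.

Lemma H2_cst a : H2 (fun=> a).
Proof.
split; first exact: H1_cst.
apply: (@eq_H1 _ (fun=> 0)); last exact: H1_cst.
by move=> y _; apply/esym/is_cderiveE/is_cderive_cst.
Qed.

Lemma inY_lin a U V : inY U -> inY V -> inY (a *: U + V).
Proof. by move=> [h1 h2] [k1 k2]; split; [exact: (H1_lin a h1 k1)|exact: (L2_lin a h2 k2)]. Qed.

Lemma inY0 : inY (0 : state).
Proof. by split; [exact: H1_cst|apply: H1_L2; exact: H1_cst]. Qed.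

Lemma inYZ a U : inY U -> inY (a *: U).
Proof. by move=> h; have := inY_lin a h inY0; rewrite addr0. Qed.

Lemma inYD U V : inY U -> inY V -> inY (U + V).
Proof. by move=> h k; have := inY_lin 1 h k; rewrite scale1r. Qed.

Lemma inYB U V : inY U -> inY V -> inY (U - V).
Proof. by move=> h k; apply: inYD => //; rewrite -scaleN1r; exact: inYZ. Qed.

Definition normsq U : R := sqnorm_int (s_phi U) + sqnorm_int (cderiv (s_phi U))
            + sqnorm_int (s_u U) + cmod (s_eta U) ^+ 2 + cmod (s_z U) ^+ 2.

Lemma sqnorm_int_ge0 f : 0 <= sqnorm_int f.
Proof. by apply: Rintegral_ge0 => y _; exact: sqr_ge0. Qed.

Lemma normsq_ge0 U : 0 <= normsq U.
Proof. by rewrite /normsq !addr_ge0 ?sqnorm_int_ge0 ?sqr_ge0. Qed.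

Lemma measurable_cmod2 f : L2 f -> measurable_fun I01 (fun y => cmod (f y) ^+ 2).
Proof.
move=> [_ _ If]; apply/measurable_EFinP; exact: measurable_int If.
Qed.

Lemma sqnorm_int_ae f g : L2 f -> L2 g -> {ae mu, forall y, 0 < y < 1 -> f y = g y} ->
  sqnorm_int f = sqnorm_int g.
Proof.
move=> f2 g2 fg; rewrite /sqnorm_int /Rintegral; congr fine.
apply: (@ae_eq_integral _ _ _ mu I01 (fun y => (cmod (g y) ^+ 2)%:E) (fun y => (cmod (f y) ^+ 2)%:E)).
- exact: measurable_itv.
- by apply/measurable_EFinP; exact: measurable_cmod2.
- by apply/measurable_EFinP; exact: measurable_cmod2.
apply: ae_imply fg => y h; rewrite /= in_itv /= => y01; congr EFin; congr (_ ^+ 2).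
by rewrite h.
Qed.

Lemma eq_sqnorm_int f g : (forall y, 0 < y < 1 -> f y = g y) -> sqnorm_int f = sqnorm_int g.
Proof.
move=> fg; apply: eq_Rintegral => y; rewrite inE /= in_itv /= => y01.
by rewrite fg.
Qed.

Lemma cmod_lin_sqr a (x z : C) :
  cmod (a * x + z) ^+ 2 <= 2 * cmod a ^+ 2 * cmod x ^+ 2 + 2 * cmod z ^+ 2.
Proof.
have := cmodD (a * x) z; rewrite cmodM.
have := cmod_ge0 (a * x + z); have := cmod_ge0 a; have := cmod_ge0 x; have := cmod_ge0 z.
set s := cmod (_ + _); set p := cmod a; set q := cmod x; set t := cmod z => t0 q0 p0 s0 h.
have pq : 0 <= p * q by rewrite mulr_ge0.
have : s ^+ 2 <= (p * q + t) ^+ 2 by rewrite lerXn2r ?nnegrE ?addr_ge0.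
have := sqr_ge0 (p * q - t); clearbody s p q t; clear; nra.
Qed.

Lemma sqnorm_int_lin a f g : L2 f -> L2 g ->
  sqnorm_int (fun y => a * f y + g y) <= 2 * cmod a ^+ 2 * sqnorm_int f + 2 * sqnorm_int g.
Proof.
move=> f2 g2; have [_ _ If] := f2; have [_ _ Ig] := g2.
have [_ _ Ifg] := L2_lin a f2 g2.
have mI : measurable I01 by exact: measurable_itv.
rewrite /sqnorm_int -!RintegralZl // -RintegralD //; last 2 first.
- exact: (integrableZl01 (2 * cmod a ^+ 2) If).
- exact: (integrableZl01 2 Ig).
apply: le_Rintegral => //.
  exact: (integrableD01 (integrableZl01 (2 * cmod a ^+ 2) If) (integrableZl01 2 Ig)).
by move=> y _; exact: cmod_lin_sqr.
Qed.

(** The pointwise bound [cmod_lin_sqr] integrates term by term. It stands in for the triangle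
    inequality of [normY]: convergence to 0 and vanishing are insensitive to the factor 2. *)
Lemma normsq_lin a U V : inY U -> inY V ->
  normsq (a *: U + V) <= 2 * cmod a ^+ 2 * normsq U + 2 * normsq V.
Proof.
move=> [U1 U2] [V1 V2]; rewrite /normsq.
have h1 := sqnorm_int_lin a (H1_L2 U1) (H1_L2 V1).
have h2 := sqnorm_int_lin a U2 V2.
have h3 := sqnorm_int_lin a (H1_cderiv_L2 U1) (H1_cderiv_L2 V1).
(* Differentiation is linear only almost everywhere here, since H^1 functions need not be
   differentiable at every point. *)
have e3 : sqnorm_int (cderiv (s_phi (a *: U + V))) =
    sqnorm_int (fun y => a * cderiv (s_phi U) y + cderiv (s_phi V) y).
  apply: sqnorm_int_ae.
  - exact/H1_cderiv_L2/(H1_lin a U1 V1).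
  - exact: L2_lin (H1_cderiv_L2 U1) (H1_cderiv_L2 V1).
  - have [f [_ hf]] := H1_ae_cderive U1; have [g [_ hg]] := H1_ae_cderive V1.
    apply: ae_imply2 hf hg => y hf hg y01.
    have y01' : I01 y by rewrite /= in_itv.
    rewrite (is_cderiveE (hf y01')) (is_cderiveE (hg y01')).
    exact: (is_cderiveE (is_cderive_lin a (hf y01') (hg y01'))).
have h4 := cmod_lin_sqr a (s_eta U) (s_eta V); have h5 := cmod_lin_sqr a (s_z U) (s_z V).
rewrite e3 s_phi_lin s_u_lin s_eta_lin s_z_lin.
have D5 (c d u1 u2 u3 u4 u5 v1 v2 v3 v4 v5 : R) :
    c * (u1 + u2 + u3 + u4 + u5) + d * (v1 + v2 + v3 + v4 + v5) =
    c * u1 + d * v1 + (c * u2 + d * v2) + (c * u3 + d * v3)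
    + (c * u4 + d * v4) + (c * u5 + d * v5) by ring.
by rewrite D5 !lerD.
Qed.

Lemma eqY_normsq U V : inY U -> inY V -> eqY U V -> normsq U = normsq V.
Proof.
move=> [U1 U2] [V1 V2] [h1 h2 h3 h4]; rewrite /normsq h3 h4 (eq_sqnorm_int h1).
have e2 : sqnorm_int (cderiv (s_phi U)) = sqnorm_int (cderiv (s_phi V)).
  by apply: eq_sqnorm_int => y y01; exact: (eq01_cderiv h1 y01).
by rewrite (sqnorm_int_ae U2 V2 h2) e2.
Qed.

Lemma normsq0 : normsq 0 = 0.
Proof.
have h := normsq_lin 0 inY0 inY0; have n0 := normsq_ge0 0.
have : sqnorm_int (fun=> 0 : C) = 0 :> R.
  have -> : sqnorm_int (fun=> 0 : C) = \int[mu]_(y in I01) (0 : R).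
    by apply: eq_Rintegral => y _; rewrite cmod0 expr0n.
  by rewrite Rintegral_cst ?mul0r //; exact: measurable_itv.
move=> e; rewrite /normsq [X in _ + X + _ + _ + _](_ : _ = 0).
  by rewrite !e !add0r cmod0 expr0n /= addr0.
rewrite -[RHS]e; apply: eq_sqnorm_int => y _.
exact/is_cderiveE/is_cderive_cst.
Qed.

Lemma continuous_ae0 (F : R -> R) : continuous F ->
  {ae mu, forall y, 0 < y < 1 -> F y = 0} -> forall y, 0 < y < 1 -> F y = 0.
Proof.
move=> cF [A [mA A0 sA]] y y01; apply/eqP/negPn/negP => Fy.
have : \forall z \near y, 0 < z < 1 /\ F z != 0.
  near=> z; split; first by near: z; exact: near_I01.
  by near: z; apply: (cvgr_neq0 _ (cF y)).
move=> /nbhs_ballP[e /= e0 he].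
have sub : `]y, (y + e)[ `<=` A.
  move=> z /=; rewrite in_itv /= => /andP[yz zy]; apply: sA => /=.
  have [z01 Fz] : 0 < z < 1 /\ F z != 0.
    by apply: he; rewrite /ball /= distrC ger0_norm ?subr_ge0 ?ltW //; lra.
  by move=> /(_ z01)/eqP; rewrite (negbTE Fz).
have : (mu `]y, (y + e)%R[%classic <= mu A)%E.
  by apply: le_measure => //; rewrite inE //; exact: measurable_itv.
rewrite A0; suff : (0 < mu `]y, (y + e)%R[%classic)%E by move=> /lt_le_trans h /h; rewrite ltxx.
rewrite lebesgue_measure_itv /= lte_fin ltrDl e0 -EFinB lte_fin.
by rewrite addrAC subrr add0r.
Unshelve. all: by end_near. Qed.

Lemma sqnorm_int_eq0 f : L2 f -> sqnorm_int f = 0 -> {ae mu, forall y, 0 < y < 1 -> f y = 0}.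
Proof.
move=> f2 f0; have [_ _ If] := f2.
have fin : (\int[mu]_(y in I01) (cmod (f y) ^+ 2)%:E)%E \is a fin_num.
  by apply: integrable_fin_num If; exact: measurable_itv.
have e0 : (\int[mu]_(y in I01) (cmod (f y) ^+ 2)%:E = 0)%E.
  by rewrite -(fineK fin); congr EFin; exact: f0.
have := (@ae_eq_integral_abs _ _ _ mu I01 (measurable_itv _) (fun y => (cmod (f y) ^+ 2)%:E)
  (measurable_int _ If)).1.
rewrite -[X in X = _ -> _]/(\int[mu]_(y in I01) `|(cmod (f y) ^+ 2)%:E|)%E.
have -> : (\int[mu]_(y in I01) `|(cmod (f y) ^+ 2)%:E| = 0)%E.
  rewrite -[RHS]e0; apply: eq_integral => y _.
  by rewrite gee0_abs // lee_fin sqr_ge0.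
move=> /(_ erefl); apply: ae_imply => y h y01.
have /h /= [] : I01 y by rewrite /= in_itv.
by move=> /eqP; rewrite sqrf_eq0 => /eqP /cmod_eq0.
Qed.

(** [eqY] asks for equality of the first components at every point of []0, 1[], and the continuous
    representative supplies it. *)
Lemma normsq_eq0 U : inY U -> normsq U = 0 -> eqY U 0.
Proof.
move=> [U1 U2]; rewrite /normsq => /eqP.
rewrite !paddr_eq0 ?addr_ge0 ?sqnorm_int_ge0 ?sqr_ge0 //.
move=> /andP[/andP[/andP[/andP[/eqP p0 _] /eqP u0]] ]; rewrite !sqrf_eq0 => /eqP e0 /eqP z0.
split; last 2 first.
- exact: cmod_eq0.
- exact: cmod_eq0.
- have [F [[cr ci] eF]] := H1_ccontinuous U1.
  have h := sqnorm_int_eq0 (H1_L2 U1) p0.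
  move=> y y01; rewrite eF //; apply: complexP => /=.
    apply: (continuous_ae0 cr _ y01).
    by apply: ae_imply h => t ht t01; rewrite -eF // ht.
  apply: (continuous_ae0 ci _ y01).
  by apply: ae_imply h => t ht t01; rewrite -eF // ht.
- exact: sqnorm_int_eq0.
Qed.

End StateSpace.
Section LinearOperator.
Context {R : realType}.
Variables (beta kappa : R).
Local Notation C := R[i].
Local Notation state := (@state R).
Local Notation mu := (@lebesgue_measure R).
Local Notation I01 := (`](0 : R), 1[%classic : set R).
Local Notation Re := (@complex.Re R).
Local Notation Im := (@complex.Im R).
Local Notation domL := (@domL R beta).
Local Notation Lop := (@Lop R beta kappa).
Local Notation gker := (@gker R beta kappa).
Implicit Types (f g : R -> C) (a lam nu : C) (U V W : state).

Lemma is_cderive_real (f : R -> R) (y d : R) : is_derive y 1 f d ->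
  is_cderive (fun t => (f t)%:C%C) y d%:C%C.
Proof. by move=> h; split => //=; exact: is_derive_cst. Qed.

Lemma ccontinuous_real (f : R -> R) : continuous f -> ccontinuous (fun t => (f t)%:C%C).
Proof. by move=> h; split => // y; exact: cvg_cst. Qed.

Lemma H1_real (f df : R -> R) : (forall y : R, is_derive y 1 f (df y)) -> continuous df ->
  H1 (fun y => (f y)%:C%C).
Proof.
move=> dfP cf; apply: (@C1_H1 _ _ (fun y => (df y)%:C%C)); last exact: ccontinuous_real.
by move=> y; exact: is_cderive_real.
Qed.

Lemma is_derive_sqr (y : R) : is_derive y 1 (fun t : R => t ^+ 2) (2 * y).
Proof. by apply: is_derive_eq; rewrite /GRing.scale /=; ring. Qed.

Lemma H1_sqr : H1 (fun y : R => (y ^+ 2)%:C%C).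
Proof.
apply: (@H1_real _ (fun y => 2 * y)); first exact: is_derive_sqr.
by move=> y; apply: cvgMr; exact: cvg_id.
Qed.

Lemma domL_inY U : domL U -> inY U.
Proof. by move=> [[h1 _] h2 _ _]; split => //; exact: H1_L2. Qed.

Lemma domL_lin a U V : domL U -> domL V -> domL (a *: U + V).
Proof.
move=> [u1 u2 u3 u4] [v1 v2 v3 v4].
have E y : 0 < y < 1 -> cderiv (s_phi (a *: U + V)) y =
    a * cderiv (s_phi U) y + cderiv (s_phi V) y.
  move=> y01.
  exact: (is_cderiveE (is_cderive_lin a (H2_is_cderive u1 y01) (H2_is_cderive v1 y01))).
have h := H1_lin a u1.2 v1.2.
split.
- exact: (H2_lin a u1 v1).
- exact: (H1_lin a u2 v2).
- rewrite (eq_tr1 h E) (tr1_lin a u1.2 v1.2) s_z_lin.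
  have E2 (x1 x2 x3 x4 b : C) : a * x1 + x2 + (a * x3 + x4) / b = a * (x1 + x3 / b) + (x2 + x4 / b).
    by ring.
  exact: (etrans (E2 _ _ _ _ _) (etrans (congr2 (fun p q => a * p + q) u3 v3)
    (etrans (addr0 _) (mulr0 _)))).
- by rewrite (eq_tr0 h E) (tr0_lin a u1.2 v1.2) u4 v4 mulr0 addr0.
Qed.

Lemma cderiv0 (y : R) : cderiv (fun=> 0 : C) y = 0 :> C.
Proof. exact/is_cderiveE/is_cderive_cst. Qed.

Lemma domL0 : domL 0.
Proof.
have E (y : R) : 0 < y < 1 -> cderiv (s_phi (0 : state)) y = 0.
  by move=> _; exact: cderiv0.
split.
- exact: (H2_cst 0).
- exact: (H1_cst 0).
- rewrite (eq_tr1 (H1_cst 0) E) (@tr1E _ _ (fun=> 0)) //; last exact: ccontinuous_cst.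
  by rewrite mul0r addr0.
- by rewrite (eq_tr0 (H1_cst 0) E) (@tr0E _ _ (fun=> 0)) //; exact: ccontinuous_cst.
Qed.

Lemma Lop_inY lam U : domL U -> inY (Lop lam U).
Proof.
move=> [u1 u2 u3 u4]; split.
  have h := H1_lin (- (lam * s_z U / (2 * beta%:C%C))) H1_sqr u2.
  apply: eq_H1 h => y _; rewrite /s_phi /=; ring.
have h := L2_lin (- 1) (H1_cderiv_L2 u1.2) (H1_L2 (H1_cst (- (lam * s_eta U)))).
apply: eq_L2 h => y _; rewrite /s_u /=; ring.
Qed.

Lemma s_phiZ a U y : s_phi (a *: U) y = a * s_phi U y. Proof. by []. Qed.
Lemma s_uZ a U y : s_u (a *: U) y = a * s_u U y. Proof. by []. Qed.
Lemma s_etaZ a U : s_eta (a *: U) = a * s_eta U. Proof. by []. Qed.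
Lemma s_zZ a U : s_z (a *: U) = a * s_z U. Proof. by []. Qed.
Lemma s_phiB U V y : s_phi (U - V) y = s_phi U y - s_phi V y. Proof. by []. Qed.
Lemma s_uB U V y : s_u (U - V) y = s_u U y - s_u V y. Proof. by []. Qed.
Lemma s_etaB U V : s_eta (U - V) = s_eta U - s_eta V. Proof. by []. Qed.
Lemma s_zB U V : s_z (U - V) = s_z U - s_z V. Proof. by []. Qed.

Lemma s_phi_L lam U y : s_phi (Lop lam U) y =
  s_u U y - lam * (y ^+ 2)%:C%C * s_z U / (2 * beta%:C%C).
Proof. by []. Qed.
Lemma s_u_L lam U y : s_u (Lop lam U) y = - cderiv (cderiv (s_phi U)) y - lam * s_eta U.
Proof. by []. Qed.
Lemma s_eta_L lam U : s_eta (Lop lam U) = s_z U / beta%:C%C.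
Proof. by []. Qed.
Lemma s_z_L lam U : s_z (Lop lam U) =
  lam ^+ 2 * s_eta U / (2 * (mu0 beta kappa)%:C%C) + lam * tr1 (s_phi U) / (mu0 beta kappa)%:C%C
  + s_eta U - tr1 (s_u U) / (mu0 beta kappa)%:C%C.
Proof. by []. Qed.

Lemma Lop_lin lam a U V : domL U -> domL V ->
  eqY (Lop lam (a *: U + V)) (a *: Lop lam U + Lop lam V).
Proof.
move=> [u1 u2 u3 u4] [v1 v2 v3 v4].
have E y : 0 < y < 1 -> cderiv (s_phi (a *: U + V)) y =
    a * cderiv (s_phi U) y + cderiv (s_phi V) y.
  move=> y01.
  exact: (is_cderiveE (is_cderive_lin a (H2_is_cderive u1 y01) (H2_is_cderive v1 y01))).
split.
- by move=> y _; rewrite s_phi_lin !s_phi_L s_u_lin s_z_lin; ring.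
- have [fu [_ hu]] := H1_ae_cderive u1.2; have [fv [_ hv]] := H1_ae_cderive v1.2.
  apply: ae_imply2 hu hv => y hu hv y01; have y01' : I01 y by rewrite /= in_itv.
  rewrite s_u_lin !s_u_L s_eta_lin.
  rewrite (eq01_cderiv E y01) (is_cderiveE (is_cderive_lin a (hu y01') (hv y01'))).
  by rewrite (is_cderiveE (hu y01')) (is_cderiveE (hv y01')); ring.
- by rewrite s_eta_lin !s_eta_L s_z_lin; ring.
- rewrite s_z_lin !s_z_L s_eta_lin s_phi_lin s_u_lin.
  by rewrite (tr1_lin a u1.1 v1.1) (tr1_lin a u2 v2); ring.
Qed.

Lemma LopZ lam a U : domL U -> eqY (Lop lam (a *: U)) (a *: Lop lam U).
Proof.
move=> dU; have := Lop_lin lam (a - 1) dU dU.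
have E (M : state) : (a - 1) *: M + M = a *: M by rewrite scalerBl scale1r subrK.
by rewrite !E.
Qed.

Lemma domLZ a U : domL U -> domL (a *: U).
Proof. by move=> dU; have := domL_lin a dU domL0; rewrite addr0. Qed.

Lemma domLD U V : domL U -> domL V -> domL (U + V).
Proof. by move=> dU dV; have := domL_lin 1 dU dV; rewrite scale1r. Qed.

Lemma H1_ae_eq f g : H1 f -> H1 g -> {ae mu, forall y, 0 < y < 1 -> f y = g y} ->
  forall y, 0 < y < 1 -> f y = g y.
Proof.
move=> /H1_ccontinuous[F [[Fr Fi] eF]] /H1_ccontinuous[G [[Gr Gi] eG]] fg y y01.
rewrite eF // eG //; apply: complexP; apply/eqP; rewrite -subr_eq0; apply/eqP.
  apply: (@continuous_ae0 _ (fun y => Re (F y) - Re (G y)) _ _ _ y01).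
    by move=> t; apply: cvgB; [exact: Fr|exact: Gr].
  by apply: ae_imply fg => t h t01; rewrite -eF // -eG // h // subrr.
apply: (@continuous_ae0 _ (fun y => Im (F y) - Im (G y)) _ _ _ y01).
  by move=> t; apply: cvgB; [exact: Fi|exact: Gi].
by apply: ae_imply fg => t h t01; rewrite -eF // -eG // h // subrr.
Qed.

Lemma Lop_eqY lam U V : domL U -> domL V -> eqY U V -> eqY (Lop lam U) (Lop lam V).
Proof.
move=> [u1 u2 u3 u4] [v1 v2 v3 v4] [e1 e2 e3 e4].
have e2' := H1_ae_eq u2 v2 e2.
have ed (y : R) : 0 < y < 1 -> cderiv (s_phi U) y = cderiv (s_phi V) y.
  by move=> y01; exact: (eq01_cderiv e1 y01).
split.
- by move=> y y01; rewrite /Lop /s_phi /= e2' // e4.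
- by apply: aeW => y y01; rewrite /Lop /s_u /= e3 (eq01_cderiv ed y01).
- by rewrite /Lop /s_eta /= e4.
- by rewrite /Lop /s_z /= e3 (eq_tr1 v1.1 e1) (eq_tr1 v2 e2').
Qed.

(* Pointwise equality on ]0, 1[, which unlike eqY preserves domL. *)
Definition eqp U V : Prop :=
  [/\ forall y, 0 < y < 1 -> s_phi U y = s_phi V y,
      forall y, 0 < y < 1 -> s_u U y = s_u V y,
      s_eta U = s_eta V & s_z U = s_z V].

Lemma eqp_eqY U V : eqp U V -> eqY U V.
Proof. by move=> [h1 h2 h3 h4]; split => //; exact: aeW. Qed.

Lemma eqp_domL U V : eqp U V -> domL U -> domL V.
Proof.
move=> [h1 h2 h3 h4] [u1 u2 u3 u4].
have E y : 0 < y < 1 -> cderiv (s_phi V) y = cderiv (s_phi U) y.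
  by move=> y01; apply: eq01_cderiv => // t /h1.
split.
- split; first exact: (eq_H1 h1 u1.1).
  by apply: eq_H1 u1.2 => y /E.
- exact: (eq_H1 h2 u2).
- by rewrite (eq_tr1 u1.2 E) -h4.
- by rewrite (eq_tr0 u1.2 E).
Qed.

(** Each stage of [gker] above 0 requires membership in [domL], which depends on the representative
    of the second component. Hence pointwise equality is propagated down to the last stage, where
    [eqY] suffices. *)
Lemma gker_scale lam nu a m U V : (if m is 0%N then eqY V (a *: U) else eqp V (a *: U)) ->
  gker lam nu m U -> gker lam nu m V.
Proof.
elim: m U V => [|m IH] U V /=.
  by move=> h k; apply: (eqY_trans h); have := eqYZ a k; rewrite scaler0.
move=> e [dU gU]; have daU := domLZ a dU.
have e' : eqp (a *: U) V by case: e => h1 h2 h3 h4; split => // y y01; rewrite ?h1 ?h2.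
have dV := eqp_domL e' daU; split => //.
apply: (IH (Lop lam U - nu *: U)); last by [].
case: m gU {IH} => [|m] /= gU.
  rewrite scalerBr; apply: eqYB; last first.
    by rewrite scalerA mulrC -scalerA; apply: eqYZ; exact: eqp_eqY.
  exact: (eqY_trans (Lop_eqY lam dV daU (eqp_eqY e)) (LopZ lam a dU)).
(* The next iterate lies in the domain too, which makes the second derivative of [s_phi U] an H^1
   function; that of [s_phi V] can then be computed at every point, as [eqp] requires. *)
have [e1 e2 e3 e4] := e; have [dL _] := gU; have [[u1 u2] u3 _ _] := dU.
have [_ h _ _] := dL.
have u4 : H1 (cderiv (cderiv (s_phi U))).
  have h' := H1_lin (- 1) (H1_lin nu u3 h) (H1_cst (- (lam * s_eta U))).
  by apply: eq_H1 h' => y _; rewrite s_uB s_uZ s_u_L; ring.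
have d2 (y : R) : 0 < y < 1 -> cderiv (cderiv (s_phi V)) y = a * cderiv (cderiv (s_phi U)) y.
  move=> y01; have hU : H2 (cderiv (s_phi U)) by split.
  have k := is_cderive_lin a (H2_is_cderive hU y01) (is_cderive_cst 0 y).
  rewrite -[RHS]addr0 -(is_cderiveE k); apply: eq01_cderiv => // t t01.
  have k' := is_cderive_lin a (H2_is_cderive (conj u1 u2) t01) (is_cderive_cst 0 t).
  rewrite -(is_cderiveE k'); apply: eq01_cderiv => // x x01.
  by rewrite addr0 e1.
have t1 : tr1 (s_phi V) = a * tr1 (s_phi U).
  have dU0 := tr1_lin a u1 (H1_cst 0); rewrite (@tr1E _ (fun=> 0) (fun=> 0)) // ?addr0 in dU0; last exact: ccontinuous_cst.
  rewrite -dU0; apply: eq_tr1; first exact: (H1_lin a u1 (H1_cst 0)).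
  by move=> y y01; rewrite addr0 e1.
have t2 : tr1 (s_u V) = a * tr1 (s_u U).
  have dU0 := tr1_lin a u3 (H1_cst 0); rewrite (@tr1E _ (fun=> 0) (fun=> 0)) // ?addr0 in dU0; last exact: ccontinuous_cst.
  rewrite -dU0; apply: eq_tr1; first exact: (H1_lin a u3 (H1_cst 0)).
  by move=> y y01; rewrite addr0 e2.
split.
- move=> y y01; rewrite s_phiZ !s_phiB !s_phi_L !s_phiZ e1 // e2 // e4.
  by rewrite s_phiZ s_uZ s_zZ; ring.
- move=> y y01; rewrite s_uZ !s_uB !s_u_L !s_uZ e2 // e3 d2 //.
  by rewrite s_uZ s_etaZ; ring.
- by rewrite s_etaZ !s_etaB !s_eta_L !s_etaZ e3 e4 s_etaZ s_zZ; ring.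
- rewrite s_zZ !s_zB !s_z_L !s_zZ e3 e4 s_etaZ s_zZ t1 t2.
  move: (tr1 (s_phi U)) (tr1 (s_u U)) => x1 x2; ring.
Qed.

Lemma gen_eigenspace_scale lam nu a U : gen_eigenspace beta kappa lam nu U ->
  gen_eigenspace beta kappa lam nu (a *: U).
Proof. by move=> [m h]; exists m; apply: gker_scale h; split. Qed.

Lemma gen_eigenspace_domL lam nu U : gen_eigenspace beta kappa lam nu U -> domL U.
Proof. by move=> [m [h _]]. Qed.

Lemma domL_sum n (F : 'I_n -> state) : (forall i, domL (F i)) -> domL (\sum_(i < n) F i).
Proof.
elim: n F => [|n IH] F h; first by rewrite big_ord0; exact: domL0.
by rewrite big_ord_recr; apply: domLD; [exact: IH|exact: h].
Qed.

Lemma Ysigma_domL sigma U : Ysigma beta kappa sigma U -> domL U.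
Proof.
move=> [n [g [h ->]]]; apply: domL_sum => i; have [k hk] := h i.
exact: gen_eigenspace_domL hk.
Qed.

(** Members of [Ysigma] are plain sums of generalized eigenvectors, so the scalar has to be moved
    into each summand. *)
Lemma Ysigma_lin sigma a U V : Ysigma beta kappa sigma U -> Ysigma beta kappa sigma V ->
  Ysigma beta kappa sigma (a *: U + V).
Proof.
move=> [n [g [hg ->]]] [m [f [hf ->]]].
exists (n + m)%N, (fun i => match fintype.split i with inl j => a *: g j | inr j => f j end); split.
  move=> i; case: (fintype.split i) => j; last exact: hf.
  by have [k hk] := hg j; exists k; exact: gen_eigenspace_scale.
rewrite big_split_ord /= scaler_sumr; congr (_ + _); apply: eq_bigr => i _.
  by rewrite -[lshift _ _]/(unsplit (inl i)) unsplitK.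
by rewrite -[rshift _ _]/(unsplit (inr i)) unsplitK.
Qed.

Lemma Ysigma0 sigma : Ysigma beta kappa sigma 0.
Proof. by exists 0%N, (fun=> 0); split; [case|rewrite big_ord0]. Qed.

End LinearOperator.

(** * The trivial wave *)

Section TrivialWave.
Context {R : realType}.
Variables (beta kappa : R).
Local Notation C := R[i].
Local Notation state := (@state R).
Local Notation domL := (@domL R beta).
Local Notation Lop := (@Lop R beta kappa).
Implicit Types (a lam nu : C) (U V W : state) (x y : R).

Lemma is_derive_half_sqr y : is_derive y 1 (fun t : R => t ^+ 2 / 2) y.
Proof.
apply: (is_derive_eq (is_deriveM (is_derive_sqr y) (is_derive_cst (2^-1 : R) y 1))).
by rewrite /GRing.scale /=; field.
Qed.

Lemma H1_half_sqr : H1 (fun y : R => (y ^+ 2 / 2)%:C%C).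
Proof.
by apply: (@H1_real _ _ (fun y => y)) => y; [exact: is_derive_half_sqr|exact: cvg_id].
Qed.

Variable w : @wave R.
Hypothesis eta0 : forall x, etab w x = 0.
Hypothesis phi0 : forall x y, 0 <= y <= 1 ->
  [/\ dx (phib w) x y = 0, dy (phib w) x y = 0 & dy (dy (phib w)) x y = 0].
Hypothesis mu0_neq0 : mu0 beta kappa != 0.
Hypothesis mu_w : mub w = mu0 beta kappa.

Lemma etab_x0 x : etab_x w x = 0.
Proof.
rewrite /etab_x (_ : etab w = cst 0); last by apply/funext => t; rewrite eta0.
by rewrite derive1_cst.
Qed.

Lemma sb1 x : sb w x = 1.
Proof. by rewrite /sb etab_x0 expr0n addr0 powR1. Qed.

Lemma ub0 x y : 0 <= y <= 1 -> ub w x y = 0.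
Proof.
by move=> y01; have [h1 h2 _] := phi0 x y01; rewrite /ub h1 h2 mulr0 mul0r subr0.
Qed.

Lemma dy_ub0 x y : 0 < y < 1 -> dy (ub w) x y = 0.
Proof.
move=> y01; rewrite /dy (eq01_derive1 (g := cst 0) _ y01) ?derive1_cst //.
by move=> z /andP[z0 z1]; rewrite ub0 // !ltW.
Qed.

Let one01 : 0 <= (1 : R) <= 1. Proof. by rewrite ler01 lexx. Qed.

Lemma chg1E : chg1 w = fun=> 1.
Proof. by apply/funext => x; rewrite /chg1 ub0 // eta0 sb1 subr0 addr0 !mulr1. Qed.

Lemma chg2E : chg2 w = fun=> 0.
Proof. by apply/funext => x; rewrite /chg2 etab_x0 mul0r. Qed.

Lemma chg3E lam : chg3 w lam = fun=> lam.
Proof.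
apply/funext => x; have [_ h _] := phi0 x one01.
by rewrite /chg3 h eta0 mul0r !addr0 mulr1.
Qed.

Lemma phi_ofE lam x U : phi_of w lam x U =
  fun y => lam * s_eta U * (y ^+ 2 / 2)%:C%C + s_phi U y.
Proof.
apply/funext => y; rewrite /phi_of chg1E chg2E chg3E mul0r addr0 mul1r addrC.
by rewrite mulrAC.
Qed.

Lemma phi_xE lam x U y : 0 < y < 1 -> phi_x beta w lam x U y = s_u U y.
Proof.
move=> /andP[y0 y1]; have [_ h _] := phi0 x (introT andP (conj (ltW y0) (ltW y1))).
by rewrite /phi_x etab_x0 h !(mulr0, mul0r, oppr0, subr0, addr0, add0r).
Qed.

Lemma u_xE lam x U y : 0 < y < 1 ->
  u_x beta w lam x U y = - cderiv (cderiv (phi_of w lam x U)) y.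
Proof.
move=> y01; have /andP[y0 y1] := y01.
have [_ _ h] := phi0 x (introT andP (conj (ltW y0) (ltW y1))).
rewrite /u_x etab_x0 h dy_ub0 // eta0 !(mulr0, mul0r, oppr0, subr0, addr0, add0r).
by rewrite expr1n invr1 mul1r.
Qed.

Lemma eta_xE x U : eta_x beta w x U = s_z U / beta%:C%C.
Proof. by rewrite /eta_x sb1 mulrC mul1r -fmorphV. Qed.

Lemma z_xE lam x U : H1 (s_phi U) -> z_x beta w lam x U = s_z (Lop lam U).
Proof.
move=> h; rewrite /z_x ub0 // etab_x0 eta0 mu_w phi_ofE.
have [_ -> _] := phi0 x one01.
have t : tr1 (fun y : R => lam * s_eta U * (y ^+ 2 / 2)%:C%C + s_phi U y)
    = lam * s_eta U / 2 + tr1 (s_phi U).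
  rewrite (tr1_lin _ H1_half_sqr h).
  congr (_ + _); rewrite (@tr1E _ _ (fun y : R => (y ^+ 2 / 2)%:C%C)) //.
    by rewrite expr1n mul1r fmorphV rmorph_nat.
  apply: ccontinuous_real => y; apply: cvgM; last exact: cvg_cst.
  exact: exprn_continuous.
rewrite t s_z_L !(mulr0, mul0r, addr0, subr0).
have : (mu0 beta kappa)%:C%C != 0 :> C by rewrite fmorph_eq0.
move: (tr1 (s_phi U)) (tr1 (s_u U)) => p q; set m := (mu0 beta kappa)%:C%C => m0.
by field.
Qed.

Lemma varphi_xE lam x U y : 0 < y < 1 -> varphi_x beta w lam x U y = s_phi (Lop lam U) y.
Proof.
move=> y01; rewrite /varphi_x chg1E chg2E chg3E phi_xE // eta_xE s_phi_L.
have dc (c : C) (t : R) : cderiv (fun=> c) t = 0 := is_cderiveE (is_cderive_cst c t).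
rewrite !dc !(mulr0, mul0r, addr0, subr0) invr1 mul1r; congr (_ - _).
rewrite rmorphM /= fmorphV rmorph_nat invfM; ring.
Qed.

Lemma LBop_inY lam x U : domL U -> inY (LBop beta w lam x U).
Proof.
move=> dU; have [u1 u2 _ _] := dU; have [L1 L2'] := Lop_inY kappa lam dU; split.
  by apply: eq_H1 L1 => y y01; rewrite -(varphi_xE lam x).
pose F y := phi_of w lam x U y.
have hF : H2 F.
  rewrite /F phi_ofE; apply: H2_lin => //; split.
    exact: H1_half_sqr.
  apply: (@eq_H1 _ (fun y => y%:C%C)); last first.
    by apply: (@H1_real _ _ (fun=> 1)) => y; exact: cvg_cst.
  move=> y _; apply/esym/is_cderiveE; apply: is_cderive_real; exact: is_derive_half_sqr.
have h := L2_lin (- 1) (H1_cderiv_L2 hF.2) (H1_L2 (H1_cst 0)).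
by apply: eq_L2 h => y y01; rewrite /LBop /s_u /= u_xE // addr0 mulN1r.
Qed.

(** The perturbation vanishes at the trivial wave. The second components agree almost everywhere
    only, because the second derivative of [phi_of] splits only where that of [s_phi U] exists. *)
Lemma LBop_eqY lam x U : domL U -> eqY (LBop beta w lam x U) (Lop lam U).
Proof.
move=> dU; have [u1 u2 _ _] := dU; split.
- by move=> y y01; rewrite -(varphi_xE lam x).
- have [g [_ hg]] := H1_ae_cderive u1.2.
  apply: ae_imply hg => y hy y01; have h := hy _.
  rewrite s_u_L /LBop /s_u /= u_xE // phi_ofE.
  have e1 t : 0 < t < 1 -> cderiv (fun y => lam * s_eta U * (y ^+ 2 / 2)%:C%C + s_phi U y) t
     = lam * s_eta U * t%:C%C + cderiv (s_phi U) t.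
    move=> t01; apply/is_cderiveE/is_cderive_lin; last exact: H2_is_cderive.
    by apply: is_cderive_real; exact: is_derive_half_sqr.
  have h' : is_cderive (cderiv (s_phi U)) y (g y) by apply: hy; rewrite /= in_itv.
  rewrite (eq01_cderiv e1 y01) (is_cderiveE h').
  have d := is_cderive_lin (lam * s_eta U) (is_cderive_real (is_derive_id y 1)) h'.
  by rewrite (is_cderiveE d) mulr1 opprD addrC.
- exact: eta_xE.
- exact: (z_xE lam x u1.1).
Qed.

(* L(i sigma + delta) - L(i sigma), without second derivatives. *)
Definition Lincr lam lam' U : state :=
  (fun y => - (lam' - lam) * (y ^+ 2)%:C%C * s_z U / (2 * beta%:C%C),
   fun=> - (lam' - lam) * s_eta U,
   0,
   (lam' ^+ 2 - lam ^+ 2) * s_eta U / (2 * (mu0 beta kappa)%:C%C)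
   + (lam' - lam) * tr1 (s_phi U) / (mu0 beta kappa)%:C%C).

Lemma s_phi_Lincr lam lam' U y : s_phi (Lincr lam lam' U) y =
  - (lam' - lam) * (y ^+ 2)%:C%C * s_z U / (2 * beta%:C%C).
Proof. by []. Qed.
Lemma s_u_Lincr lam lam' U y : s_u (Lincr lam lam' U) y = - (lam' - lam) * s_eta U.
Proof. by []. Qed.
Lemma s_eta_Lincr lam lam' U : s_eta (Lincr lam lam' U) = 0.
Proof. by []. Qed.
Lemma s_z_Lincr lam lam' U : s_z (Lincr lam lam' U) =
  (lam' ^+ 2 - lam ^+ 2) * s_eta U / (2 * (mu0 beta kappa)%:C%C)
   + (lam' - lam) * tr1 (s_phi U) / (mu0 beta kappa)%:C%C.
Proof. by []. Qed.

Lemma Lincr_lin lam lam' a U V : H1 (s_phi U) -> H1 (s_phi V) ->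
  eqY (Lincr lam lam' (a *: U + V)) (a *: Lincr lam lam' U + Lincr lam lam' V).
Proof.
move=> u1 v1; split.
- by move=> y _; rewrite s_phi_lin !s_phi_Lincr s_z_lin; ring.
- by apply: aeW => y _; rewrite s_u_lin !s_u_Lincr s_eta_lin; ring.
- by rewrite s_eta_lin !s_eta_Lincr mulr0 addr0.
- rewrite s_z_lin !s_z_Lincr s_eta_lin s_phi_lin (tr1_lin a u1 v1).
  by move: (tr1 (s_phi U)) (tr1 (s_phi V)) => p q; ring.
Qed.

Lemma Bdelta_inY sigma delta x U : domL U -> inY (Bdelta beta kappa sigma w delta x U).
Proof.
move=> dU; rewrite /Bdelta /Bop; apply: inYD; first by apply: inYB; exact: Lop_inY.
by apply: inYB; [exact: LBop_inY|exact: Lop_inY].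
Qed.

Lemma Bdelta_eqY sigma delta x U : domL U ->
  eqY (Bdelta beta kappa sigma w delta x U) (Lincr (imag sigma) (imag sigma + delta) U).
Proof.
move=> dU; have h := LBop_eqY (imag sigma + delta) x dU.
have h' := eqYD (eqY_refl (Lop (imag sigma + delta) U - Lop (imag sigma) U))
  (eqYB h (eqY_refl (Lop (imag sigma + delta) U))).
apply: (eqY_trans h'); rewrite subrr addr0; split.
- by move=> y _; rewrite s_phiB !s_phi_L s_phi_Lincr; ring.
- by apply: aeW => y _; rewrite s_uB !s_u_L s_u_Lincr; ring.
- by rewrite s_etaB !s_eta_L subrr.
- rewrite s_zB !s_z_L s_z_Lincr.
  by move: (tr1 (s_phi U)) (tr1 (s_u U)) => p q; ring.
Qed.

End TrivialWave.

(** * Explicit eigenvectors *)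

Section Eigenvectors.
Context {R : realType}.
Variables (beta kappa : R).
Local Notation C := R[i].
Local Notation state := (@state R).
Local Notation domL := (@domL R beta).
Local Notation Lop := (@Lop R beta kappa).
Implicit Types (s k y : R).

Lemma wave_family_trivial r (w : R -> @wave R) : 0 < r -> is_wave_family beta kappa r w ->
  [/\ forall x, etab (w 0) x = 0,
      forall x y, 0 <= y <= 1 -> [/\ dx (phib (w 0)) x y = 0,
        dy (phib (w 0)) x y = 0 & dy (dy (phib (w 0))) x y = 0]
    & mub (w 0) = mu0 beta kappa].
Proof.
move=> r0 [_ [K HK] _]; have [|h1 h2 h3 _] := HK 0; first by rewrite normr0.
move: h1 h2 h3; rewrite expr0n mulr0 => h1 h2 h3.
have z (t : R) : `|t| <= 0 -> t = 0 by rewrite normr_le0 => /eqP.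
split.
- move=> x; have [[+ _ _] _] := h2 x 0 (introT andP (conj (lexx _) ler01)).
  by rewrite mul0r subr0 => /z.
- move=> x y y01; have := h1 x y y01.
  rewrite (_ : (fun x y => _) = phib (w 0)); last first.
    by apply/funext => x'; apply/funext => y'; rewrite mul0r subr0.
  by move=> [[_ /z d1 /z d2] [_ _ /z d3]].
- by apply/eqP; rewrite -subr_eq0; apply/eqP/z.
Qed.

Lemma is_derive_expRM (k y : R) : is_derive y 1 (fun t => expR (k * t)) (k * expR (k * y)).
Proof.
have h : is_derive y 1 (fun t : R => k * t) k.
  by apply: (is_derive_eq (is_deriveZ k (is_derive_id y 1))); rewrite /GRing.scale /= mulr1.
apply: (is_derive_eq (@is_derive1_comp R expR (fun t => k * t) y _ _ (is_derive_expR _) h)).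
by rewrite mulrC.
Qed.

Lemma is_derive_coshM k y : is_derive y 1 (fun t => cosh (k * t)) (k * sinh (k * y)).
Proof.
have h1 := is_derive_expRM k y; have h2 := is_derive_expRM (- k) y.
rewrite (_ : (fun t => cosh (k * t)) = fun t => 2^-1 * (expR (k * t) + expR (- k * t))).
  apply: (is_derive_eq (is_deriveZ (2^-1) (is_deriveD h1 h2))).
  by rewrite /sinh /GRing.scale /= !mulNr; field.
by apply/funext => t; rewrite /cosh mulNr mulrC.
Qed.

Lemma is_derive_sinhM k y : is_derive y 1 (fun t => sinh (k * t)) (k * cosh (k * y)).
Proof.
have h1 := is_derive_expRM k y; have h2 := is_derive_expRM (- k) y.
rewrite (_ : (fun t => sinh (k * t)) = fun t => 2^-1 * (expR (k * t) - expR (- k * t))).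
  apply: (is_derive_eq (is_deriveZ (2^-1) (is_deriveB h1 h2))).
  by rewrite /cosh /GRing.scale /= !mulNr; field.
by apply/funext => t; rewrite /sinh mulNr mulrC.
Qed.

Lemma cosh_gt0 k : 0 < cosh k.
Proof. by rewrite divr_gt0 // expRDN_gt0. Qed.

Lemma sinh0 : sinh 0 = 0 :> R. Proof. by rewrite /sinh oppr0 subrr mul0r. Qed.
Lemma tanhE k : tanh k = sinh k / cosh k.
Proof.
rewrite /tanh /sinh /cosh; have := lt0r_neq0 (expRDN_gt0 k).
by move=> h; field.
Qed.

Lemma sinh_eq0 k : sinh k = 0 -> k = 0.
Proof.
move=> h; apply/eqP; apply/negPn/negP => k0.
wlog kp : k h k0 / 0 < k.
  move=> H; have [kp|kn|/eqP] := ltgtP 0 k; [exact: (H k)| |by rewrite eq_sym (negbTE k0)].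
  apply: (H (- k)); rewrite ?oppr_eq0 ?oppr_gt0 //.
  by rewrite /sinh opprK -[LHS]opprK -[X in - X]mulNr opprB -/(sinh k) h oppr0.
by have := tanh_gt0 kp; rewrite tanhE h mul0r ltxx.
Qed.

Lemma continuous_coshM k : continuous (fun y => cosh (k * y)).
Proof.
move=> y; apply: differentiable_continuous; apply/derivable1_diffP.
by have [] := is_derive_coshM k y.
Qed.

Lemma continuous_sinhM k : continuous (fun y => sinh (k * y)).
Proof.
move=> y; apply: differentiable_continuous; apply/derivable1_diffP.
by have [] := is_derive_sinhM k y.
Qed.

(** The quadratic term is produced by the change of variables: for [eta = k sinh k] and
    [lambda = i s], the substitution turns [imag (evec_p s k y)] back into the potential
    [i (s - k) cosh (k y)]. *)
Definition evec_p s k y : R := - s * (k * sinh k) * (y ^+ 2 / 2) + (s - k) * cosh (k * y).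
Definition evec_p' s k y : R := - s * (k * sinh k) * y + (s - k) * (k * sinh (k * y)).
Definition evec_p'' s k y : R := - s * (k * sinh k) + (s - k) * (k * (k * cosh (k * y))).

(* For (s - k)^2 = disprel k, an eigenvector of L(i s) for the eigenvalue i k. *)
Definition evec s k : state :=
  (fun y => imag (evec_p s k y), fun y => (- k * (s - k) * cosh (k * y))%:C%C,
   (k * sinh k)%:C%C, imag (beta * k * (k * sinh k))).

Lemma is_derive_evec_p s k y : is_derive y 1 (evec_p s k) (evec_p' s k y).
Proof.
have h := is_deriveD (is_deriveZ (- s * (k * sinh k)) (is_derive_half_sqr y))
  (is_deriveZ (s - k) (is_derive_coshM k y)).
exact: (is_derive_eq h).
Qed.

Lemma is_derive_evec_p' s k y : is_derive y 1 (evec_p' s k) (evec_p'' s k y).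
Proof.
have h := is_deriveD (is_deriveZ (- s * (k * sinh k)) (is_derive_id y 1))
  (is_deriveZ (s - k) (is_deriveZ k (is_derive_sinhM k y))).
by apply: (is_derive_eq h); rewrite /GRing.scale /= mulr1.
Qed.

Lemma is_cderive_imag (f : R -> R) y d : is_derive y 1 f d ->
  is_cderive (fun t => imag (f t)) y (imag d).
Proof. by move=> h; split => //=; exact: is_derive_cst. Qed.

Lemma ccontinuous_imag (f : R -> R) : continuous f -> ccontinuous (fun t => imag (f t)).
Proof. by move=> h; split => // y; exact: cvg_cst. Qed.

Lemma continuous_is_derive (f df : R -> R) : (forall y, is_derive y 1 f (df y)) -> continuous f.
Proof.
move=> h y; apply: differentiable_continuous; apply/derivable1_diffP.
by have [] := h y.
Qed.

Lemma cderiv_evec s k y : cderiv (s_phi (evec s k)) y = imag (evec_p' s k y).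
Proof. by apply: is_cderiveE; apply: is_cderive_imag; exact: is_derive_evec_p. Qed.

Lemma cderiv2_evec s k y : cderiv (cderiv (s_phi (evec s k))) y = imag (evec_p'' s k y).
Proof.
rewrite (_ : cderiv (s_phi _) = fun y => imag (evec_p' s k y)); last first.
  by apply/funext => t; exact: cderiv_evec.
by apply: is_cderiveE; apply: is_cderive_imag; exact: is_derive_evec_p'.
Qed.

Lemma imagD (x y : R) : imag (x + y) = imag x + imag y.
Proof. by apply: complexP; rewrite complexE /= ?addr0. Qed.

Lemma imag_div (x b : R) : imag x / b%:C%C = imag (x / b).
Proof. by rewrite -fmorphV; apply: complexP; rewrite complexE /=; ring. Qed.

Lemma evec_domL s k : beta != 0 -> domL (evec s k).
Proof.
move=> b0; have cp' := continuous_is_derive (is_derive_evec_p' s k).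
have cp'' : continuous (evec_p'' s k).
  move=> y; apply: cvgD; first exact: cvg_cst.
  by do 3 apply: cvgMr; exact: continuous_coshM.
have e y : 0 < y < 1 -> cderiv (s_phi (evec s k)) y = imag (evec_p' s k y).
  by move=> _; exact: cderiv_evec.
split.
- split.
    apply: (@C1_H1 _ _ (fun y => imag (evec_p' s k y))); last exact: ccontinuous_imag.
    by move=> y; apply: is_cderive_imag; exact: is_derive_evec_p.
  apply: (@eq_H1 _ (fun y => imag (evec_p' s k y))); first by move=> y /e.
  apply: (@C1_H1 _ _ (fun y => imag (evec_p'' s k y))); last exact: ccontinuous_imag.
  by move=> y; apply: is_cderive_imag; exact: is_derive_evec_p'.
- apply: (@H1_real _ _ (fun y => - k * (s - k) * (k * sinh (k * y)))).
    by move=> y; have h := is_deriveZ (- k * (s - k)) (is_derive_coshM k y).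
  by move=> y; do 2 apply: cvgMr; exact: continuous_sinhM.
- rewrite (tr1E (ccontinuous_imag cp') e) /s_z /= imag_div -imagD /evec_p' !mulr1.
  by apply: complexP => //=; field.
- rewrite (tr0E (ccontinuous_imag cp') e) /evec_p' !mulr0 sinh0 !mulr0 addr0.
  by apply: complexP.
Qed.

(** The first three components are identities in [s] and [k]; only the fourth, which encodes the
    dynamic boundary condition, uses the dispersion relation. *)
Lemma evec_eigen s k : beta != 0 -> mu0 beta kappa != 0 ->
  (s - k) ^+ 2 = disprel beta (mu0 beta kappa) k ->
  eqp (Lop (imag s) (evec s k)) (imag k *: evec s k).
Proof.
move=> b0 m0; rewrite /disprel tanhE; set m := mu0 beta kappa => disp.
have c0 := lt0r_neq0 (cosh_gt0 k).
have disp' : (s - k) ^+ 2 * cosh k = m * k * sinh k * (1 + beta * k ^+ 2) by rewrite disp; field.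
have tr1u : tr1 (s_u (evec s k)) = (- k * (s - k) * cosh k)%:C%C.
  rewrite (@tr1E _ _ (fun y => (- k * (s - k) * cosh (k * y))%:C%C)) ?mulr1 //.
  apply: ccontinuous_real => y; apply: cvgMr; exact: continuous_coshM.
have tr1p : tr1 (s_phi (evec s k)) = imag (evec_p s k 1).
  rewrite (@tr1E _ _ (fun y => imag (evec_p s k y))) //.
  exact: (ccontinuous_imag (continuous_is_derive (is_derive_evec_p s k))).
have b2 : (2 * beta%:C%C : C) = (2 * beta)%:C%C by rewrite rmorphM rmorph_nat.
split.
- move=> y _; rewrite s_phiZ s_phi_L b2 -fmorphV /s_u /s_phi /s_z /=.
  by apply: complexP; rewrite !complexE /= /evec_p; field.
- move=> y _; rewrite s_uZ s_u_L cderiv2_evec /s_u /s_eta /=.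
  by apply: complexP; rewrite !complexE /= /evec_p''; field.
- rewrite s_etaZ s_eta_L -fmorphV /s_z /s_eta /=.
  by apply: complexP; rewrite !complexE /=; field.
- rewrite s_zZ s_z_L tr1u tr1p -/m.
  have -> : (2 * m%:C%C : C) = (2 * m)%:C%C by apply: complexP; rewrite !complexE /=; ring.
  rewrite -!fmorphV /s_z /s_eta /=.
  apply: complexP; rewrite !complexE /= /evec_p ?expr1n ?mulr1; last by field.
  apply/eqP; rewrite -subr_eq0; apply/eqP.
  transitivity ((m * k * sinh k * (1 + beta * k ^+ 2) - (s - k) ^+ 2 * cosh k) / m).
    by rewrite /evec_p; field.
  by rewrite disp' subrr mul0r.
Qed.


End Eigenvectors.
Section EigenvectorsFree.
Context {R : realType}.
Variables (beta kappa : R).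
Hypotheses (beta_gt0 : 0 < beta) (mu0_gt0 : 0 < mu0 beta kappa).
Local Notation C := R[i].
Local Notation state := (@state R).
Local Notation F := (disprel beta (mu0 beta kappa)).
Local Notation Re := (@complex.Re R).
Local Notation Im := (@complex.Im R).
Implicit Types (s y : R).

Lemma cosh_comb_step n (k d : 'I_n -> R) :
  (forall y, 0 < y < 1 -> \sum_(i < n) d i * cosh (k i * y) = 0) ->
  forall y, 0 < y < 1 -> \sum_(i < n) (d i * k i ^+ 2) * cosh (k i * y) = 0.
Proof.
move=> h.
have d1 y : is_derive y 1 (\sum_(i < n) (fun t => d i * cosh (k i * t)))
    (\sum_(i < n) (d i * (k i * sinh (k i * y)))).
  apply: is_derive_sum => i; have hc := is_derive_coshM (k i) y.
  exact: (is_deriveZ (d i) hc).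
have d2 y : is_derive y 1 (\sum_(i < n) (fun t => d i * (k i * sinh (k i * t))))
    (\sum_(i < n) (d i * (k i * (k i * cosh (k i * y))))).
  apply: is_derive_sum => i; have hs := is_derive_sinhM (k i) y.
  exact: (is_deriveZ (d i) (is_deriveZ (k i) hs)).
have z (f : R -> R) y (l : R) : (forall t, 0 < t < 1 -> f t = 0) -> 0 < y < 1 ->
    is_derive y 1 f l -> l = 0.
  move=> f0 y01 df.
  have [_ <-] : is_derive y 1 (cst 0 : R -> R) l by apply: (eq01_is_derive _ y01 df) => t /f0.
  by have [_ ->] := is_derive_cst (0 : R) y (1 : R).
have h1 y : 0 < y < 1 -> \sum_(i < n) (d i * (k i * sinh (k i * y))) = 0.
  by move=> y01; apply: (z _ _ _ _ y01 (d1 y)) => t /h; rewrite fct_sumE.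
move=> y y01; rewrite -[RHS](z _ _ _ _ y01 (d2 y)); last by move=> t /h1; rewrite fct_sumE.
by apply: eq_bigr => i _; ring.
Qed.

(** Differentiating twice multiplies the coefficient [d i] by [k i ^+ 2], so [d i] may be multiplied
    by [q (k i ^+ 2)] for any polynomial [q]. The polynomial vanishing at all the other squares
    isolates one term. *)
Lemma cosh_free n (k d : 'I_n -> R) : injective (fun i => k i ^+ 2) ->
  (forall y, 0 < y < 1 -> \sum_(i < n) d i * cosh (k i * y) = 0) ->
  forall i, d i = 0.
Proof.
move=> kinj h i.
have hX m : forall y, 0 < y < 1 -> \sum_(j < n) (d j * (k j ^+ 2) ^+ m) * cosh (k j * y) = 0.
  elim: m => [|m IH] y y01.
    by rewrite -[RHS](h y y01); apply: eq_bigr => j _; rewrite expr0 mulr1.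
  rewrite -[RHS](cosh_comb_step IH y01); apply: eq_bigr => j _.
  by rewrite exprSr mulrA.
have half : 0 < (1 / 2 : R) < 1 by apply/andP; split; lra.
have hq (q : {poly R}) : \sum_(j < n) d j * q.[k j ^+ 2] * cosh (k j * (1 / 2)) = 0.
  transitivity (\sum_(j < n) \sum_(m < size q) q`_m * ((d j * (k j ^+ 2) ^+ m) * cosh (k j * (1 / 2)))).
    apply: eq_bigr => j _; rewrite horner_coef mulr_sumr mulr_suml.
    by apply: eq_bigr => m _; ring.
  rewrite exchange_big /= big1 // => m _.
  by rewrite -mulr_sumr hX // mulr0.
have := hq (\prod_(j < n | j != i) ('X - (k j ^+ 2)%:P)).
rewrite (bigD1 i) //= [X in _ + X]big1 ?addr0; last first.
  move=> j ji; suff -> : (\prod_(j0 < n | j0 != i) ('X - (k j0 ^+ 2)%:P)).[k j ^+ 2] = 0.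
    by rewrite mulr0 mul0r.
  by apply/eqP; rewrite horner_prod (bigD1 j) //= hornerXsubC subrr mulf_eq0 eqxx.
move/eqP; rewrite mulf_eq0 [X in _ || X]gt_eqF ?cosh_gt0 // orbF mulf_eq0 => /orP[/eqP //|].
rewrite horner_prod => /prodf_eq0[j ji]; rewrite hornerXsubC subr_eq0 => /eqP /kinj e.
by rewrite e eqxx in ji.
Qed.

Lemma s_phi_sum n (G : 'I_n -> state) y : s_phi (\sum_(i < n) G i) y = \sum_(i < n) s_phi (G i) y.
Proof.
elim: n G => [|n IH] G; first by rewrite !big_ord0.
by rewrite !big_ord_recr /= -IH.
Qed.

Lemma s_eta_sum n (G : 'I_n -> state) : s_eta (\sum_(i < n) G i) = \sum_(i < n) s_eta (G i).
Proof.
elim: n G => [|n IH] G; first by rewrite !big_ord0.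
by rewrite !big_ord_recr /= -IH.
Qed.

Lemma dispersion_neq s k : s != 0 -> (s - k) ^+ 2 = F k -> k != 0 /\ s - k != 0.
Proof.
move=> s0 e; have k0 : k != 0.
  apply/eqP => k0; move: e; rewrite k0 subr0 disprel0 => /eqP.
  by rewrite sqrf_eq0 (negbTE s0).
split => //; apply/eqP => e0; move: e; rewrite e0 expr0n /= => /esym/eqP.
by rewrite gt_eqF // disprel_gt0.
Qed.

Lemma Re_sum n (G : 'I_n -> C) : Re (\sum_(i < n) G i) = \sum_(i < n) Re (G i).
Proof. by apply: (big_morph Re (id1 := 0)) => // a b; rewrite ReD. Qed.
Lemma Im_sum n (G : 'I_n -> C) : Im (\sum_(i < n) G i) = \sum_(i < n) Im (G i).
Proof. by apply: (big_morph Im (id1 := 0)) => // a b; rewrite ImD. Qed.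

(** The component [eta] of the relation cancels the quadratic terms of the first component. What
    remains is a relation between the functions [cosh (k i * y)], with coefficients
    [c i * (s - k i)] and [s - k i] nonzero. *)
Lemma evec_free s n (k : 'I_n -> R) (c : 'I_n -> C) : s != 0 -> injective k ->
  (forall i, (s - k i) ^+ 2 = F (k i)) ->
  eqY (\sum_(i < n) c i *: evec beta s (k i)) 0 -> forall i, c i = 0.
Proof.
move=> s0 kinj disp [hphi _ heta _].
(* Opposite roots are impossible: [F] is even, so they would give [(s - k)^2 = (s + k)^2], that is
   [s k = 0]. *)
have kinj2 : injective (fun i => k i ^+ 2).
  move=> i j /eqP; rewrite eqf_sqr => /orP[/eqP/kinj //|/eqP e].
  have := disp i; rewrite e disprelN -disp => /eqP.
  rewrite -subr_eq0 subr_sqr mulf_eq0 => /orP[]/eqP h; exfalso.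
    have [_ /eqP] := dispersion_neq s0 (disp j); have [/eqP + _] := dispersion_neq s0 (disp j).
    by move=> + _; apply; lra.
  by move/eqP: s0; apply; lra.
have eta0 : \sum_(i < n) c i * (k i * sinh (k i))%:C%C = 0.
  by rewrite -[RHS]heta s_eta_sum.
have d0 y : 0 < y < 1 -> \sum_(i < n) c i * ((s - k i) * cosh (k i * y))%:C%C = 0.
  move=> /hphi; rewrite s_phi_sum => hy.
  have : \sum_(i < n) (imag (- s * (y ^+ 2 / 2)) * (c i * (k i * sinh (k i))%:C%C)
     + imag 1 * (c i * ((s - k i) * cosh (k i * y))%:C%C)) = 0.
    rewrite -[RHS]hy; apply: eq_bigr => i _; rewrite s_phiZ /s_phi /= /evec_p.
    by apply: complexP; rewrite !complexE /=; ring.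
  rewrite big_split /= -!mulr_sumr eta0 mulr0 add0r => /eqP; rewrite mulf_eq0 => /orP[|/eqP//].
  by rewrite eq_complex /= eqxx oner_eq0.
move=> i; have [_ ski] := dispersion_neq s0 (disp i).
have hr : Re (c i) * (s - k i) = 0.
  apply: (cosh_free (d := fun i => Re (c i) * (s - k i)) kinj2) => y /d0 /(congr1 Re).
  rewrite Re_sum /= => h; rewrite -[RHS]h; apply: eq_bigr => j _.
  by rewrite ReM /=; ring.
have hi : Im (c i) * (s - k i) = 0.
  apply: (cosh_free (d := fun i => Im (c i) * (s - k i)) kinj2) => y /d0 /(congr1 Im).
  rewrite Im_sum /= => h; rewrite -[RHS]h; apply: eq_bigr => j _.
  by rewrite ImM /=; ring.
apply: complexP => /=.
  by move/eqP: hr; rewrite mulf_eq0 (negbTE ski) orbF => /eqP.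
by move/eqP: hi; rewrite mulf_eq0 (negbTE ski) orbF => /eqP.
Qed.

End EigenvectorsFree.
Section EigenvalueDispersion.
Context {R : realType}.
Variables (beta kappa : R).
Hypotheses (beta_gt0 : 0 < beta) (mu0_gt0 : 0 < mu0 beta kappa).
Local Notation C := R[i].
Local Notation mu := (@lebesgue_measure R).
Local Notation Lop := (@Lop R beta kappa).
Local Notation F := (disprel beta (mu0 beta kappa)).
Local Notation Re := (@complex.Re R).
Local Notation Im := (@complex.Im R).
Implicit Types (s k y : R).

Lemma constant_on01 (f : R -> R) : (forall y, 0 < y < 1 -> is_derive y 1 f 0) ->
  forall y, 0 < y < 1 -> f y = f (1 / 2).
Proof.
move=> df; have lt_eq x y : 0 < x -> x < y -> y < 1 -> f x = f y.
  move=> x0 xy y1.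
  have [||z _] := @MVT _ f (fun=> 0) x y xy.
  - move=> z; rewrite in_itv /= => /andP[xz zy]; apply: df.
    by rewrite (lt_trans x0) // (lt_trans zy).
  - apply: derivable_within_continuous => z; rewrite in_itv /= => /andP[xz zy].
    have [|h _] := df z; last exact: h.
    by rewrite (lt_le_trans x0) // (le_lt_trans zy).
  by rewrite mul0r => /eqP; rewrite subr_eq0 => /eqP ->.
move=> y /andP[y0 y1]; have [h|h|->//] := ltgtP y (1 / 2).
  by apply: lt_eq => //; lra.
by apply/esym/lt_eq => //; lra.
Qed.

(* The Wronskian of (psi, chi) and cosh (k y) is constant, hence 0, and
   psi / cosh (k y) is then constant. *)
Lemma cosh_ode k (psi chi Psi Chi : R -> R) :
  (forall y, 0 < y < 1 -> is_derive y 1 psi (chi y)) ->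
  (forall y, 0 < y < 1 -> is_derive y 1 chi (k ^+ 2 * psi y)) ->
  continuous Psi -> continuous Chi ->
  (forall y, 0 < y < 1 -> psi y = Psi y) -> (forall y, 0 < y < 1 -> chi y = Chi y) ->
  Chi 0 = 0 ->
  exists A, forall y, 0 < y < 1 -> psi y = A * cosh (k * y) /\ chi y = A * (k * sinh (k * y)).
Proof.
move=> dpsi dchi cPsi cChi ePsi eChi Chi0.
pose E y := chi y * cosh (k * y) - psi y * (k * sinh (k * y)).
have E0 y : 0 < y < 1 -> E y = 0.
  move=> y01; have cst1 : forall t, 0 < t < 1 -> E t = E (1 / 2).
    apply: constant_on01 => t t01.
    have hc := is_derive_coshM k t; have hs := is_derive_sinhM k t.
    have hks : is_derive t 1 (fun t => k * sinh (k * t)) (k * (k * cosh (k * t))).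
      exact: (is_deriveZ k hs).
    have h := is_deriveB (is_deriveM (dchi t t01) hc) (is_deriveM (dpsi t t01) hks).
    by apply: (is_derive_eq h); rewrite /GRing.scale /=; ring.
  rewrite cst1 //.
  have cE : continuous (fun t => Chi t * cosh (k * t) - Psi t * (k * sinh (k * t))).
    move=> t; apply: cvgB; apply: cvgM; [exact: cChi|exact: continuous_coshM|exact: cPsi|].
    by apply: cvgMr; exact: continuous_sinhM.
  have := @lim_at_right0 _ E _ cE; rewrite Chi0 mul0r mulr0 sinh0 !mulr0 subr0 => <-.
    apply/esym; rewrite (@lim_at_right0 _ _ (fun=> E (1 / 2))) //; first by move=> t; exact: cvg_cst.
  by move=> t t01; rewrite /E ePsi // eChi.
have d2 : forall t : R, 0 < t < 1 -> is_derive t 1 (fun t => psi t * (cosh (k * t))^-1) 0.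
  move=> t t01; have hc := is_derive_coshM k t; have c0 := lt0r_neq0 (cosh_gt0 (k * t)).
  have h :=  is_deriveM (dpsi t t01) (@is_deriveV _ (fun t => cosh (k * t)) t _ 1 c0 hc).
  apply: (is_derive_eq h); rewrite /GRing.scale /=.
  transitivity (E t / cosh (k * t) ^+ 2); last by rewrite E0 // mul0r.
  by rewrite /E; field.
exists (psi (1 / 2) * (cosh (k * (1 / 2)))^-1) => y y01.
have c0 := lt0r_neq0 (cosh_gt0 (k * y)).
have e1 := constant_on01 d2 y01.
have epsi : psi y = psi (1 / 2) * (cosh (k * (1 / 2)))^-1 * cosh (k * y) by rewrite -e1 mulfVK.
split => //; apply: (mulIf c0).
have := E0 y y01; rewrite /E => /eqP; rewrite subr_eq0 => /eqP ->.
by rewrite epsi; ring.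
Qed.

Lemma H1_cderive_continuous (f G : R -> C) : H1 f -> ccontinuous G ->
  {ae mu, forall y, 0 < y < 1 -> cderiv f y = G y} ->
  forall y, 0 < y < 1 -> is_cderive f y (G y).
Proof.
move=> /H1P[fr fi] [gr gi] ae y y01; split.
  apply: (rH1_derive_continuous fr gr _ y01); apply: ae_imply ae => t h.
  by rewrite /= in_itv /= => /h <-.
apply: (rH1_derive_continuous fi gi _ y01); apply: ae_imply ae => t h.
by rewrite /= in_itv /= => /h <-.
Qed.

Lemma complex_cosh_ode k (psi chi Psi Chi : R -> C) :
  (forall y, 0 < y < 1 -> is_cderive psi y (chi y)) ->
  (forall y, 0 < y < 1 -> is_cderive chi y ((k ^+ 2)%:C%C * psi y)) ->
  ccontinuous Psi -> ccontinuous Chi ->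
  (forall y, 0 < y < 1 -> psi y = Psi y) -> (forall y, 0 < y < 1 -> chi y = Chi y) ->
  Chi 0 = 0 ->
  exists A : C, forall y, 0 < y < 1 ->
    psi y = A * (cosh (k * y))%:C%C /\ chi y = A * (k * sinh (k * y))%:C%C.
Proof.
move=> dpsi dchi [cPr cPi] [cCr cCi] ePsi eChi C0.
have [|||||Ar hr] := @cosh_ode k (fun y => Re (psi y)) (fun y => Re (chi y)) _ _ _ _ cPr cCr.
- by move=> y /dpsi[].
- move=> y /dchi[+ _]; rewrite !complexE /= mul0r subr0; exact.
- by move=> y /ePsi ->.
- by move=> y /eChi ->.
- by rewrite C0.
have [|||||Ai hi] := @cosh_ode k (fun y => Im (psi y)) (fun y => Im (chi y)) _ _ _ _ cPi cCi.
- by move=> y /dpsi[].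
- move=> y /dchi[_ +]; rewrite !complexE /= mul0r addr0; exact.
- by move=> y /ePsi ->.
- by move=> y /eChi ->.
- by rewrite C0.
exists (Complex Ar Ai) => y y01; have [h1 h2] := hr y y01; have [h3 h4] := hi y y01.
by split; apply: complexP; rewrite complexE /= ?h1 ?h2 ?h3 ?h4; ring.
Qed.

(** The eigenvalue equation reduces to a linear equation of second order in [y], whose solution is
    [A cosh (k y)] by the condition at 0. The two conditions left at [y = 1] form a homogeneous
    linear system in [A] and [eta], and the dispersion relation is the vanishing of its
    determinant. *)
Lemma eigenvalue_dispersion s k : s != 0 ->
  L_eigenvalue beta kappa (imag s) (imag k) -> (s - k) ^+ 2 = F k.
Proof.
move=> s0 [U [dU nU [ephi eu eeta ez]]].
have [u1 u2 u3 u4] := dU.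
set eta := s_eta U in eeta ez *; set z := s_z U in eeta *.
have b0 : beta%:C%C != 0 :> C by rewrite fmorph_eq0 gt_eqF.
have m0 : (mu0 beta kappa)%:C%C != 0 :> C by rewrite fmorph_eq0 gt_eqF.
have ezeta : z = beta%:C%C * (imag k * eta).
  have : z / beta%:C%C = imag k * eta by [].
  by move=> <-; rewrite mulrC mulfVK.
have eU y : 0 < y < 1 -> s_u U y = imag k * s_phi U y + imag s * (y ^+ 2)%:C%C * (imag k * eta) / 2.
  move=> y01; have := ephi y y01; rewrite s_phiZ s_phi_L -/z ezeta => <-.
  by field.
(* Adding the quadratic term undoes the change of variables: [psi] is the original potential, which
   satisfies [psi'' = k^2 psi]. *)
pose q y : C := (y ^+ 2 / 2)%:C%C.
pose psi y : C := imag s * eta * q y + s_phi U y.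
pose chi y : C := imag s * eta * y%:C%C + cderiv (s_phi U) y.
have dpsi y : 0 < y < 1 -> is_cderive psi y (chi y).
  move=> y01; apply: is_cderive_lin; last exact: H2_is_cderive.
  by apply: is_cderive_real; exact: is_derive_half_sqr.
have H1y : H1 (fun y : R => y%:C%C).
  by apply: (@H1_real _ _ (fun=> 1)) => y; exact: cvg_cst.
have psi1 : H1 psi by exact: (H1_lin _ H1_half_sqr u1.1).
have chi1 : H1 chi by exact: (H1_lin _ H1y u1.2).
have [Psi [cPsi ePsi]] := H1_ccontinuous psi1.
have [Chi [cChi eChi]] := H1_ccontinuous chi1.
have Chi0 : Chi 0 = 0.
  rewrite -(tr0E cChi eChi) (tr0_lin _ H1y u1.2) u4 addr0.
  rewrite (@tr0E _ _ (fun y : R => y%:C%C)) ?mulr0 //.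
  by apply: ccontinuous_real => y; exact: cvg_id.
have cG : ccontinuous (fun y => (k ^+ 2)%:C%C * Psi y).
  have := ccontinuous_lin ((k ^+ 2)%:C%C) cPsi (ccontinuous_cst 0).
  by congr (ccontinuous _); apply/funext => y; rewrite addr0.
have i2 (x1 x2 : R) : imag x1 * imag x2 = - (x1 * x2)%:C%C.
  by apply: complexP; rewrite !complexE /=; ring.
(* The equation is known almost everywhere at first; as its right side is continuous, the H^1
   function [chi] is differentiable everywhere. *)
have dchi y : 0 < y < 1 -> is_cderive chi y ((k ^+ 2)%:C%C * psi y).
  move=> y01; rewrite ePsi //; apply: (H1_cderive_continuous chi1 cG _ y01).
  have [g [_ hg]] := H1_ae_cderive u1.2.
  apply: ae_imply2 eu hg => t eut hgt t01.
  have hd : is_cderive (cderiv (s_phi U)) t (g t) by apply: hgt; rewrite /= in_itv.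
  rewrite (is_cderiveE (is_cderive_lin (imag s * eta) (is_cderive_real (is_derive_id t 1)) hd)).
  have := eut t01; rewrite s_u_L s_uZ (is_cderiveE hd) -/eta eU // => e.
  rewrite -ePsi // /psi /q.
  have -> : g t = - (imag k * (imag k * s_phi U t + imag s * (t ^+ 2)%:C%C * (imag k * eta) / 2)) - imag s * eta.
    by rewrite -e; ring.
  have ik : imag k * imag k = - (k ^+ 2)%:C%C by rewrite i2.
  have e2 : (t ^+ 2 / 2)%:C%C = (t ^+ 2)%:C%C / 2 :> C by rewrite rmorphM fmorphV rmorph_nat.
  rewrite e2 mulr1.
  transitivity (- (imag k * imag k) * (imag s * eta * ((t ^+ 2)%:C%C / 2) + s_phi U t)).
    by field.
  by rewrite ik opprK.
have [A hA] := complex_cosh_ode dpsi dchi cPsi cChi ePsi eChi Chi0.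
have cC : ccontinuous (fun y => A * (cosh (k * y))%:C%C).
  have := ccontinuous_lin A (ccontinuous_real (@continuous_coshM _ k)) (ccontinuous_cst 0).
  by congr (ccontinuous _); apply/funext => y; rewrite addr0.
have cS : ccontinuous (fun y => A * (k * sinh (k * y))%:C%C).
  have cs : continuous (fun y => k * sinh (k * y)).
    by move=> y; apply: cvgMr; exact: continuous_sinhM.
  have := ccontinuous_lin A (ccontinuous_real cs) (ccontinuous_cst 0).
  by congr (ccontinuous _); apply/funext => y; rewrite addr0.
have cq : ccontinuous q.
  apply: ccontinuous_real => y; apply: cvgM; last exact: cvg_cst.
  exact: exprn_continuous.
have ephiA y : 0 < y < 1 -> s_phi U y = - (imag s * eta) * q y + A * (cosh (k * y))%:C%C.
  by move=> y01; have [<- _] := hA y y01; rewrite /psi; ring.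
have euA y : 0 < y < 1 -> s_u U y = imag k * A * (cosh (k * y))%:C%C.
  move=> y01; rewrite eU // ephiA // /q rmorphM fmorphV rmorph_nat; by field.
have t1 : tr1 (s_phi U) = - (imag s * eta) / 2 + A * (cosh k)%:C%C.
  rewrite (tr1E (ccontinuous_lin (- (imag s * eta)) cq cC) ephiA) mulr1.
  by rewrite /q expr1n mul1r fmorphV rmorph_nat.
have t2 : tr1 (s_u U) = imag k * A * (cosh k)%:C%C.
  rewrite (@tr1E _ _ (fun y => imag k * (A * (cosh (k * y))%:C%C))).
  - by rewrite mulr1 mulrA.
  - have := ccontinuous_lin (imag k) cC (ccontinuous_cst 0).
    by congr (ccontinuous _); apply/funext => y; rewrite addr0.
  - by move=> y /euA ->; rewrite mulrA.
have t3 : tr1 (cderiv (s_phi U)) = A * (k * sinh k)%:C%C - imag s * eta.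
  have cy : ccontinuous (fun y : R => y%:C%C : C) by apply: ccontinuous_real => y; exact: cvg_id.
  rewrite (tr1E (ccontinuous_lin (- (imag s * eta)) cy cS)).
    by rewrite !mulr1 addrC.
  by move=> y y01; have [_ <-] := hA y y01; rewrite /chi; ring.
(* The boundary condition of the domain at [y = 1]; [eq2] is the last component of the eigenvalue
   equation, and eliminating [A] between them gives [key]. *)
have eq1 : A * (k * sinh k)%:C%C = imag (s - k) * eta.
  have := u3; rewrite t3 -/z ezeta => h.
  have -> : imag (s - k) = imag s - imag k by apply: complexP; rewrite complexE /=; ring.
  apply/eqP; rewrite -subr_eq0 -[X in _ == X]h; apply/eqP; by field.
have eq2 : - (mu0 beta kappa * (1 + beta * k ^+ 2))%:C%C * eta = imag (s - k) * (A * (cosh k)%:C%C).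
  have h : s_z (Lop (imag s) U) = imag k * z := ez.
  rewrite s_z_L -/eta t1 t2 ezeta in h.
  have -> : imag (s - k) = imag s - imag k by apply: complexP; rewrite complexE /=; ring.
  have -> : - (mu0 beta kappa * (1 + beta * k ^+ 2))%:C%C
      = (mu0 beta kappa)%:C%C * (beta%:C%C * (imag k * imag k)) - (mu0 beta kappa)%:C%C.
    by rewrite i2; apply: complexP; rewrite !complexE /=; ring.
  set m := (mu0 beta kappa)%:C%C in h m0 *.
  have -> : (m * (beta%:C%C * (imag k * imag k)) - m) * eta
      = m * (imag k * (beta%:C%C * (imag k * eta))) - m * eta by ring.
  by rewrite -h; field.
have c0 := lt0r_neq0 (cosh_gt0 k).
have key : ((s - k) ^+ 2 * cosh k - mu0 beta kappa * (1 + beta * k ^+ 2) * (k * sinh k))%:C%C * eta = 0.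
  have -> : ((s - k) ^+ 2 * cosh k - mu0 beta kappa * (1 + beta * k ^+ 2) * (k * sinh k))%:C%C * eta
    = - (mu0 beta kappa * (1 + beta * k ^+ 2))%:C%C * eta * (k * sinh k)%:C%C
      - imag (s - k) * (imag (s - k) * eta) * (cosh k)%:C%C.
    by apply: complexP; rewrite !complexE /=; ring.
  by rewrite eq2 -eq1; ring.
move/eqP: key; rewrite mulf_eq0 => /orP[|/eqP eta0].
  rewrite fmorph_eq0 subr_eq0 => /eqP e; apply: (mulIf c0); rewrite e /disprel tanhE.
  by field.
(* With [eta = 0] also [A = 0]: otherwise [eq2] gives [s = k] and then [eq1] gives [k sinh k = 0],
   against [s != 0]. So the eigenvector would vanish. *)
exfalso.
have A0 : A = 0.
  move: eq2; rewrite eta0 mulr0 => /esym/eqP; rewrite !mulf_eq0 [(cosh k)%:C%C == 0]fmorph_eq0 (negbTE c0) orbF.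
  case/orP => [|/eqP //]; rewrite eq_complex /= eqxx /= subr_eq0 => /eqP sk.
  move: eq1; rewrite eta0 mulr0 => /eqP; rewrite mulf_eq0 => /orP[/eqP //|].
  rewrite fmorph_eq0 mulf_eq0 -sk (negbTE s0) /= => /eqP /sinh_eq0 s00.
  by rewrite s00 eqxx in s0.
apply: nU; split.
- by move=> y y01; rewrite ephiA // eta0 A0 !(mulr0, mul0r, oppr0, addr0).
- by apply: aeW => y y01; rewrite euA // A0 !(mulr0, mul0r).
- exact: eta0.
- by rewrite -/z ezeta eta0 !mulr0.
Qed.

End EigenvalueDispersion.

(** * The reduced system and its monodromy *)

Section ExponentialSolutions.
Context {R : realType}.
Local Notation C := R[i].
Local Notation state := (@state R).
Local Notation Re := (@complex.Re R).
Local Notation Im := (@complex.Im R).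
Implicit Types (k x h : R) (U V : state).

Lemma cexpi0 : cexpi 0 = 1 :> C.
Proof. by apply: complexP; rewrite /= ?cos0 ?sin0. Qed.

Lemma cexpiD x h : cexpi (x + h) = cexpi x * cexpi h.
Proof. by apply: complexP; rewrite complexE /= ?cosD ?sinD //; ring. Qed.

Lemma cmod_cexpi x : cmod (cexpi x) = 1.
Proof. by rewrite /cmod /= cos2Dsin2 sqrtr1. Qed.

Lemma cexpi_neq0 x : cexpi x != 0.
Proof. by apply/eqP => h; have := cmod_cexpi x; rewrite h cmod0 => /eqP; rewrite eq_sym oner_eq0. Qed.

Lemma is_cderive_cexpi k x : is_cderive (fun t => cexpi (k * t)) x (imag k * cexpi (k * x)).
Proof.
have hk : is_derive x 1 (fun t : R => k * t) (k * 1) by exact: (is_deriveZ k (is_derive_id x 1)).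
split; rewrite complexE /=.
  have h := @is_derive1_comp _ cos (fun t => k * t) x _ _ (is_derive_cos (k * x)) hk.
  by apply: (is_derive_eq h); ring.
have h := @is_derive1_comp _ sin (fun t => k * t) x _ _ (is_derive_sin (k * x)) hk.
by apply: (is_derive_eq h); ring.
Qed.

Lemma cvg_eq (f g : R -> R) (F : set_system R) (l : R) : f =1 g -> f @ F --> l -> g @ F --> l.
Proof. by move=> /funext ->. Qed.

Lemma is_derive_quotient (f : R -> R) x d : is_derive x 1 f d ->
  (fun h => h^-1 * (f (x + h) - f x) - d) @ 0^' --> (0 : R).
Proof.
move=> [fx fd].
have h : (fun h => h^-1 *: (f (h *: 1 + x) - f x)) @ 0^' --> d by rewrite -fd; exact: fx.
have hh : (fun h => h^-1 *: (f (h *: 1 + x) - f x) - d) @ 0^' --> d - d.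
  by apply: cvgB h _; exact: cvg_cst.
rewrite subrr in hh; apply: (cvg_eq _ hh) => t.
by rewrite /= /GRing.scale /= mulr1 [t + x]addrC.
Qed.

Lemma normYE U : normY U = Num.sqrt (normsq U). Proof. by []. Qed.

Lemma normY_cvg0 (D : R -> state) (g : R -> R) : (\forall h \near 0^', normsq (D h) <= g h) ->
  g h @[h --> 0^'] --> (0 : R) -> (fun h => normY (D h)) @ 0^' --> (0 : R).
Proof.
move=> Dg g0; rewrite -[X in _ --> X](@sqrtr0 R).
have hs : (fun h => normsq (D h)) @ 0^' --> (0 : R).
  apply: (squeeze_cvgr _ (cvg_cst 0) g0).
  by apply: filterS Dg => h Dh; rewrite normsq_ge0.
exact: (continuous_cvg _ (@sqrt_continuous R 0) hs).
Qed.

Lemma normY_cvg0_sqr (D : R -> state) : (fun h => normY (D h)) @ 0^' --> (0 : R) ->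
  (fun h => normsq (D h)) @ 0^' --> (0 : R).
Proof.
move=> h; have hh : (fun h => normY (D h) * normY (D h)) @ 0^' --> (0 * 0 : R) by exact: (cvgM h h).
rewrite mulr0 in hh; apply: (cvg_eq _ hh) => t.
by rewrite /= normYE -expr2 sqr_sqrtr // normsq_ge0.
Qed.

Lemma is_derive_Y_exp k x U V : inY U -> inY V ->
  eqY V ((imag k * cexpi (k * x)) *: U) -> is_derive_Y (fun t => cexpi (k * t) *: U) x V.
Proof.
move=> iU iV eV.
pose c h : C := (h^-1)%:C%C * (cexpi (k * (x + h)) - cexpi (k * x)) - imag k * cexpi (k * x).
have [dr di] := is_cderive_cexpi k x.
have cr := is_derive_quotient dr; have ci := is_derive_quotient di.
have c0 : (fun h => 2 * cmod (c h) ^+ 2 * normsq U + 2 * normsq 0) @ 0^' --> (0 : R).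
  have cr' : (fun h => Re (c h)) @ 0^' --> (0 : R).
    by apply: (cvg_eq _ cr) => h; rewrite /c complexE /=; ring.
  have ci' : (fun h => Im (c h)) @ 0^' --> (0 : R).
    by apply: (cvg_eq _ ci) => h; rewrite /c complexE /=; ring.
  have cc : (fun h => 2 * (Re (c h) * Re (c h) + Im (c h) * Im (c h)) * normsq U) @ 0^'
      --> 2 * (0 * 0 + 0 * 0) * normsq U.
    by apply: cvgMr_tmp; apply: cvgMl_tmp; apply: cvgD; apply: cvgM.
  rewrite mul0r addr0 mulr0 mul0r in cc; apply: (cvg_eq _ cc) => h.
  by rewrite normsq0 mulr0 addr0 cmod_sqr !expr2.
apply: (normY_cvg0 _ c0); apply: nearW => h.
set D := (X in normsq X).
have -> : normsq D = normsq (c h *: U + 0).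
  apply: eqY_normsq; first by apply: inYB => //; apply: inYZ; apply: inYB; apply: inYZ.
    by apply: inYD; [exact: inYZ|exact: inY0].
  apply: (eqY_trans (eqYB (eqY_refl _) eV)).
  rewrite addr0 -scalerBl scalerA -scalerBl; exact: eqY_refl.
exact: (normsq_lin _ iU inY0).
Qed.

(** The difference quotients of [f] and [g] agree modulo [eqY], so [normsq (U - V)] is at most twice
    the sum of the two squared errors, which tends to 0. *)
Lemma is_derive_Y_unique (f g : R -> state) x U V : (forall t, inY (f t)) ->
  (forall t, inY (g t)) -> (forall t, eqY (f t) (g t)) -> inY U -> inY V ->
  is_derive_Y f x U -> is_derive_Y g x V -> eqY U V.
Proof.
move=> If Ig fg iU iV dU dV.
pose Df (h : R) := (h^-1)%:C%C *: (f (x + h) - f x) - U.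
pose Dg (h : R) := (h^-1)%:C%C *: (g (x + h) - g x) - V.
move: dU dV => /(@normY_cvg0_sqr Df) dU /(@normY_cvg0_sqr Dg) dV.
apply: eqY_subr0; apply: normsq_eq0; first exact: inYB.
have lim0 : (fun h => normsq (Df h) * 2 + normsq (Dg h) * 2) @ 0^' --> (0 * 2 + 0 * 2 : R).
  by apply: cvgD; exact: cvgMr_tmp.
rewrite mul0r addr0 in lim0.
have iq (F : R -> state) h : (forall t, inY (F t)) -> inY ((h^-1)%:C%C *: (F (x + h) - F x)).
  by move=> IF; apply: inYZ; exact: inYB.
apply/eqP; rewrite eq_le normsq_ge0 andbT.
apply: (ler_cvg_to (cvg_cst (normsq (U - V))) lim0); apply: nearW => h.
set A := Df h; set B := Dg h.
have iA : inY A by apply: inYB => //; exact: iq.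
have iB : inY B by apply: inYB => //; exact: iq.
have := normsq_lin (-1) iA iB.
have -> : normsq (-1 *: A + B) = normsq (U - V).
  apply: eqY_normsq; [exact: inY_lin|exact: inYB|].
  rewrite /A /B /Df /Dg scaleN1r opprB -addrA; apply: eqYD; first exact: eqY_refl.
  rewrite addrA -[X in eqY _ X]add0r; apply: eqYD; last exact: eqY_refl.
  rewrite -(scaler0 _ ((h^-1)%:C%C)) addrC -scalerBr; apply: eqYZ.
  rewrite -(subrr (g (x + h) - g x)); apply: eqYB; first exact: eqY_refl.
  by apply: eqYB.
have -> : cmod (-1 : C) = 1 by rewrite /cmod /= oppr0 expr0n addr0 sqrrN expr1n sqrtr1.
by rewrite expr1n mulr1 ![2 * _]mulrC.
Qed.

End ExponentialSolutions.

(** * Maps that are linear modulo [eqY] *)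

Section LinearModuloEqY.
Context {R : realType}.
Local Notation C := R[i].
Local Notation state := (@state R).
Variables (S : state -> Prop) (f : state -> state).
Hypothesis S0 : S 0.
Hypothesis S_lin : forall (a : C) U V, S U -> S V -> S (a *: U + V).
Hypothesis f_lin : forall (a : C) U V, S U -> S V -> eqY (f (a *: U + V)) (a *: f U + f V).

Lemma closed_scale (a : C) U : S U -> S (a *: U).
Proof. by move=> SU; rewrite -[a *: U]addr0; exact: S_lin. Qed.

Lemma closed_sum n (c : 'I_n -> C) (G : 'I_n -> state) : (forall i, S (G i)) ->
  S (\sum_(i < n) c i *: G i).
Proof.
elim: n c G => [|n IH] c G SG; first by rewrite big_ord0.
by rewrite big_ord_recl /=; apply: S_lin; [exact: SG|apply: IH].
Qed.

Lemma eqY_lin0 : eqY (f 0) 0.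
Proof.
have := f_lin 1 S0 S0; rewrite !scale1r addr0 => h.
have := eqYB h (eqY_refl (f 0)); rewrite subrr addrK; exact: eqY_sym.
Qed.

Lemma eqY_linZ (a : C) U : S U -> eqY (f (a *: U)) (a *: f U).
Proof.
move=> SU; have := f_lin a SU S0; rewrite addr0 => h; apply: (eqY_trans h).
rewrite -[X in eqY _ X]addr0; apply: eqYD; [exact: eqY_refl|exact: eqY_lin0].
Qed.

Lemma eqY_lin_sum n (c : 'I_n -> C) (G : 'I_n -> state) : (forall i, S (G i)) ->
  eqY (f (\sum_(i < n) c i *: G i)) (\sum_(i < n) c i *: f (G i)).
Proof.
elim: n c G => [|n IH] c G SG; first by rewrite !big_ord0; exact: eqY_lin0.
rewrite !big_ord_recl /=; apply: (eqY_trans (f_lin _ (SG _) (closed_sum _ _))) => //.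
by apply: eqYD; [exact: eqY_refl|apply: IH].
Qed.

End LinearModuloEqY.

Section ReducedSystem.
Context {R : realType}.
Local Notation C := R[i].
Local Notation state := (@state R).
Variables (beta kappa sigma tau : R) (w : @wave R).
Hypotheses (beta_gt0 : 0 < beta) (mu0_gt0 : 0 < mu0 beta kappa).
Hypothesis eta0 : forall x, etab w x = 0.
Hypothesis phi0 : forall x y, 0 <= y <= 1 ->
  [/\ dx (phib w) x y = 0, dy (phib w) x y = 0 & dy (dy (phib w)) x y = 0].
Hypothesis mu_w : mub w = mu0 beta kappa.
Variables (P : state -> state) (W : R -> state -> state).
Hypothesis projP : spectral_projection beta kappa sigma P.
Hypothesis redW : is_reduction beta kappa sigma P w (imag tau) W.
Local Notation Ysigma := (@Ysigma R beta kappa sigma).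
Local Notation domL := (@domL R beta).
Local Notation red := (@reduced R beta kappa sigma P w (imag tau) W).
Local Notation F := (disprel beta (mu0 beta kappa)).
Implicit Types (x k : R) (U V v : state).

Let mu0_neq0 : mu0 beta kappa != 0. Proof. by rewrite gt_eqF. Qed.
Let beta_neq0 : beta != 0. Proof. by rewrite gt_eqF. Qed.

Lemma Ysigma_inY v : Ysigma v -> inY v.
Proof. by move=> h; apply: domL_inY; exact: Ysigma_domL h. Qed.

Lemma proj_inY U : inY U -> inY (P U).
Proof. by case: projP => h _ _ _ _ /h; exact: Ysigma_inY. Qed.

(** [P] acts on representatives. That it respects [eqY] follows from its boundedness, applied to a
    difference of norm 0. *)
Lemma proj_eqY U V : inY U -> inY V -> eqY U V -> eqY (P U) (P V).
Proof.
have [_ Plin [K PK] _ _] := projP.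
move=> iU iV UV; have iD : inY (U - V) by exact: inYB.
have D0 : normsq (U - V) = 0.
  by rewrite -normsq0; apply: eqY_normsq => //; [exact: inY0|rewrite -(subrr V); apply: eqYB => //; exact: eqY_refl].
have PD0 : eqY (P (U - V)) 0.
  apply: normsq_eq0; first exact: proj_inY.
  have := PK _ iD; rewrite !normYE D0 sqrtr0 mulr0 => h.
  have : Num.sqrt (normsq (P (U - V))) = 0 by apply/eqP; rewrite eq_le h sqrtr_ge0.
  by move/eqP; rewrite sqrtr_eq0 => h0; apply/eqP; rewrite eq_le h0 normsq_ge0.
have := Plin 1 _ _ iD iV; rewrite !scale1r subrK => h; apply: (eqY_trans h).
by rewrite -[X in eqY _ X]add0r; apply: eqYD => //; exact: eqY_refl.
Qed.

Lemma Lincr_eqY lam lam' U V : H1 (s_phi V) -> eqY U V ->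
  eqY (Lincr beta kappa lam lam' U) (Lincr beta kappa lam lam' V).
Proof.
move=> hV [h1 h2 h3 h4]; split.
- by move=> y y01; rewrite /Lincr /s_phi /= h4.
- by apply: aeW => y y01; rewrite /Lincr /s_u /= h3.
- by [].
- by rewrite /Lincr /s_z /= h3 (eq_tr1 hV h1).
Qed.

Lemma reduced_domL x v : Ysigma v -> domL (v + W x v).
Proof.
case: redW => h _ _ _ _ sv; apply: domLD; first exact: Ysigma_domL sv.
exact: (h x v sv).1.
Qed.

Lemma domL_H1 U : domL U -> H1 (s_phi U). Proof. by case=> [[]]. Qed.

Lemma reduced_inY x v : Ysigma v -> inY (red x v).
Proof.
move=> sv; apply: inYD; first by apply: Lop_inY; exact: Ysigma_domL sv.
by apply: proj_inY; apply: Bdelta_inY => //; exact: reduced_domL.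
Qed.

(** At the trivial wave the perturbation is [Lincr], where the second derivatives have cancelled,
    and which therefore respects [eqY]. *)
Lemma reduced_eq x v v' : Ysigma v -> Ysigma v' -> eqY v v' -> eqY (red x v) (red x v').
Proof.
case: redW => _ Weq _ _ _ sv sv' e; apply: eqYD.
  exact: (Lop_eqY _ _ (Ysigma_domL sv) (Ysigma_domL sv') e).
have d := reduced_domL x sv; have d' := reduced_domL x sv'.
apply: proj_eqY; [exact: Bdelta_inY|exact: Bdelta_inY|].
apply: (eqY_trans (Bdelta_eqY eta0 phi0 mu0_neq0 mu_w _ _ _ d)).
apply: (eqY_trans _ (eqY_sym (Bdelta_eqY eta0 phi0 mu0_neq0 mu_w _ _ _ d'))).
by apply: Lincr_eqY; [exact: domL_H1|apply: eqYD => //; exact: Weq].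
Qed.

Lemma reduced_lin x (a : C) v v' : Ysigma v -> Ysigma v' ->
  eqY (red x (a *: v + v')) (a *: red x v + red x v').
Proof.
have [_ Plin _ _ _] := projP.
case: redW => _ Weq Wlin _ _ sv sv'; have s := Ysigma_lin a sv sv'.
have d := reduced_domL x sv; have d' := reduced_domL x sv'; have ds := reduced_domL x s.
have eL := Lop_lin kappa (imag sigma) a (Ysigma_domL sv) (Ysigma_domL sv').
have eW : eqY ((a *: v + v') + W x (a *: v + v')) (a *: (v + W x v) + (v' + W x v')).
  apply: (eqY_trans (eqYD (eqY_refl _) (Wlin x a _ _ sv sv'))).
  by rewrite scalerDr addrACA; exact: eqY_refl.
have dl := domL_lin a d d'.
have i := Bdelta_inY kappa eta0 phi0 sigma (imag tau) x d.
have i' := Bdelta_inY kappa eta0 phi0 sigma (imag tau) x d'.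
have is_ := Bdelta_inY kappa eta0 phi0 sigma (imag tau) x ds.
set D := Bdelta beta kappa sigma w (imag tau) x in i i' is_ *.
have b := Bdelta_eqY eta0 phi0 mu0_neq0 mu_w sigma (imag tau) x d.
have b' := Bdelta_eqY eta0 phi0 mu0_neq0 mu_w sigma (imag tau) x d'.
have bs := Bdelta_eqY eta0 phi0 mu0_neq0 mu_w sigma (imag tau) x ds.
have eD : eqY (D (a *: v + v' + W x (a *: v + v'))) (a *: D (v + W x v) + D (v' + W x v')).
  apply: (eqY_trans bs).
  apply: (eqY_trans (Lincr_eqY _ _ (domL_H1 dl) eW)).
  apply: (eqY_trans (Lincr_lin _ _ _ _ _ (domL_H1 d) (domL_H1 d'))).
  exact: (eqY_sym (eqY_lin a b b')).
have eP := eqY_trans (proj_eqY is_ (inY_lin a i i') eD) (Plin a _ _ i i').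
apply: (eqY_trans (eqYD eL eP)).
by rewrite /reduced scalerDr addrACA; exact: eqY_refl.
Qed.

Lemma evec_inY s k : inY (evec beta s k).
Proof. by apply: domL_inY; exact: evec_domL. Qed.

(* The profile in Y(sigma) of the bounded solution e^(i k x) E. *)
Definition mode k : state := P (evec beta (sigma + tau) k).

Lemma mode_Ysigma k : Ysigma (mode k).
Proof. by have [h _ _ _ _] := projP; apply: h; exact: evec_inY. Qed.

Lemma Ysigma_scale (a : C) v : Ysigma v -> Ysigma (a *: v).
Proof. by apply: closed_scale; [exact: Ysigma0|exact: Ysigma_lin]. Qed.

Lemma exp_solution k : (sigma + tau - k) ^+ 2 = F k ->
  bounded_solution domL (LBop beta w (imag sigma + imag tau))
    (fun x => cexpi (k * x) *: evec beta (sigma + tau) k).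
Proof.
move=> disp; have iE := evec_inY (sigma + tau) k.
have dE := @evec_domL R beta (sigma + tau) k beta_neq0.
split.
- by move=> x; exact: domLZ.
- exists (Num.sqrt (2 * normsq (evec beta (sigma + tau) k))) => x.
  rewrite normYE ler_wsqrtr //; have := normsq_lin (cexpi (k * x)) iE inY0.
  by rewrite addr0 cmod_cexpi normsq0 expr1n mulr1 mulr0 addr0.
- move=> x; have dx := domLZ (cexpi (k * x)) dE.
  apply: is_derive_Y_exp => //; first exact: LBop_inY.
  apply: (eqY_trans (LBop_eqY eta0 phi0 mu0_neq0 mu_w _ _ dx)).
  apply: (eqY_trans (LopZ _ _ _ dE)).
  rewrite -imagD [imag k * _]mulrC -scalerA; apply: eqYZ.
  exact: eqp_eqY (evec_eigen beta_neq0 mu0_neq0 disp).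
Qed.

(** The exponential solution splits as [v + W v] with [v] a solution of the reduced system. Applying
    [P], which kills [W v] and fixes [v], identifies [v] with the exponential times [mode k].
    Comparing the two expressions of its derivative then gives the reduced field on the mode. *)
Lemma mode_split k x : (sigma + tau - k) ^+ 2 = F k ->
  eqY (cexpi (k * x) *: evec beta (sigma + tau) k)
      (cexpi (k * x) *: mode k + W x (cexpi (k * x) *: mode k))
  /\ eqY (red x (mode k)) (imag k *: mode k).
Proof.
have [PY Plin _ Pid _] := projP.
have [Wdom Weq Wlin _ Wsol] := redW.
move=> disp; have sol := exp_solution disp.
have /Wsol[dU [v [[sv _ dv] Uv]]] := sol.
have iE := evec_inY (sigma + tau) k.
have inYlin (a : C) U V : inY U -> inY V -> inY (a *: U + V) by exact: inY_lin.
have ev t : eqY (v t) (cexpi (k * t) *: mode k).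
  have dW := Wdom t (v t) (sv t); have iW := domL_inY dW.1.
  have iv := Ysigma_inY (sv t).
  have := proj_eqY (inYZ _ iE) (inYD iv iW) (Uv t) => e1.
  have := Plin 1 _ _ iv iW; rewrite !scale1r => e2.
  have e3 : eqY (P (v t) + P (W t (v t))) (v t).
    rewrite -[X in eqY _ X]addr0; apply: eqYD; [exact: Pid|exact: dW.2].
  have e4 := eqY_linZ inY0 Plin (cexpi (k * t)) iE.
  exact: (eqY_trans (eqY_sym e3) (eqY_trans (eqY_sym e2) (eqY_trans (eqY_sym e1) e4))).
have sm t := Ysigma_scale (cexpi (k * t)) (mode_Ysigma k).
split.
  apply: (eqY_trans (Uv x)); apply: eqYD; [exact: ev|apply: Weq => //].
have im := Ysigma_inY (mode_Ysigma k).
have e : eqY (red x (v x)) ((imag k * cexpi (k * x)) *: mode k).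
  apply: (is_derive_Y_unique (f := v) (g := fun t => cexpi (k * t) *: mode k) (x := x)) => //.
  - by move=> t; exact: Ysigma_inY.
  - by move=> t; exact: inYZ.
  - exact: reduced_inY.
  - exact: inYZ.
  - by apply: is_derive_Y_exp => //; [exact: inYZ|exact: eqY_refl].
have e1 := reduced_eq x (sv x) (sm x) (ev x).
have e2 := eqY_linZ (Ysigma0 beta kappa sigma) (@reduced_lin x) (cexpi (k * x)) (mode_Ysigma k).
have e3 := eqY_trans (eqY_sym e2) (eqY_trans (eqY_sym e1) e).
(* The reduced field is linear, so the exponential factor can be divided out. *)
have := eqYZ (cexpi (k * x))^-1 e3.
rewrite !scalerA mulVf ?cexpi_neq0 // scale1r mulrC mulfK ?cexpi_neq0 //.
Qed.

(** At [x = 0] each eigenvector is recovered from its mode [v] as [v + W 0 v], linearly in [v]. A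
    relation between modes thus becomes one between eigenvectors. *)
Lemma mode_free n (k : 'I_n -> R) (c : 'I_n -> C) : sigma + tau != 0 -> injective k ->
  (forall i, (sigma + tau - k i) ^+ 2 = F (k i)) ->
  eqY (\sum_(i < n) c i *: mode (k i)) 0 -> forall i, c i = 0.
Proof.
move=> s0 kinj disp e0; apply: (evec_free beta_gt0 mu0_gt0 s0 kinj disp).
have [_ Weq Wlin _ _] := redW.
have eU i : eqY (evec beta (sigma + tau) (k i)) (mode (k i) + W 0 (mode (k i))).
  by have [+ _] := mode_split 0 (disp i); rewrite mulr0 cexpi0 !scale1r.
apply: (eqY_trans (eqY_sum (fun i => eqYZ (c i) (eU i)))).
under eq_bigr do rewrite scalerDr.
rewrite big_split /= -[X in eqY _ X]addr0; apply: eqYD => //.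
have sm i := mode_Ysigma (k i).
have S0 := Ysigma0 beta kappa sigma.
have Slin : forall (a : C) U V, Ysigma U -> Ysigma V -> Ysigma (a *: U + V).
  by move=> a U V; exact: Ysigma_lin.
have := eqY_lin_sum S0 Slin (Wlin 0) c sm => /eqY_sym e1; apply: (eqY_trans e1).
apply: (eqY_trans (Weq 0 _ _ (closed_sum S0 Slin c sm) S0 e0)).
exact: (eqY_lin0 S0 (Wlin 0)).
Qed.

End ReducedSystem.

(** * Floquet multipliers from left eigenvectors *)

Section Monodromy.
Context {R : realType}.
Local Notation C := R[i].
Local Notation Re := (@complex.Re R).
Local Notation Im := (@complex.Im R).
Implicit Types (k t : R).

Lemma is_cderive_sum n (l : 'I_n -> C) (f : 'I_n -> R -> C) (d : 'I_n -> C) t :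
  (forall i, is_cderive (f i) t (d i)) ->
  is_cderive (fun s => \sum_(i < n) l i * f i s) t (\sum_(i < n) l i * d i).
Proof.
elim: n l f d => [|n IH] l f d df.
  rewrite big_ord0; have -> : (fun s => \sum_(i < 0) l i * f i s) = fun=> 0.
    by apply/funext => s; rewrite big_ord0.
  exact: is_cderive_cst.
rewrite big_ord_recl; have -> : (fun s => \sum_(i < n.+1) l i * f i s)
    = fun s => l ord0 * f ord0 s + \sum_(i < n) l (lift ord0 i) * f (lift ord0 i) s.
  by apply/funext => s; rewrite big_ord_recl.
apply: (is_cderive_lin (l ord0) (df ord0)); exact: (IH _ (fun i => f (lift ord0 i)) (fun i => d (lift ord0 i))).
Qed.

(** [z1] and [z2] are the real and imaginary parts of [exp (- i k t) y t], which has derivative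
    0. *)
Lemma exp_ode k (y : R -> C) : (forall t, is_cderive y t (imag k * y t)) ->
  forall t, y t = cexpi (k * t) * y 0.
Proof.
move=> dy.
pose z1 t := cos (k * t) * Re (y t) + sin (k * t) * Im (y t).
pose z2 t := cos (k * t) * Im (y t) - sin (k * t) * Re (y t).
have dk t : is_derive t 1 (fun t : R => k * t) (k * 1) by exact: (is_deriveZ k (is_derive_id t 1)).
have dc t : is_derive t 1 (fun t : R => cos (k * t)) (- sin (k * t) * (k * 1)).
  exact: (@is_derive1_comp _ cos (fun t => k * t) t _ _ (is_derive_cos (k * t)) (dk t)).
have ds t : is_derive t 1 (fun t : R => sin (k * t)) (cos (k * t) * (k * 1)).
  exact: (@is_derive1_comp _ sin (fun t => k * t) t _ _ (is_derive_sin (k * t)) (dk t)).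
have d1 t : is_derive t 1 z1 0.
  have [dr di] := dy t.
  have h := is_deriveD (is_deriveM (dc t) dr) (is_deriveM (ds t) di).
  by apply: (is_derive_eq h); rewrite /GRing.scale /= !complexE /=; ring.
have d2 t : is_derive t 1 z2 0.
  have [dr di] := dy t.
  have h := is_deriveB (is_deriveM (dc t) di) (is_deriveM (ds t) dr).
  by apply: (is_derive_eq h); rewrite /GRing.scale /= !complexE /=; ring.
move=> t.
have e1 : z1 t = Re (y 0) by rewrite (is_derive_0_is_cst t 0 d1) /z1 mulr0 cos0 sin0 mul1r mul0r addr0.
have e2 : z2 t = Im (y 0) by rewrite (is_derive_0_is_cst t 0 d2) /z2 mulr0 cos0 sin0 mul1r mul0r subr0.
have cs := cos2Dsin2 (k * t).
apply: complexP; rewrite !complexE /= -e1 -e2 /z1 /z2.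
  transitivity ((cos (k * t) ^+ 2 + sin (k * t) ^+ 2) * Re (y t)); last by ring.
  by rewrite cs mul1r.
transitivity ((cos (k * t) ^+ 2 + sin (k * t) ^+ 2) * Im (y t)); last by ring.
by rewrite cs mul1r.
Qed.

Lemma cexpi_int (p : int) : cexpi (p%:~R * (2 * pi)) = 1 :> C.
Proof.
have en (m : nat) : cexpi (m%:R * (2 * pi)) = 1 :> C.
  elim: m => [|m IH]; first by rewrite mul0r cexpi0.
  rewrite -natr1 mulrDl mul1r cexpiD IH mul1r; apply: complexP => /=.
    by rewrite mulr_natl cos2pi.
  by rewrite mulr_natl sin2pi.
case: p => m; first exact: en.
have := cexpiD ((Negz m)%:~R * (2 * pi) : R) (m.+1%:R * (2 * pi)).
have -> : (Negz m)%:~R * (2 * pi) + m.+1%:R * (2 * pi) = 0 :> R.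
  by rewrite NegzE mulrNz mulNr addrC subrr.
by rewrite cexpi0 en mulr1 => <-.
Qed.

(** Multiplying [X' = A X] by a constant left eigenvector makes every entry of [l X] solve the same
    scalar equation, so uniqueness is needed only for that equation. *)
Lemma left_eigen_monodromy n (A X : R -> 'M[C]_n) (l : 'rV[C]_n) k :
  (forall x, l *m A x = imag k *: l) -> fundamental_matrix A X ->
  forall t, l *m X t = cexpi (k * t) *: l.
Proof.
move=> lA [X0 dX] t; apply/rowP => j.
have dy s : is_cderive (fun s => (l *m X s) 0 j) s (imag k * (l *m X s) 0 j).
  have -> : (fun s => (l *m X s) 0 j) = fun s => \sum_(i < n) l 0 i * X s i j.
    by apply/funext => u; rewrite mxE.
  have := is_cderive_sum (fun i => l 0 i) (fun i => dX s i j).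
  suff -> : \sum_(i < n) l 0 i * (A s *m X s) i j = imag k * (l *m X s) 0 j by [].
  have -> : \sum_(i < n) l 0 i * (A s *m X s) i j = (l *m (A s *m X s)) 0 j by rewrite mxE.
  by rewrite mulmxA lA -scalemxAl mxE.
by rewrite (exp_ode dy t) X0 mulmx1 mxE.
Qed.

(** [l] lies in the left kernel of the matrix. A shift of [k] by a multiple of [kappa] leaves
    [exp (i k T)] unchanged. *)
Lemma evans_root n kappa (A X : R -> 'M[C]_n) (l : 'rV[C]_n) k (p : int) :
  kappa != 0 -> l != 0 ->
  (forall x, l *m A x = imag k *: l) -> fundamental_matrix A X ->
  evans kappa (X (period kappa)) (k + p%:~R * kappa) = 0.
Proof.
move=> kap0 l0 lA fX; rewrite /evans; apply/eqP/det0P; exists l => //.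
rewrite mulmxBr (left_eigen_monodromy lA fX) mul_mx_scalar mulrDl cexpiD.
have -> : p%:~R * kappa * period kappa = p%:~R * (2 * pi).
  by rewrite /period; field.
by rewrite cexpi_int mulr1 subrr.
Qed.

End Monodromy.

Section ModesInCoordinates.
Context {R : realType}.
Local Notation C := R[i].
Local Notation state := (@state R).
Variables (beta kappa sigma tau : R) (w : @wave R).
Hypotheses (beta_gt0 : 0 < beta) (mu0_gt0 : 0 < mu0 beta kappa).
Hypothesis eta0 : forall x, etab w x = 0.
Hypothesis phi0 : forall x y, 0 <= y <= 1 ->
  [/\ dx (phib w) x y = 0, dy (phib w) x y = 0 & dy (dy (phib w)) x y = 0].
Hypothesis mu_w : mub w = mu0 beta kappa.
Variables (P : state -> state) (W : R -> state -> state).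
Hypothesis projP : spectral_projection beta kappa sigma P.
Hypothesis redW : is_reduction beta kappa sigma P w (imag tau) W.
Variables (m : nat) (B : 'I_m -> state).
Hypothesis basisB : Y_basis (Ysigma beta kappa sigma) B.
Local Notation F := (disprel beta (mu0 beta kappa)).
Local Notation md := (mode beta sigma tau P).

Lemma coord_unique (a b : 'I_m -> C) :
  eqY (\sum_(i < m) a i *: B i) (\sum_(i < m) b i *: B i) -> a =1 b.
Proof.
move=> e i; have [_ free _] := basisB; apply/eqP; rewrite -subr_eq0; apply/eqP.
apply: (free (fun i => a i - b i)); have := eqYB e (eqY_refl (\sum_(i < m) b i *: B i)).
by rewrite subrr -sumrB; under eq_bigr do rewrite -scalerBl.
Qed.

Lemma mode_coord n (k : 'I_n -> R) :
  exists M : 'M[C]_(m, n), forall i, eqY (md (k i)) (\sum_(j < m) M j i *: B j).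
Proof.
have [_ _ span] := basisB.
have /choice[a ha] i := span _ (mode_Ysigma tau beta_gt0 projP (k i)).
exists (\matrix_(j, i) a i j) => i; apply: (eqY_trans (ha i)).
by apply: eqY_sum => j; rewrite mxE; exact: eqY_refl.
Qed.

Lemma mode_coord_free n (k : 'I_n -> R) (M : 'M[C]_(m, n)) : sigma + tau != 0 -> injective k ->
  (forall i, (sigma + tau - k i) ^+ 2 = F (k i)) ->
  (forall i, eqY (md (k i)) (\sum_(j < m) M j i *: B j)) -> row_free M^T.
Proof.
move=> s0 kinj disp hM; apply: inj_row_free => u u0; apply/rowP => i; rewrite [RHS]mxE.
apply: (mode_free beta_gt0 mu0_gt0 eta0 phi0 mu_w projP redW s0 kinj disp (c := fun i => u 0 i)).
apply: (eqY_trans (eqY_sum (fun i => eqYZ (u 0 i) (hM i)))).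
have -> : \sum_(i < n) u 0 i *: (\sum_(j < m) M j i *: B j)
   = \sum_(j < m) (u *m M^T) 0 j *: B j.
  under eq_bigr do rewrite scaler_sumr; rewrite exchange_big /=; apply: eq_bigr => j _.
  by rewrite mxE scaler_suml; apply: eq_bigr => l _; rewrite mxE scalerA.
by rewrite u0 big1 => [|j _]; [exact: eqY_refl|rewrite mxE scale0r].
Qed.

Lemma dispersion_roots_le n (k : 'I_n -> R) : sigma + tau != 0 -> injective k ->
  (forall i, (sigma + tau - k i) ^+ 2 = F (k i)) -> (n <= m)%N.
Proof.
move=> s0 kinj disp; have [M hM] := mode_coord k.
have := mode_coord_free s0 kinj disp hM; rewrite /row_free => /eqP <-; exact: rank_leq_col.
Qed.

(** With as many roots as dimensions, the matrix [M] of mode coordinates is invertible, and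
    [A x M = M D] with [M] and the diagonal [D] independent of [x]. The rows of the inverse of [M]
    are the left eigenvectors. *)
Lemma coeff_left_eigen (k : 'I_m -> R) (A : R -> 'M[C]_m) : sigma + tau != 0 -> injective k ->
  (forall i, (sigma + tau - k i) ^+ 2 = F (k i)) ->
  is_coeff_matrix beta kappa sigma P w (imag tau) W B A ->
  forall i, exists2 l : 'rV[C]_m, l != 0 & forall x, l *m A x = imag (k i) *: l.
Proof.
move=> s0 kinj disp hA i; have [M hM] := mode_coord k.
have := mode_coord_free s0 kinj disp hM; rewrite row_free_unit unitmx_tr => uM.
have AM x : A x *m M = M *m diag_mx (\row_i imag (k i)).
  apply/matrixP => a j; move: a; apply: coord_unique.
  have [SB _ _] := basisB.
  have S0 := Ysigma0 beta kappa sigma.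
  have Slin : forall (a : C) U V, Ysigma beta kappa sigma U -> Ysigma beta kappa sigma V ->
    Ysigma beta kappa sigma (a *: U + V) by move=> a U V; exact: Ysigma_lin.
  have sM : Ysigma beta kappa sigma (\sum_(l < m) M l j *: B l) by exact: closed_sum.
  have [_ e2] := mode_split beta_gt0 mu0_gt0 eta0 phi0 mu_w projP redW x (disp j).
  have sj := mode_Ysigma tau beta_gt0 projP (k j).
  have e3 := reduced_eq mu0_gt0 eta0 phi0 mu_w projP redW x sj sM (hM j).
  have rlin := reduced_lin mu0_gt0 eta0 phi0 mu_w projP redW x.
  have e4 := eqY_lin_sum S0 Slin rlin (fun l => M l j) SB.
  have e5 := eqY_sum (fun l => eqYZ (M l j) (hA x l)).
  have e6 := eqY_trans (eqY_sym e2) (eqY_trans e3 (eqY_trans e4 e5)).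
  have e7 := eqY_trans (eqY_sym e6) (eqYZ (imag (k j)) (hM j)).
  have -> : \sum_(l < m) (A x *m M) l j *: B l = \sum_(l < m) M l j *: (\sum_(a < m) A x a l *: B a).
    under [RHS]eq_bigr do rewrite scaler_sumr; rewrite [RHS]exchange_big /=; apply: eq_bigr => a _.
    by rewrite mxE scaler_suml; apply: eq_bigr => l _; rewrite scalerA mulrC.
  have -> : \sum_(l < m) (M *m diag_mx (\row_i0 imag (k i0))) l j *: B l
      = imag (k j) *: (\sum_(l < m) M l j *: B l).
    by rewrite scaler_sumr; apply: eq_bigr => l _; rewrite mul_mx_diag !mxE scalerA mulrC.
  exact: e7.
exists (row i (invmx M)).
  apply/eqP => l0; have := congr1 (fun l => l *m M) l0.
  rewrite -row_mul mulVmx // mul0mx => /rowP /(_ i); rewrite !mxE eqxx /= => /eqP.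
  by rewrite oner_eq0.
move=> x; rewrite -row_mul.
have -> : invmx M *m A x = diag_mx (\row_i0 imag (k i0)) *m invmx M.
  by rewrite -[A x](mulmxK uM) AM !mulmxA mulVmx // mul1mx.
by apply/rowP => j; rewrite mul_diag_mx !mxE.
Qed.

End ModesInCoordinates.

(** * The discriminant *)

Section AnalyticGerms.
Context {R : realType}.
Local Notation C := R[i].
Implicit Types (q rho M : R).

Lemma cmod_sum n (f : 'I_n -> C) : cmod (\sum_(i < n) f i) <= \sum_(i < n) cmod (f i).
Proof.
elim: n f => [|n IH] f; first by rewrite !big_ord0 cmod0.
by rewrite !big_ord_recl (le_trans (cmodD _ _)) // lerD2l.
Qed.

Lemma cmodB_sym (a b : C) : cmod (a - b) = cmod (b - a).
Proof.
have e : cmod (a - b) ^+ 2 = cmod (b - a) ^+ 2 by rewrite !cmod_sqr !complexE /=; ring.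
by apply/eqP; rewrite -(eqrXn2 (n := 2)) ?cmod_ge0 // e.
Qed.

Lemma cmodX (a : C) n : cmod (a ^+ n) = cmod a ^+ n.
Proof.
elim: n => [|n IH]; last by rewrite !exprS cmodM IH.
by rewrite !expr0 /cmod /= expr1n expr0n addr0 sqrtr1.
Qed.

Lemma cmodR (x : R) : cmod (x%:C%C) = `|x|.
Proof. by rewrite /cmod /= expr0n addr0 sqrtr_sqr. Qed.

Lemma cmod_imag (x : R) : cmod (imag x) = `|x|.
Proof. by rewrite /cmod /= expr0n add0r sqrtr_sqr. Qed.

Lemma triple_sum_head n (a : nat -> nat -> nat -> C) (b : nat -> nat -> nat -> R) :
  (forall i j k, cmod (a i j k) <= b i j k) ->
  cmod (\sum_(i < n.+1) \sum_(j < n.+1) \sum_(k < n.+1) a i j k - a 0%N 0%N 0%N)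
  <= \sum_(i < n.+1) \sum_(j < n.+1) \sum_(k < n.+1) b i j k - b 0%N 0%N 0%N.
Proof.
move=> ab; rewrite big_ord_recl [X in _ <= X - _]big_ord_recl.
rewrite [\sum_(j < n.+1) \sum_(k < n.+1) a (@ord0 n) j k]big_ord_recl.
rewrite [\sum_(j < n.+1) \sum_(k < n.+1) b (@ord0 n) j k]big_ord_recl.
rewrite [\sum_(k < n.+1) a (@ord0 n) (@ord0 n) k]big_ord_recl.
rewrite [\sum_(k < n.+1) b (@ord0 n) (@ord0 n) k]big_ord_recl /=.
have drop (V : zmodType) (x y z t : V) : x + y + z + t - x = y + z + t.
  by rewrite -[x + y + z]addrA -[x + (y + z) + t]addrA [x + _]addrC addrK.
rewrite !drop.
apply: (le_trans (cmodD _ _)); apply: lerD.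
  apply: (le_trans (cmodD _ _)); apply: lerD.
    by apply: (le_trans (cmod_sum _)); apply: ler_sum => k _; exact: ab.
  apply: (le_trans (cmod_sum _)); apply: ler_sum => j _.
  by apply: (le_trans (cmod_sum _)); apply: ler_sum => k _; exact: ab.
apply: (le_trans (cmod_sum _)); apply: ler_sum => i _.
apply: (le_trans (cmod_sum _)); apply: ler_sum => j _.
by apply: (le_trans (cmod_sum _)); apply: ler_sum => k _; exact: ab.
Qed.

(** The sum is at most [1 / (1 - q) <= 1 + 2 q], and [(1 + 2 q)^3 = 1 + 6 q + 12 q^2 + 8 q^3] with
    [12 q^2 <= 6 q] and [8 q^3 <= 2 q]. *)
Lemma geometric_cube q n : 0 <= q -> q <= 1 / 2 -> (\sum_(i < n) q ^+ i) ^+ 3 <= 1 + 14 * q.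
Proof.
move=> q0 q1; set G := \sum_(i < n) _.
have G0 : 0 <= G by apply: sumr_ge0 => i _; exact: exprn_ge0.
have G1 : G <= 1 + 2 * q.
  have e : G * (1 - q) = 1 - q ^+ n.
    rewrite /G; elim: n {G G0} => [|n IH]; first by rewrite big_ord0 mul0r expr0 subrr.
    by rewrite big_ord_recr /= mulrDl IH exprS; ring.
  have qn : 0 <= q ^+ n by exact: exprn_ge0.
  have h : G * (1 - q) <= 1 by rewrite e; lra.
  clear e; nra.
have G2 : G ^+ 3 <= (1 + 2 * q) ^+ 3 by rewrite lerXn2r // nnegrE; lra.
apply: (le_trans G2); rewrite !exprS expr0 mulr1; nra.
Qed.

Lemma analytic_lipschitz (f : C -> R -> R -> C) : analytic_at0 f ->
  exists K rho : R, 0 < rho /\ forall (t : R) d g e, 0 <= t -> t < rho ->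
    cmod d <= t -> `|g| <= t -> `|e| <= t -> cmod (f d g e - f 0 0 0) <= K * t.
Proof.
move=> [rho [M [c [rho0 cM fc]]]].
have M0 : 0 <= M by apply: le_trans (cM 0%N 0%N 0%N); rewrite expr0 mulr1 cmod_ge0.
have key (t : R) d g e : 0 <= t -> t < rho / 2 -> cmod d <= t -> `|g| <= t -> `|e| <= t ->
    cmod (f d g e - c 0%N 0%N 0%N) <= 14 * M / rho * t.
  move=> t0 tr dt gt et.
  have lim0 := fc d g e _ _ _; set q := t / rho.
  have q0 : 0 <= q by rewrite divr_ge0 // ltW.
  have q1 : q <= 1 / 2 by rewrite ler_pdivrMr // ltW // mulrC mulrA mulr1.
  have tr' : t < rho by apply: (lt_le_trans tr); lra.
  have {lim0} lim0 := lim0 (le_lt_trans dt tr') (le_lt_trans gt tr') (le_lt_trans et tr').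
  pose S N := \sum_(i < N) \sum_(j < N) \sum_(k < N) c i j k * d ^+ i * g%:C%C ^+ j * e%:C%C ^+ k.
  change ((fun N => cmod (S N - f d g e)) @ \oo --> (0 : R)) in lim0.
  have tq : t = q * rho by rewrite /q divfK // gt_eqF.
  have SN n : cmod (S n.+1 - c 0%N 0%N 0%N) <= M * (14 * q).
    have h := @triple_sum_head n (fun i j k => c i j k * d ^+ i * g%:C%C ^+ j * e%:C%C ^+ k)
      (fun i j k => M * (q ^+ i * q ^+ j * q ^+ k)).
    have {h} := h _; rewrite !expr0 !mulr1 => h.
    apply: (le_trans (h _)) => {h} => [i j k|].
      rewrite !cmodM !cmodX !cmodR.
      have -> : q ^+ i * q ^+ j * q ^+ k = t ^+ (i + j + k) / rho ^+ (i + j + k).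
        by rewrite -!exprD -expr_div_n.
      have p0 : 0 < rho ^+ (i + j + k) by exact: exprn_gt0.
      rewrite mulrA ler_pdivlMr //.
      have pw : cmod d ^+ i * `|g| ^+ j * `|e| ^+ k <= t ^+ (i + j + k).
        rewrite !exprD; apply: ler_pM; [|exact: exprn_ge0| |by rewrite lerXn2r ?nnegrE].
          by rewrite mulr_ge0 ?exprn_ge0 ?cmod_ge0.
        by apply: ler_pM; rewrite ?exprn_ge0 ?cmod_ge0 ?lerXn2r ?nnegrE ?cmod_ge0.
      have -> : cmod (c i j k) * cmod d ^+ i * `|g| ^+ j * `|e| ^+ k * rho ^+ (i + j + k)
        = (cmod (c i j k) * rho ^+ (i + j + k)) * (cmod d ^+ i * `|g| ^+ j * `|e| ^+ k) by ring.
      apply: ler_pM => //; first by rewrite mulr_ge0 ?cmod_ge0 // ltW.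
      by rewrite !mulr_ge0 ?exprn_ge0 ?cmod_ge0.
    have -> : \sum_(i < n.+1) \sum_(j < n.+1) \sum_(k < n.+1) M * (q ^+ i * q ^+ j * q ^+ k)
       = M * (\sum_(i < n.+1) q ^+ i) ^+ 3.
      set G := (\sum_(i < n.+1) q ^+ i).
      transitivity (\sum_(i < n.+1) M * (q ^+ i * G * G)); last first.
        by rewrite -mulr_sumr -mulr_suml -mulr_suml -/G; ring.
      apply: eq_bigr => i _; transitivity (\sum_(j < n.+1) M * (q ^+ i * q ^+ j * G)); last first.
        by rewrite -mulr_sumr -mulr_suml -mulr_sumr.
      by apply: eq_bigr => j _; rewrite -mulr_sumr -mulr_sumr.
    by have := geometric_cube n.+1 q0 q1; nra.
  have -> : 14 * M / rho * t = M * (14 * q) by rewrite /q; field; rewrite gt_eqF.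
  have lim1 : (fun N => cmod (S N - f d g e) + M * (14 * q)) @ \oo --> 0 + M * (14 * q).
    by apply: cvgD => //; exact: cvg_cst.
  rewrite add0r in lim1.
  apply: (ler_cvg_to (cvg_cst _) lim1).
  exists 1%N => // -[//|N] _ /=.
  have -> : f d g e - c 0%N 0%N 0%N = (f d g e - S N.+1) + (S N.+1 - c 0%N 0%N 0%N) by ring.
  by apply: (le_trans (cmodD _ _)); rewrite [cmod (f d g e - _)]cmodB_sym lerD2l.
have f0 : f 0 0 0 = c 0%N 0%N 0%N.
  apply/eqP; rewrite -subr_eq0; apply/eqP; apply: cmod_eq0.
  have := key 0 0 0 0; rewrite cmod0 normr0 mulr0 lexx divr_gt0 // => h.
  by apply/eqP; rewrite eq_le cmod_ge0 andbT h.
exists (14 * M / rho), (rho / 2); split; first by rewrite divr_gt0.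
by rewrite f0.
Qed.

End AnalyticGerms.

Section DiscriminantOrder.
Context {R : realType}.
Local Notation C := R[i].
Local Notation Re := (@complex.Re R).
Local Notation Im := (@complex.Im R).

(** Two distinct roots determine both coefficients of the monic quadratic, by Vieta's formulas. *)
Lemma disc_roots (a1 a0 : R -> R -> C) gamma eps z1 z2 : z1 <> z2 ->
  Wdelta a1 a0 z1 gamma eps = 0 -> Wdelta a1 a0 z2 gamma eps = 0 ->
  disc a1 a0 gamma eps = (z1 - z2) ^+ 2.
Proof.
rewrite /Wdelta /disc; set A := a1 _ _; set B := a0 _ _ => /eqP; rewrite -subr_eq0 => z12 h1 h2.
have e : A = - (z1 + z2).
  apply/eqP; rewrite -addr_eq0; apply/eqP; apply: (mulfI z12).
  transitivity ((z1 ^+ 2 + A * z1 + B) - (z2 ^+ 2 + A * z2 + B)); first by ring.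
  by rewrite h1 h2 subrr mulr0.
have -> : B = z1 * z2.
  transitivity ((z1 ^+ 2 + A * z1 + B) - z1 ^+ 2 - A * z1); first by ring.
  by rewrite h1 e; ring.
by rewrite e; ring.
Qed.

(* Divide by g^2 if n > 2, by g^n otherwise, and let g tend to 0. *)
Lemma order_two (n : nat) (H : R -> C) (q : R -> R) (c : R) : (1 <= n)%N -> c != 0 ->
  H 0 <> 0 ->
  (fun g => Re (H g)) @ 0^' --> Re (H 0) -> (fun g => Im (H g)) @ 0^' --> Im (H 0) ->
  q @ 0^' --> c ->
  (\forall g \near 0^', (g%:C%C : C) ^+ n * H g = - ((g * q g) ^+ 2)%:C%C) ->
  n = 2%N /\ H 0 = (- c ^+ 2)%:C%C.
Proof.
move=> n1 c0 H0 cr ci cq eH.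
have eR : \forall g \near 0^', g ^+ n * Re (H g) = - (g * q g) ^+ 2
    /\ g ^+ n * Im (H g) = 0.
  apply: filterS eH => g; rewrite -rmorphXn /= => e.
  have := congr1 Re e; have := congr1 Im e; rewrite !complexE /= => h1 h2.
  by split; move: h1 h2; rewrite ?mul0r ?mul0r ?subr0 ?addr0 ?oppr0.
have id0 : (fun g : R => g) @ 0^' --> (0 : R) by apply: cvg_within_filter; exact: cvg_id.
have pow0 m : (fun g : R => g ^+ m.+1) @ 0^' --> (0 : R).
  elim: m => [|m IH]; first by apply: (cvg_eq _ id0) => g; rewrite expr1.
  have h : (fun g : R => g * g ^+ m.+1) @ 0^' --> (0 * 0 : R) by exact: (cvgM id0 IH).
  by rewrite mulr0 in h; apply: (cvg_eq _ h) => g; rewrite [RHS]exprS.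
have qq : (fun g => q g * q g) @ 0^' --> c * c by exact: (cvgM cq cq).
have uniq0 (f : R -> R) (a b : R) : f @ 0^' --> a -> f @ 0^' --> b -> a = b.
  by move=> fa fb; rewrite -(cvg_lim (@Rhausdorff R) fa) (cvg_lim (@Rhausdorff R) fb).
have nz : \forall g \near 0^', g != 0 :> R by exact: nbhs_dnbhs_neq.
(* The right side of [eH] is real, so [H g] is real for small nonzero [g], and so is its limit. *)
have Im0 : Im (H 0) = 0.
  apply: (uniq0 _ _ _ ci); apply: cvg_near_cst.
  apply: filterS2 nz eR => g g0 [_ /eqP]; rewrite mulf_eq0 expf_eq0 (negbTE g0) andbF.
  by move/eqP.
case: n n1 eH eR => // -[|[|n]] _ eH eR.
- exfalso; apply: H0; apply: complexP; last by rewrite Im0.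
  apply: (uniq0 _ _ _ cr).
  have l0 : (fun g => - (g * (q g * q g))) @ 0^' --> - (0 * (c * c)).
    by apply: cvgN; exact: (cvgM id0 qq).
  rewrite mul0r oppr0 in l0; apply: cvg_trans l0; apply: near_eq_cvg.
  apply: filterS2 nz eR => g g0 [h _]; apply: (mulfI g0).
  by rewrite -[g in RHS]expr1 h; ring.
- split => //; apply: complexP; last by rewrite Im0 /=.
  apply: (uniq0 _ _ _ cr).
  have l0 : (fun g => - (q g * q g)) @ 0^' --> - (c * c) by exact: cvgN.
  rewrite /= expr2; apply: cvg_trans l0; apply: near_eq_cvg.
  apply: filterS2 nz eR => g g0 [h _]; apply: (mulfI (expf_neq0 2 g0)).
  by rewrite h; ring.
- exfalso; have : - (c * c) = 0 * Re (H 0).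
    apply: (uniq0 (fun g => - (q g * q g))); first exact: cvgN.
    have l0 : (fun g => g ^+ n.+1 * Re (H g)) @ 0^' --> 0 * Re (H 0).
      by apply: cvgM => //; exact: pow0.
    apply: cvg_trans l0; apply: near_eq_cvg.
    apply: filterS2 nz eR => g g0 [h _]; apply: (mulfI (expf_neq0 2 g0)).
    have -> : g ^+ 2 * (g ^+ n.+1 * Re (H g)) = g ^+ n.+3 * Re (H g) by rewrite !exprS; ring.
    by rewrite h; ring.
  by rewrite mul0r => /eqP; rewrite oppr_eq0 mulf_eq0 orbb (negbTE c0).
Qed.

End DiscriminantOrder.

Section Germs.
Context {R : realType}.
Local Notation C := R[i].
Local Notation Re := (@complex.Re R).
Local Notation Im := (@complex.Im R).

Lemma ReIm_le_cmod (z : C) : `|Re z| <= cmod z /\ `|Im z| <= cmod z.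
Proof.
case: z => x y; rewrite /cmod /= -!sqrtr_sqr.
by rewrite !ler_wsqrtr // ?lerDl ?lerDr sqr_ge0.
Qed.

Lemma analytic_cvg (h : R -> R -> C) : analytic_at0 (fun _ => h) ->
  (fun g => Re (h g 0)) @ 0^' --> Re (h 0 0) /\ (fun g => Im (h g 0)) @ 0^' --> Im (h 0 0).
Proof.
move=> /analytic_lipschitz[K [rho [rho0 hK]]].
have near_le : \forall g \near 0^', cmod (h g 0 - h 0 0) <= K * `|g|.
  have : \forall g \near (0 : R)^', `|g| < rho.
    by apply: nbhs_dnbhs; near=> g; rewrite -[g]subr0 distrC; near: g; exact: (@cvgr_dist_lt _ R^o).
  by apply: filterS => g gr; apply: (hK _ 0) => //; rewrite ?cmod0 ?normr0.
have lim0 : (fun g : R => K * `|g|) @ 0^' --> (0 : R).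
  have a : (fun g : R => `|g|) @ 0^' --> (0 : R).
    by rewrite -[X in _ --> X](@normr0 R R); apply: cvg_norm; apply: cvg_within_filter; exact: cvg_id.
  have := cvgMl_tmp (a := K) a; rewrite mulr0; exact.
have squeeze (f : R -> R) (l : R) : (\forall g \near 0^', `|f g - l| <= K * `|g|) ->
    f @ 0^' --> l.
  move=> fl.
  have l1 : (fun g : R => l - K * `|g|) @ 0^' --> l - 0 by apply: cvgB => //; exact: cvg_cst.
  have l2 : (fun g : R => l + K * `|g|) @ 0^' --> l + 0 by apply: cvgD => //; exact: cvg_cst.
  rewrite subr0 in l1; rewrite addr0 in l2; apply: (squeeze_cvgr _ l1 l2).
  by apply: filterS fl => g; rewrite ler_distl.
split; apply: squeeze; apply: filterS near_le => g; apply: le_trans.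
  by have [] := ReIm_le_cmod (h g 0 - h 0 0); rewrite !complexE.
by have [] := ReIm_le_cmod (h g 0 - h 0 0); rewrite !complexE.
Unshelve. all: by end_near. Qed.

Lemma analytic_neq0 (f : C -> R -> R -> C) : analytic_at0 f -> f 0 0 0 <> 0 ->
  exists2 e : R, 0 < e & forall d g, cmod d < e -> `|g| < e -> f d g 0 <> 0.
Proof.
move=> /analytic_lipschitz[K [rho [rho0 fK]]] f0.
have m0 : 0 < cmod (f 0 0 0).
  by rewrite lt_neqAle cmod_ge0 andbT eq_sym; apply/eqP => /cmod_eq0.
have K1 : 0 < `|K| + 1 by rewrite ltr_wpDl.
(* Within this radius the Lipschitz bound is less than [cmod (f 0 0 0)]; the summand 1 keeps the
   denominator positive. *)
pose e := Num.min (rho / 2) (cmod (f 0 0 0) / (2 * (`|K| + 1))).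
have e0 : 0 < e by rewrite lt_min !divr_gt0 // mulr_gt0.
exists e => // d g de ge fd.
have := fK e d g 0 (ltW e0) _ (ltW de) (ltW ge) _.
rewrite fd normr0 sub0r; have -> : cmod (- f 0 0 0) = cmod (f 0 0 0).
  by rewrite -[- _]sub0r cmodB_sym subr0.
have er : e < rho by rewrite gt_min; apply/orP; left; lra.
move=> /(_ er (ltW e0)) h.
have h1 : K * e <= `|K| * e by rewrite ler_wpM2r ?ler_norm // ltW.
have h2 : e * (2 * (`|K| + 1)) <= cmod (f 0 0 0) by rewrite -ler_pdivlMr ?mulr_gt0 // ge_min lexx orbT.
have h3 := normr_ge0 K.
move: h h1 h2 h3 e0 m0; generalize (cmod (f 0 0 0)) `|K| e (K * e) => x y z t; nra.
Qed.

Lemma is_derive_increment (f : R -> R) (x d : R) : is_derive x 1 f d ->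
  (fun h => f (x + h) - f x) @ 0^' --> (0 : R).
Proof.
move=> fd; have id0 : (fun g : R => g) @ 0^' --> (0 : R) by apply: cvg_within_filter; exact: cvg_id.
have l0 : (fun h => h * (h^-1 * (f (x + h) - f x) - d) + h * d) @ 0^' --> 0 * 0 + 0 * d.
  by apply: cvgD; [exact: (cvgM id0 (is_derive_quotient fd))|exact: cvgMr_tmp].
rewrite !mul0r addr0 in l0; apply: cvg_trans l0; apply: near_eq_cvg.
have nz : \forall g \near 0^', g != 0 :> R by exact: nbhs_dnbhs_neq.
apply: filterS nz => h h0; rewrite mulrBr mulrA mulfV // mul1r.
by rewrite subrK.
Qed.

End Germs.

Theorem lemma5p3 (R : realType) (beta kappa : R) (r : R) (w : R -> @wave R)
    (sigma kj kj' kr ks : R)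
    (P : @state R -> @state R) (B : 'I_4 -> @state R)
    (W : R -> @state R -> R[i] -> R -> @state R)
    (A X : R -> R[i] -> R -> 'M[R[i]]_4)
    (p : int) (a1 a0 : R -> R -> R[i]) (h3 : R[i] -> R -> R -> R[i])
    (n : nat) (b : nat -> R -> R[i]) (h : R -> R -> R[i]) :
  0 < beta -> 0 < kappa -> 0 < r ->
  (* the wave *)
  is_wave_family beta kappa r w ->
  nonresonant beta kappa ->
  1 < mu0 beta kappa ->
  (* the resonance *)
  0 < sigma -> ~ critical beta kappa sigma ->
  resonance beta kappa sigma kj kj' 1 ->
  Y_dim (Ysigma beta kappa sigma) 4 ->
  uniq [:: kj; kj'; kr; ks] ->
  (forall k : R, L_eigenvalue beta kappa (imag sigma) (imag k) <->
                 k \in [:: kj; kj'; kr; ks]) ->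
  (forall (k k' : R) (N : int), k \in [:: kr; ks] -> k' \in [:: kj; kj'] ->
     k - k' <> N%:~R * kappa) ->
  (* the reduction and the periodic Evans function *)
  spectral_projection beta kappa sigma P ->
  Ysigma_basis beta kappa sigma B ->
  (forall (delta : R[i]) (eps : R), cmod delta < r -> `|eps| < r ->
     [/\ is_reduction beta kappa sigma P (w eps) delta
           (fun x v => W x v delta eps),
         is_coeff_matrix beta kappa sigma P (w eps) delta
           (fun x v => W x v delta eps) B (fun x => A x delta eps)
       & fundamental_matrix (fun x => A x delta eps) (fun x => X x delta eps)]) ->
  (* the Weierstrass polynomial in delta *)
  analytic_at0 (fun _ => a1) -> analytic_at0 (fun _ => a0) ->
  a1 0 0 = 0 -> a0 0 0 = 0 ->
  analytic_at0 h3 -> h3 0 0 0 <> 0 ->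
  (forall (delta : R[i]) (gamma eps : R),
     cmod delta < r -> `|gamma| < r -> `|eps| < r ->
     evans kappa (X (period kappa) delta eps) (kj + p%:~R * kappa + gamma)
     = Wdelta a1 a0 delta gamma eps * h3 delta gamma eps) ->
  (* the Weierstrass factorization of the discriminant in gamma *)
  (1 <= n)%N ->
  (forall l, (l < n)%N -> analytic_at0 (fun _ _ => b l) /\ b l 0 = 0) ->
  analytic_at0 (fun _ => h) -> h 0 0 <> 0 ->
  (forall gamma eps : R, `|gamma| < r -> `|eps| < r ->
     disc a1 a0 gamma eps = Wgamma n b gamma eps * h gamma eps) ->
  [/\ n = 2%N,
      forall gamma eps : R,
        Wgamma n b gamma eps
        = gamma%:C%C ^+ 2 + b 1%N eps * gamma%:C%C + b 0%N eps
    & h 0 0 < 0].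
Proof.
move=> beta_gt0 kappa_gt0 r_gt0 fam _ m1 sigma_gt0 _ [ej ej' resk _] _ uL eigL _ projP [basisB _].
move=> redA _ _ _ _ h3a h30 evW n1 bl ha h0 discW.
have [eta0 phi0 mu_w] := wave_family_trivial r_gt0 fam.
have m0_gt0 : 0 < mu0 beta kappa by apply: lt_trans m1.
have m0_neq0 := lt0r_neq0 m0_gt0; have beta_neq0 := lt0r_neq0 beta_gt0.
have sigma_neq0 := lt0r_neq0 sigma_gt0.
set m0 := mu0 beta kappa in m0_gt0 m0_neq0.
pose F := disprel beta m0.
have F_kappa : F kappa = kappa ^+ 2.
  have t0 := lt0r_neq0 (tanh_gt0 kappa_gt0).
  have d0 : 1 + beta * kappa ^+ 2 != 0 by rewrite gt_eqF // ltr_pwDl // mulr_ge0 ?sqr_ge0 // ltW.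
  by rewrite /F /disprel /m0 /mu0; field; rewrite t0 d0.
(* The hypothesis lists the imaginary eigenvalues; they are the real roots of the dispersion
   relation, one inclusion coming from [evec]. *)
have rootL k : dispersion_root beta m0 sigma k <-> k \in [:: kj; kj'; kr; ks].
  split=> [disp|/eigL eigk]; last exact: eigenvalue_dispersion.
  have k0 : k != 0.
    apply/eqP => k0; move: disp; rewrite /dispersion_root k0 subr0 disprel0 => /eqP.
    by rewrite sqrf_eq0 (negbTE sigma_neq0).
  apply/eigL; exists (evec beta sigma k); split; first exact: evec_domL.
    move=> [_ _ /eqP + _]; rewrite /s_eta /= fmorph_eq0 mulf_eq0 (negbTE k0) /=.
    by move=> /eqP /sinh_eq0 k00; rewrite k00 eqxx in k0.
  exact: eqp_eqY (evec_eigen beta_neq0 m0_neq0 disp).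
(* Below [r1] the reduction is available and [sigma + tau] stays positive. *)
pose r1 := Num.min r sigma.
have r1_gt0 : 0 < r1 by rewrite lt_min r_gt0.
have redt tau : `|tau| < r1 -> [/\ sigma + tau != 0,
    is_reduction beta kappa sigma P (w 0) (imag tau) (fun x v => W x v (imag tau) 0),
    is_coeff_matrix beta kappa sigma P (w 0) (imag tau) (fun x v => W x v (imag tau) 0) B
      (fun x => A x (imag tau) 0)
  & fundamental_matrix (fun x => A x (imag tau) 0) (fun x => X x (imag tau) 0)].
  rewrite lt_min => /andP[taur]; rewrite ltr_norml => /andP[taus _].
  have [] := redA (imag tau) 0; rewrite ?cmod_imag ?normr0 // => ? ? ?; split => //.
  by rewrite gt_eqF //; move: taus; lra.
have nth_roots (l : seq R) tau : uniq l ->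
    (forall k, k \in l -> dispersion_root beta m0 (sigma + tau) k) ->
    injective (fun i : 'I_(size l) => nth 0 l i)
    /\ forall i : 'I_(size l), (sigma + tau - nth 0 l i) ^+ 2 = F (nth 0 l i).
  move=> ul rl; split; last by move=> i; apply: rl; rewrite mem_nth.
  by move=> i i' /eqP; rewrite nth_uniq // => /eqP; exact: ord_inj.
have at_most_four tau : `|tau| < r1 -> forall l, uniq l ->
    (forall k, k \in l -> dispersion_root beta m0 (sigma + tau) k) -> (size l <= 4)%N.
  move=> /redt[s0 redW _ _] l ul rl; have [linj lF] := nth_roots l tau ul rl.
  exact: (dispersion_roots_le beta_gt0 m0_gt0 eta0 phi0 mu_w projP redW basisB s0 linj lF).
have [e e_gt0 persist] :=
  four_roots_persist beta_gt0 m0_gt0 sigma_gt0 r1_gt0 at_most_four uL erefl rootL.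
(* A root [k] must be one of the four that persist, since a fifth is excluded. The four of them
   diagonalize the coefficient matrix. *)
have evans0 tau k (N : int) : `|tau| < r1 -> `|tau| < e ->
    dispersion_root beta m0 (sigma + tau) k ->
    evans kappa (X (period kappa) (imag tau) 0) (k + N%:~R * kappa) = 0.
  move=> tr te rk; have [l [ul sl rl]] := persist tau te.
  have kl : k \in l.
    apply/negPn/negP => kl; have /(_ (k :: l)) := at_most_four tau tr.
    rewrite /= kl ul sl => /(_ isT) H; suff : (5 <= 4)%N by [].
    by apply: H => k1; rewrite inE => /orP[/eqP ->|/rl].
  have [s0 redW coefA fundX] := redt tau tr.
  have il : (index k l < 4)%N by rewrite -sl index_mem.
  have [linj lF] : injective (fun i : 'I_4 => nth 0 l i)
      /\ forall i : 'I_4, (sigma + tau - nth 0 l i) ^+ 2 = F (nth 0 l i).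
    by rewrite -sl; exact: nth_roots.
  have [v v0 vA] := coeff_left_eigen beta_gt0 m0_gt0 eta0 phi0 mu_w projP redW basisB
    s0 linj lF coefA (Ordinal il).
  rewrite /= nth_index // in vA.
  exact: (evans_root N (lt0r_neq0 kappa_gt0) v0 vA fundX).
have branch k : dispersion_root beta m0 sigma k ->
    k != 0 /\ exists s : bool, sigma = k + (-1) ^+ s * omega beta m0 k.
  move=> rk; split.
    apply/eqP => k0; move: rk; rewrite /dispersion_root k0 subr0 disprel0 => /eqP.
    by rewrite sqrf_eq0 (negbTE sigma_neq0).
  have [->|sl] := (dispersion_branches beta_gt0 m0_gt0 sigma k).1 rk.
    by exists false; rewrite expr0 mul1r.
  by exists true; move: sl; rewrite /slow expr1 mulN1r; lra.
have [kj0 [s sj]] := branch kj (eigenvalue_dispersion beta_gt0 m0_gt0 sigma_neq0 ej).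
have [kj'0 [s' sj']] := branch kj' (eigenvalue_dispersion beta_gt0 m0_gt0 sigma_neq0 ej').
have kjkj' : kj - kj' = kappa by rewrite resk mul1r.
(* The sign [s] selects the branch, [false] being the fast and [true] the slow one; [c] is its
   slope. *)
pose f (s : bool) (k : R) := k + (-1) ^+ s * omega beta m0 k.
pose c (s : bool) (k : R) := 1 + (-1) ^+ s * group_speed beta m0 `|k|.
have df (s1 : bool) (k : R) : k != 0 -> is_derive k 1 (f s1) (c s1 k).
  move=> k0; exact: (is_deriveD (is_derive_id k 1) (is_deriveZ ((-1) ^+ s1) (is_derive_omega beta_gt0 m0_gt0 k0))).
have speeds : c s kj - c s' kj' != 0.
  rewrite subr_eq0; apply/eqP.
  exact: (resonant_speeds_neq beta_gt0 m0_gt0 kappa_gt0 F_kappa sigma_gt0 r1_gt0 at_most_four kjkj' sj sj').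
(* The shifts of [sigma] that turn [kj + g] and [kj' + g] into roots; [imag (t1 g)] and
   [imag (t2 g)] will be the zeros of the Weierstrass polynomial in [delta]. *)
pose t1 g := f s (kj + g) - f s kj; pose t2 g := f s' (kj' + g) - f s' kj'.
have root1 g : dispersion_root beta m0 (sigma + t1 g) (kj + g).
  rewrite /dispersion_root /t1 -[f s kj]sj /f.
  have -> : sigma + (kj + g + (-1) ^+ s * omega beta m0 (kj + g) - sigma) - (kj + g)
    = (-1) ^+ s * omega beta m0 (kj + g) by ring.
  by rewrite exprMn sqrr_sign mul1r omega_sqr.
have root2 g : dispersion_root beta m0 (sigma + t2 g) (kj' + g).
  rewrite /dispersion_root /t2 -[f s' kj']sj' /f.
  have -> : sigma + (kj' + g + (-1) ^+ s' * omega beta m0 (kj' + g) - sigma) - (kj' + g)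
    = (-1) ^+ s' * omega beta m0 (kj' + g) by ring.
  by rewrite exprMn sqrr_sign mul1r omega_sqr.
have t10 := is_derive_increment (df s kj kj0); have t20 := is_derive_increment (df s' kj' kj'0).
(* Its limit is the difference of the slopes. This being nonzero both separates the two zeros and
   fixes the order of the discriminant. *)
pose q g := g^-1 * t1 g - g^-1 * t2 g.
have qc : q @ 0^' --> c s kj - c s' kj'.
  have l1 := is_derive_quotient (df s kj kj0); have l2 := is_derive_quotient (df s' kj' kj'0).
  have l0 : (fun g => (g^-1 * t1 g - c s kj) - (g^-1 * t2 g - c s' kj') + (c s kj - c s' kj')) @ 0^'
      --> 0 - 0 + (c s kj - c s' kj').
    by apply: cvgD; [exact: (cvgB l1 l2)|exact: cvg_cst].
  rewrite subrr add0r in l0; apply: (cvg_eq _ l0) => g; rewrite /q; ring.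
have [e3 e3_gt0 h3_neq0] := analytic_neq0 h3a h30.
pose d := Num.min (Num.min r1 e) e3.
have d_gt0 : 0 < d by rewrite lt_min e3_gt0 andbT lt_min r1_gt0.
have near_small (t : R -> R) : t @ 0^' --> (0 : R) -> \forall g \near 0^', `|t g| < d.
  by move=> tl; apply: (@cvgr0_norm_lt _ R^o _ _ _ t tl d d_gt0).
have id0 : (fun g : R => g) @ 0^' --> (0 : R) by apply: cvg_within_filter; exact: cvg_id.
have q_neq0 : \forall g \near 0^', q g != 0 by exact: (@cvgr_neq0 _ R^o _ _ _ q _ qc speeds).
have nz : \forall g \near 0^', g != 0 :> R by exact: nbhs_dnbhs_neq.
have [hr hi] := analytic_cvg ha.
have [|n2 h00] := @order_two _ n (fun g => h g 0) q _ n1 speeds h0 hr hi qc.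
  near=> g.
  have [sg1 sg2 sg] : [/\ `|t1 g| < d, `|t2 g| < d & `|g| < d].
    by split; near: g; [exact: near_small|exact: near_small|exact: (near_small (fun g => g))].
  have g0 : g != 0 by near: g.
  have qg : q g != 0 by near: g.
  move: sg1 sg2 sg; rewrite !lt_min.
  move=> /andP[/andP[/andP[t1r t1s] t1e] t13] /andP[/andP[/andP[t2r t2s] t2e] t23].
  move=> /andP[/andP[/andP[gr _] _] g3].
  have W1 : Wdelta a1 a0 (imag (t1 g)) g 0 = 0.
    have := evW (imag (t1 g)) g 0; rewrite cmod_imag normr0 => /(_ t1r gr r_gt0).
    have -> : kj + p%:~R * kappa + g = kj + g + p%:~R * kappa by ring.
    rewrite evans0 //; last by rewrite lt_min t1r.
    move=> /esym/eqP; rewrite mulf_eq0 => /orP[/eqP //|/eqP h3z].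
    by have := h3_neq0 (imag (t1 g)) g; rewrite cmod_imag => /(_ t13 g3).
  have W2 : Wdelta a1 a0 (imag (t2 g)) g 0 = 0.
    have := evW (imag (t2 g)) g 0; rewrite cmod_imag normr0 => /(_ t2r gr r_gt0).
    (* The resonance enters here: the same Floquet exponent belongs to the second curve, shifted by
       one more [kappa]. *)
    have -> : kj + p%:~R * kappa + g = kj' + g + (p + 1)%:~R * kappa.
      by rewrite intrD mulrDl mul1r -{3}kjkj'; ring.
    rewrite evans0 //; last by rewrite lt_min t2r.
    move=> /esym/eqP; rewrite mulf_eq0 => /orP[/eqP //|/eqP h3z].
    by have := h3_neq0 (imag (t2 g)) g; rewrite cmod_imag => /(_ t23 g3).
  have gq : g * q g = t1 g - t2 g by rewrite /q -mulrBr mulrA mulfV // mul1r.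
  have z12 : imag (t1 g) <> imag (t2 g).
    move=> /(congr1 (@complex.Im R)) /= t12; move: qg; rewrite /q t12 subrr eqxx; exact.
  have := discW g 0; rewrite normr0 => /(_ gr r_gt0).
  (* At [eps = 0] the coefficients [b l] vanish, so the Weierstrass polynomial in [gamma] is the
     pure power [g ^+ n]. *)
  rewrite (disc_roots z12 W1 W2) /Wgamma big1; last by move=> l _; rewrite (bl l (ltn_ord l)).2 mul0r.
  rewrite addr0 => <-; rewrite gq.
  by apply: complexP; rewrite expr2 !complexE /=; ring.
split => //.
- move=> g eps; rewrite /Wgamma n2 !big_ord_recl big_ord0 /= expr0 mulr1 expr1 addr0.
  by rewrite -addrA; congr (_ + _); rewrite addrC.
- have -> : 0 = (0 : R)%:C%C by [].
  by rewrite h00 ltcR oppr_lt0 exprn_even_gt0.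
Unshelve. all: by end_near. Qed.
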